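(* Let $K$ be a field of characteristic 0 and let $f\in K[X]$ be a separable polynomial of odd degree $d\geq 3$. Let $C$ be the (projective) curve defined by $Y^{2}=f$, and let $J$ be the Jacobian of the normalization of $C$. Let $L=K(J[2])$ and let $G_{2}$ be a 2-Sylow subgroup of $\mathrm{Gal}(L/K)$. Then the following are equivalent. (1) The group $H^{1}(G_{2},J[2])$ is trivial. (2) The group $J[2]$ is cohomologically trivial as a $G_{2}$-module. (3) The group $J[2]$ is cohomologically trivial as a $\mathrm{Gal}(L/K)$-module. (4) Let $W$ be the subfield of $L$ fixed by $G_{2}$. In $W[X]$, the polynomial $f$ is the product of one linear factor and $(d-1)/\#G_{2}$ irreducible factors, each of degree $\#G_{2}$. (5) Let $\alpha_{i}$, for $1\leq i\leq d$, be the roots of $f$. For all $i\neq j$, the degree of $L$ over $K(\alpha_{i},\alpha_{j})$ is odd.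
   Context: For a finite group $G$, a $G$-module $N$ is cohomologically trivial if the Tate cohomology groups $\hat H^i(H,N)$ vanish for all integers $i$ and all subgroups $H\subseteq G$. *)

(* Defs.v *)
From HB Require Import structures.
From mathcomp Require Import all_boot all_order all_fingroup all_algebra.
From mathcomp Require Import all_solvable all_field qfpoly.
From mathcomp Require Import boolp generic_quotient ring_quotient freeg.

Set Implicit Arguments.
Unset Strict Implicit.
Unset Printing Implicit Defensive.

Import Order.TTheory GRing.Theory Num.Theory.
Local Open Scope ring_scope.
Local Open Scope quotient_scope.

(******************************************************************************)
(*     Tate cohomology of a finite group G with coefficients in a G-module.   *)
(*                                                                            *)
(* Modules are right modules, act (g * h) m = act h (act g m), following      *)
(* the composition order of permutations and of Galois automorphisms          *)
(* ((g * h) x = h (g x), see galM).  The Tate groups are those of the         *)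
(* two-sided standard complex                                                 *)
(*   ... -> C_2 --bound 1--> C_1 --bound 0--> C_0 --norm--> C^0               *)
(*                               --cobound 0--> C^1 --cobound 1--> C^2 -> ... *)
(* where C_n = M (x) Z[G^n] and C^n = Map(G^n, M) are both represented by the *)
(* functions from n-tuples to M; C^n is in degree n and C_n in degree -n-1.   *)
(******************************************************************************)
Section TateCohomology.

Variables (gT : finGroupType) (M : zmodType) (act : gT -> M -> M).

Local Notation chain n := {ffun n.-tuple gT -> M}.

(* On (g_1, ..., g_(n+1)): drops g_1 if i = 0, drops g_(n+1) if i = n + 1,    *)
(* and replaces g_i, g_(i+1) by g_i * g_(i+1) otherwise.                      *)
Definition face n (i : nat) (g : n.+1.-tuple gT) : n.-tuple gT :=
  [tuple if (j.+1 < i)%N then nth 1%g g j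
         else if j.+1 == i then (nth 1%g g j * nth 1%g g j.+1)%g
         else nth 1%g g j.+1 | j < n].

Definition cobound n (c : chain n) : chain n.+1 :=
  [ffun g : n.+1.-tuple gT =>
     \sum_(i < n.+2)
        (if i == ord_max then act (last 1%g g) (c (face i g))
         else c (face i g)) *~ (-1) ^+ i].

Definition bound n (c : chain n.+1) : chain n :=
  [ffun h : n.-tuple gT =>
     \sum_(g : n.+1.-tuple gT) \sum_(i < n.+2 | face i g == h)
        (if i == ord0 then act (thead g) (c g) else c g) *~ (-1) ^+ i].

Definition norm (c : chain 0) : chain 0 :=
  [ffun t => \sum_(g : gT) act g (c t)].

Definition exact_at (A B C : zmodType) (d : A -> B) (d' : B -> C) : Prop :=
  forall b, d' b = 0 -> exists a, d a = b.

Definition tate_vanish (i : int) : Prop :=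
  match i with
  | Posz 0 => exact_at norm (@cobound 0)
  | Posz n.+1 => exact_at (@cobound n) (@cobound n.+1)
  | Negz 0 => exact_at (@bound 0) norm
  | Negz n.+1 => exact_at (@bound n.+1) (@bound n)
  end.

Definition H1_vanish : Prop := exact_at (@cobound 0) (@cobound 1).

End TateCohomology.

Definition res_act (gT : finGroupType) (M : zmodType) (act : gT -> M -> M)
  (H : {group gT}) : subg_of H -> M -> M := fun h => act (sgval h).
Arguments res_act {gT M} act H h m : simpl never.

Definition coh_trivial (gT : finGroupType) (M : zmodType)
    (act : gT -> M -> M) (G : {group gT}) : Prop :=
  forall H : {group gT}, H \subset G -> forall i : int,
    tate_vanish (res_act act H) i.

Section Torsion.

Variables (M : zmodType) (n : nat).

Definition torsion_pred : {pred M} := fun x => x *+ n == 0.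

Fact torsion_zmod_closed : zmod_closed torsion_pred.
Proof.
split=> [|x y]; rewrite unfold_in ?mul0rn // => /eqP x0 /eqP y0.
by rewrite unfold_in mulrnBl x0 y0 subrr.
Qed.
HB.instance Definition _ :=
  GRing.isZmodClosed.Build M torsion_pred torsion_zmod_closed.

Record torsion : predArgType :=
  Torsion { torsion_val : M; _ : torsion_val \in torsion_pred }.
HB.instance Definition _ := [isSub for torsion_val].
HB.instance Definition _ := [Choice of torsion by <:].
HB.instance Definition _ := [SubChoice_isSubZmodule of torsion by <:].

End Torsion.

Local Notation "p %:F" := (FracField.tofrac p) : ring_scope.

Section RatMap.

Variables (k : fieldType) (s : {rmorphism k -> k}).

Definition rat_map (u : {fraction {poly k}}) : {fraction {poly k}} :=
  (map_poly s \n_(repr u))%:F / (map_poly s \d_(repr u))%:F.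

Lemma frac_numden (u : {fraction {poly k}}) :
  u = (\n_(repr u))%:F / (\d_(repr u))%:F.
Proof.
have dnz : (\d_(repr u))%:F != 0 :> {fraction {poly k}}.
  by rewrite tofrac_eq0 denom_ratioP.
apply: (mulIf dnz); rewrite divfK //.
rewrite -{1}[u]reprK; set r := repr u.
unlock FracField.tofrac; rewrite -[LHS]FracField.pi_mul; apply/eqmodP.
have rnz : \d_r != 0 by apply: denom_ratioP.
rewrite /= FracField.equivfE /FracField.mulf.
by rewrite !(numden_Ratio, mulr1, mul1r) ?oner_eq0 // mulrC.
Qed.

Lemma rat_mapE (n d : {poly k}) : d != 0 ->
  rat_map (n%:F / d%:F) = (map_poly s n)%:F / (map_poly s d)%:F.
Proof.
move=> dnz; rewrite /rat_map; set u := n%:F / d%:F; set r := repr u.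
have rnz : \d_r != 0 by apply: denom_ratioP.
have snz (p : {poly k}) : p != 0 -> (map_poly s p)%:F != 0 :> {fraction {poly k}}.
  by rewrite tofrac_eq0 map_poly_eq0.
have tnz (p : {poly k}) : p != 0 -> p%:F != 0 :> {fraction {poly k}}.
  by rewrite tofrac_eq0.
apply/eqP; rewrite eqr_div ?snz // -!rmorphM /= tofrac_eq.
have /eqP : u = (\n_r)%:F / (\d_r)%:F by apply: frac_numden.
by rewrite /u eqr_div ?tnz // -!rmorphM /= tofrac_eq => /eqP <-.
Qed.

Lemma rat_map_tofrac p : rat_map p%:F = (map_poly s p)%:F.
Proof.
by rewrite -[p%:F]divr1 -[1]/(1%:F) rat_mapE ?oner_eq0 // rmorph1 divr1.
Qed.

Fact rat_map_zmod_morphism : zmod_morphism rat_map.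
Proof.
move=> u w; rewrite [u]frac_numden [w]frac_numden.
set n := \n_(repr u); set d := \d_(repr u).
set m := \n_(repr w); set e := \d_(repr w).
have dnz : d != 0 by apply: denom_ratioP.
have enz : e != 0 by apply: denom_ratioP.
have subf_div (F : fieldType) (x y z t : F) : y != 0 -> t != 0 ->
    x / y - z / t = (x * t - z * y) / (y * t).
  by move=> y0 t0; rewrite -mulNr addf_div // mulNr.
rewrite subf_div ?tofrac_eq0 // -!rmorphM -rmorphB /= !rat_mapE ?mulf_neq0 //.
rewrite subf_div ?tofrac_eq0 ?map_poly_eq0 //.
by rewrite -!rmorphM -rmorphB /= !rmorphB !rmorphM.
Qed.

Fact rat_map_monoid_morphism : monoid_morphism rat_map.
Proof.
split=> [|u w]; first by rewrite -[1]/(1%:F) rat_map_tofrac rmorph1.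
rewrite [u]frac_numden [w]frac_numden.
set n := \n_(repr u); set d := \d_(repr u).
set m := \n_(repr w); set e := \d_(repr w).
have dnz : d != 0 by apply: denom_ratioP.
have enz : e != 0 by apply: denom_ratioP.
rewrite mulf_div -!rmorphM /= !rat_mapE ?mulf_neq0 //.
by rewrite mulf_div -!rmorphM /= !rmorphM.
Qed.

HB.instance Definition _ := GRing.isZmodMorphism.Build
  {fraction {poly k}} {fraction {poly k}} rat_map rat_map_zmod_morphism.
HB.instance Definition _ := GRing.isMonoidMorphism.Build
  {fraction {poly k}} {fraction {poly k}} rat_map rat_map_monoid_morphism.

End RatMap.

Lemma rat_mapK (k : fieldType) (s t : {rmorphism k -> k}) :
  cancel s t -> cancel (rat_map s) (rat_map t).
Proof.
move=> sK u; rewrite {2}/rat_map rat_mapE ?map_poly_eq0 ?denom_ratioP //.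
have mapK p : map_poly t (map_poly s p) = p.
  by rewrite -map_poly_comp /= map_poly_id // => x _ /=; rewrite sK.
by rewrite !mapK -frac_numden.
Qed.

(******************************************************************************)
(* The function field k(C) = k(x)[Y] / (Y^2 - g(x)) of the curve Y^2 = g over *)
(* an algebraically closed field k, for g of odd degree.                      *)
(******************************************************************************)
Section FunctionField.

Variables (k : closedFieldType) (g : {poly k}).
Hypothesis odd_g : odd (size g).-1.

Definition curve_poly : {poly {fraction {poly k}}} := 'X^2 - (g%:F)%:P.

Lemma curve_poly_monic_irreducible : monic_irreducible_poly curve_poly.
Proof.
have gnz : g != 0 by apply: contraTneq odd_g => ->; rewrite size_poly0.
have szc : size curve_poly = 3 by rewrite size_XnsubC.
split; last by rewrite monicE lead_coefXnsubC.
apply: cubic_irreducible => [|u]; first by rewrite szc.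
apply/negP => /rootP; rewrite !hornerE [u]frac_numden.
move: (\n_(repr u)) (\d_(repr u)) (denom_ratioP (repr u)) => n d dnz.
move/eqP; rewrite subr_eq0 expr_div_n -!rmorphXn /=.
rewrite -[g%:F]divr1 eqr_div ?tofrac_eq0 ?expf_neq0 ?oner_eq0 // mulr1.
rewrite -rmorphM /= tofrac_eq => /eqP E.
have nnz : n != 0.
  apply/eqP => n0; move/eqP: E.
  by rewrite n0 expr0n eq_sym mulf_eq0 (negPf gnz) (negPf (expf_neq0 _ dnz)).
move/(congr1 (fun p : {poly k} => (size p).-1)): E.
rewrite size_exp size_mul ?expf_neq0 //.
have sq : size (d ^+ 2) = ((size d).-1 * 2).+1.
  by rewrite -size_exp prednK // size_poly_gt0 expf_neq0.
rewrite sq addnS /= -{1}[size g]prednK ?size_poly_gt0 // addSn /=.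
by move/(congr1 odd); rewrite oddD !oddM !andbF addbF odd_g.
Qed.

Definition func_field : predArgType :=
  {poly %/ curve_poly with curve_poly_monic_irreducible}.
HB.instance Definition _ := GRing.Field.on func_field.

Definition func_of_poly (p : {poly {fraction {poly k}}}) : func_field :=
  in_qpoly curve_poly p.
HB.instance Definition _ := GRing.RMorphism.copy func_of_poly
  (in_qpoly curve_poly : {poly {fraction {poly k}}} -> {poly %/ curve_poly}).

Definition func_const (c : k) : func_field := func_of_poly (c%:P%:F)%:P.

Lemma func_of_polyK (p : func_field) : func_of_poly (polyn p) = p.
Proof.
by apply: val_inj; apply: in_qpoly_small; apply: size_mk_monic.
Qed.

(******************************************************************************)
(* The closed points of the smooth projective model of k(C), which is the     *)
(* normalization of the projective curve, are the discrete valuations of k(C) *)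
(* trivial on k.  Valuations are normalized; the value 0 at 0 is a            *)
(* convention, which makes a valuation determined by its values on k(C)^*.    *)
(******************************************************************************)
Definition is_valuation (v : func_field -> int) : Prop :=
  [/\ v 0 = 0,
      forall a b, a != 0 -> b != 0 -> v (a * b) = v a + v b,
      forall a b, a != 0 -> b != 0 -> a + b != 0 ->
        Num.min (v a) (v b) <= v (a + b),
      forall c, v (func_const c) = 0
    & exists t, v t = 1].

Record place : Type :=
  Place { ord_at :> func_field -> int; placeP : is_valuation ord_at }.

Lemma place_inj (v w : place) : ord_at v =1 ord_at w -> v = w.
Proof.
case: v w => v vP [w wP] /= /funext E; rewrite -{}E in wP *.
by congr Place; apply: Prop_irrelevance.
Qed.

HB.instance Definition _ := gen_eqMixin place.
HB.instance Definition _ := gen_choiceMixin place.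

Lemma func_const1 : func_const 1 = 1.
Proof. by rewrite /func_const (polyC1 k) tofrac1 polyC1; apply: in_qpoly1. Qed.

Lemma place1 (v : place) : v 1 = 0.
Proof. by case: (placeP v) => _ _ _ /(_ 1) + _; rewrite func_const1. Qed.

Lemma placeM (v : place) a b : a != 0 -> b != 0 -> v (a * b) = v a + v b.
Proof. by case: (placeP v) => _ + _ _ _ => /(_ a b). Qed.

Lemma placeV (v : place) a : a != 0 -> v a^-1 = - v a.
Proof.
move=> a0; apply/eqP; rewrite -addr_eq0 addrC.
by rewrite -placeM ?invr_neq0 // divff // place1.
Qed.

(******************************************************************************)
(*     J(k) = Pic^0, the divisors of degree 0 modulo the divisors div(h)      *)
(******************************************************************************)
Local Notation divisor := {freeg place}.

Definition degree0_pred : {pred divisor} := fun D => deg D == 0.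
Fact degree0_zmod_closed : zmod_closed degree0_pred.
Proof.
split=> [|D E]; rewrite !unfold_in ?deg0 // => /eqP D0 /eqP E0.
by rewrite degB D0 E0.
Qed.
HB.instance Definition _ :=
  GRing.isZmodClosed.Build divisor degree0_pred degree0_zmod_closed.

Record divisor0 : predArgType :=
  Divisor0 { divisor0_val :> divisor; _ : divisor0_val \in degree0_pred }.
HB.instance Definition _ := [isSub for divisor0_val].
HB.instance Definition _ := [Choice of divisor0 by <:].
HB.instance Definition _ := [SubChoice_isSubZmodule of divisor0 by <:].

Definition principal : {pred divisor0} := fun D =>
  `[< exists2 h : func_field, h != 0 & forall v : place, coeff v D = v h >].
Fact principal_zmod_closed : zmod_closed principal.
Proof.
split=> [|D E].
  apply/asboolP; exists 1; first exact: oner_neq0.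
  by move=> v; rewrite place1 coeff0.
move=> /asboolP[h h0 hD] /asboolP[l l0 lE]; apply/asboolP.
exists (h / l) => [|v]; first by rewrite mulf_neq0 ?invr_neq0.
by rewrite placeM ?invr_neq0 // placeV // -hD -lE -coeffB.
Qed.
HB.instance Definition _ :=
  GRing.isZmodClosed.Build divisor0 principal principal_zmod_closed.

Definition jacobian : Type := Quotient.quot principal.
HB.instance Definition _ := GRing.Zmodule.on jacobian.

End FunctionField.

(******************************************************************************)
(* Semilinear action on J(k) of an automorphism s (with inverse t) of k that  *)
(* fixes g: s acts on the coefficients of the elements of k(C), fixing x and  *)
(* Y, and s v := v \o s^-1 corresponds to (a, b) |-> (s a, s b) on points.    *)
(******************************************************************************)
Section JacobianAction.

Variables (k : closedFieldType) (g : {poly k}) (odd_g : odd (size g).-1).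

Local Notation F := (func_field odd_g).
Local Notation place := (place odd_g).

Definition func_map (s : {rmorphism k -> k}) (h : F) : F :=
  func_of_poly odd_g (map_poly (rat_map s) (polyn h)).

Section Automorphism.

Variable s : {rmorphism k -> k}.
Hypothesis sg : map_poly s g = g.

Lemma func_map_of_poly q :
  func_map s (func_of_poly odd_g q) = func_of_poly odd_g (map_poly (rat_map s) q).
Proof.
have hI := curve_poly_monic_irreducible odd_g.
have hM : curve_poly g \is monic by case: hI.
have mapC : map_poly (rat_map s) (curve_poly g) = curve_poly g.
  by rewrite /curve_poly rmorphB /= map_polyXn map_polyC /= rat_map_tofrac sg.
have C0 : func_of_poly odd_g (curve_poly g) = 0.
  by apply: val_inj; rewrite /= mk_monicE // Pdiv.RingMonic.rmodpp.
rewrite [q in RHS](Pdiv.RingMonic.rdivp_eq hM).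
rewrite rmorphD rmorphM /= mapC.
rewrite (rmorphD (func_of_poly odd_g)) (rmorphM (func_of_poly odd_g)) /=.
rewrite C0 mulr0 add0r /func_map; congr (func_of_poly _ (map_poly _ _)).
by rewrite /= mk_monicE.
Qed.

Lemma func_mapB : zmod_morphism (func_map s).
Proof.
move=> a b; rewrite -[a]func_of_polyK -[b]func_of_polyK.
rewrite -(rmorphB (func_of_poly odd_g)) !func_map_of_poly.
by rewrite rmorphB; apply: (rmorphB (func_of_poly odd_g)).
Qed.

Lemma func_map0 : func_map s 0 = 0.
Proof. by rewrite -[X in func_map s X](subrr 0) func_mapB subrr. Qed.

Lemma func_mapM : monoid_morphism (func_map s).
Proof.
split=> [|a b].
  rewrite -(rmorph1 (func_of_poly odd_g)) func_map_of_poly.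
  by congr (func_of_poly _ _); apply: rmorph1.
rewrite -[a]func_of_polyK -[b]func_of_polyK.
rewrite -(rmorphM (func_of_poly odd_g)) !func_map_of_poly.
by rewrite rmorphM; apply: (rmorphM (func_of_poly odd_g)).
Qed.

Lemma func_map_const c : func_map s (func_const odd_g c) = func_const odd_g (s c).
Proof.
by rewrite /func_const func_map_of_poly !map_polyC /= rat_map_tofrac map_polyC.
Qed.

End Automorphism.

Lemma func_mapK (s t : {rmorphism k -> k}) : cancel s t ->
  map_poly t g = g -> cancel (func_map s) (func_map t).
Proof.
move=> sK tg h; rewrite {2}/func_map func_map_of_poly //.
rewrite -map_poly_comp /= map_poly_id ?func_of_polyK // => u _ /=.
exact: rat_mapK.
Qed.

Record curve_aut : Type := CurveAut {
  caut : {rmorphism k -> k};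
  caut_inv : {rmorphism k -> k};
  cautK : cancel caut caut_inv;
  caut_invK : cancel caut_inv caut;
  caut_fix : map_poly caut g = g }.

Lemma caut_inv_fix (s : curve_aut) : map_poly (caut_inv s) g = g.
Proof.
rewrite -{1}(caut_fix s) -map_poly_comp /= map_poly_id // => x _ /=.
exact: cautK.
Qed.

Lemma func_map_inv_neq0 (s : curve_aut) (h : F) :
  h != 0 -> func_map (caut_inv s) h != 0.
Proof.
have sg := caut_inv_fix s; apply: contra_neq => h0.
have fK := func_mapK (@caut_invK s) (caut_fix s).
by rewrite -[h]fK h0 func_map0 ?caut_fix.
Qed.

Fact place_act_subproof (s : curve_aut) (v : place) :
  is_valuation (fun h : F => v (func_map (caut_inv s) h)).
Proof.
have sg := caut_inv_fix s; have nz := @func_map_inv_neq0 s.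
have fD a b : func_map (caut_inv s) (a + b) =
    func_map (caut_inv s) a + func_map (caut_inv s) b.
  pose m := GRing.isZmodMorphism.Build _ _ _ (func_mapB sg).
  pose f : {additive F -> F} := HB.pack (func_map (caut_inv s)) m.
  exact: (raddfD f).
have [v0 vM vD vC [t vt]] := placeP v; split.
- by rewrite func_map0.
- by move=> a b a0 b0; rewrite (func_mapM sg).2 vM ?nz.
- by move=> a b a0 b0 ab0; rewrite fD vD ?nz // -fD nz.
- by move=> c; rewrite func_map_const.
by exists (func_map (caut s) t); rewrite func_mapK //; apply: cautK.
Qed.

Definition place_act (s : curve_aut) (v : place) : place :=
  Place (place_act_subproof s v).

Lemma place_act_inj s : injective (place_act s).
Proof.
move=> v w E; apply: place_inj => h.
have := congr1 (fun u : place => u (func_map (caut s) h)) E => /=.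
by rewrite func_mapK ?caut_inv_fix //; apply: cautK.
Qed.

Lemma place_act_surj s v : exists w, place_act s w = v.
Proof.
pose s' := CurveAut (@caut_invK s) (@cautK s) (caut_inv_fix s).
exists (place_act s' v); apply: place_inj => h /=.
by rewrite func_mapK ?caut_fix //; apply: caut_invK.
Qed.

Definition divisor_act (s : curve_aut) (D : {freeg place}) : {freeg place} :=
  fglift (fun v => << place_act s v >>) D.

HB.instance Definition _ s := GRing.isZmodMorphism.Build
  {freeg place} {freeg place} (divisor_act s) (lift_is_additive _).

Lemma divisor_actE s D : divisor_act s D =
  \sum_(v <- dom D) << coeff v D *g place_act s v >>.
Proof.
rewrite -{1}[D]freeg_sumE raddf_sum /=; apply: eq_bigr => v _.
rewrite /divisor_act liftU; apply/eqP/freeg_eqP => w.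
by rewrite coeffZ !coeffU mul1r.
Qed.

Lemma coeff_divisor_act s D v : coeff (place_act s v) (divisor_act s D) = coeff v D.
Proof.
rewrite divisor_actE -[D in RHS]freeg_sumE !raddf_sum /=; apply: eq_bigr => w _.
by rewrite !coeffU (inj_eq (@place_act_inj s)).
Qed.

Lemma deg_divisor_act s D : deg (divisor_act s D) = deg D.
Proof.
rewrite divisor_actE -[D in RHS]freeg_sumE !raddf_sum /=; apply: eq_bigr => v _.
by rewrite !degU.
Qed.

Fact divisor0_act_subproof s (D : divisor0 odd_g) :
  divisor_act s D \in @degree0_pred _ _ odd_g.
Proof. by rewrite unfold_in deg_divisor_act; case: D. Qed.

Definition divisor0_act s (D : divisor0 odd_g) : divisor0 odd_g :=
  Divisor0 (divisor0_act_subproof s D).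

Fact divisor0_act_zmod_morphism s : zmod_morphism (divisor0_act s).
Proof. by move=> D E; apply: val_inj; rewrite /= raddfB. Qed.
HB.instance Definition _ s := GRing.isZmodMorphism.Build
  (divisor0 odd_g) (divisor0 odd_g) (divisor0_act s)
  (divisor0_act_zmod_morphism s).

Lemma principal_act s (D : divisor0 odd_g) :
  D \in @principal _ _ odd_g -> divisor0_act s D \in @principal _ _ odd_g.
Proof.
move=> /asboolP[h h0 hD]; apply/asboolP; exists (func_map (caut s) h).
  apply: contra_neq h0 => h0.
  by rewrite -[h](func_mapK (@cautK s) (caut_inv_fix s)) h0 func_map0 ?caut_inv_fix.
move=> v; have [w <-] := place_act_surj s v.
rewrite coeff_divisor_act hD /= func_mapK ?caut_inv_fix //; exact: cautK.
Qed.

Definition jacobian_act s (P : jacobian odd_g) : jacobian odd_g :=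
  \pi_(Quotient.quot (@principal _ _ odd_g)) (divisor0_act s (repr P)).

Lemma pi_jacobian_act s (D : divisor0 odd_g) :
  jacobian_act s (\pi_(Quotient.quot (@principal _ _ odd_g)) D) =
  \pi_(Quotient.quot (@principal _ _ odd_g)) (divisor0_act s D).
Proof.
apply/eqP; rewrite /jacobian_act -Quotient.idealrBE -raddfB principal_act //.
by rewrite Quotient.idealrBE reprK.
Qed.

Fact jacobian_act_zmod_morphism s : zmod_morphism (jacobian_act s).
Proof.
pose pi := \pi_(Quotient.quot (@principal _ _ odd_g)).
have piB D E : pi (D - E) = pi D - pi E :> jacobian odd_g by apply: raddfB.
elim/quotW=> D; elim/quotW=> E; rewrite -/pi -piB !pi_jacobian_act -piB.
by rewrite raddfB.
Qed.
HB.instance Definition _ s := GRing.isZmodMorphism.Build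
  (jacobian odd_g) (jacobian odd_g) (jacobian_act s)
  (jacobian_act_zmod_morphism s).

Fact torsion_act_subproof s n (P : torsion (jacobian odd_g) n) :
  jacobian_act s (torsion_val P) \in @torsion_pred (jacobian odd_g) n.
Proof.
case: P => P Pn /=; move: Pn; rewrite !unfold_in => /eqP Pn.
by rewrite -raddfMn Pn raddf0.
Qed.

Definition torsion_act s n (P : torsion (jacobian odd_g) n) :
  torsion (jacobian odd_g) n := Torsion (torsion_act_subproof s P).

End JacobianAction.

(******************************************************************************)
(* The curve Y^2 = f over a field K of characteristic 0, with an algebraic    *)
(* closure Kbar of K, and the 2-torsion J[2] = J(Kbar)[2] as a Galois module. *)
(******************************************************************************)
Definition algebraic_closure (K : fieldType) (Kbar : closedFieldType)
    (iota : {rmorphism K -> Kbar}) : Prop :=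
  forall z : Kbar, exists2 p : {poly K}, p != 0 & root (map_poly iota p) z.

Section TwoTorsion.

Variables (K : fieldType) (Kbar : closedFieldType).
Variables (iota : {rmorphism K -> Kbar}) (f : {poly K}).
Hypothesis odd_f : odd (size f).-1.

Fact odd_map_iota : odd (size (map_poly iota f)).-1.
Proof. by rewrite size_map_poly. Qed.

Definition J2 : zmodType := torsion (jacobian odd_map_iota) 2.

Record abs_gal : Type := AbsGal {
  agal :> {rmorphism Kbar -> Kbar};
  agal_inv : {rmorphism Kbar -> Kbar};
  agalK : cancel agal agal_inv;
  agal_invK : cancel agal_inv agal;
  agal_fix : forall a : K, agal (iota a) = iota a }.

Fact abs_gal_curve_fix (s : abs_gal) :
  map_poly s (map_poly iota f) = map_poly iota f.
Proof.
by rewrite -map_poly_comp /=; apply: eq_map_poly => a /=; rewrite agal_fix.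
Qed.

Definition abs_gal_curve_aut (s : abs_gal) : curve_aut (map_poly iota f) :=
  CurveAut (@agalK s) (@agal_invK s) (abs_gal_curve_fix s).

Definition J2_act (s : abs_gal) (P : J2) : J2 :=
  torsion_act (abs_gal_curve_aut s) P.

Variables (L : splittingFieldType K) (j : {rmorphism L -> Kbar}).

(* The image of L in Kbar is K(J[2]), the subfield of Kbar fixed by the       *)
(* kernel of the action of the absolute Galois group on J[2].                 *)
Definition is_K_of_J2 : Prop :=
  (forall a : K, j a%:A = iota a) /\
  forall z : Kbar, (exists a : L, j a = z) <->
    (forall s : abs_gal, (forall P : J2, J2_act s P = P) -> s z = z).

(* t acts on J[2] as any s in the absolute Galois group that restricts to t   *)
(* on L does; all such s exist and act in the same way when L is K(J[2]).     *)
Definition gal_J2_act (t : gal_of {:L}) (P : J2) : J2 :=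
  if pselect (exists s : abs_gal, forall a : L, s (j a) = j (t a)) is left lift
  then J2_act (projT1 (cid lift)) P else P.

End TwoTorsion.

Arguments gal_J2_act {K Kbar} iota {f} odd_f {L} j t P.

(* Main.v *)
(** Over Kbar, the function field of C is the quadratic extension Kbar(x)(y), y^2 = f.  For a root a
    of f, x - a has divisor 2 P_a - 2 oo, so [P_a - oo] lies in J[2], and y gives sum_a [P_a - oo] = 0.
    If 2 D = div h, the norm of h has even order everywhere and is a square in Kbar(x); Hilbert's
    theorem 90 then shows that h is a square up to a product of factors x - a, so the [P_a - oo]
    generate J[2], and comparing orders at infinity shows that there is no other relation.  Hence J[2]
    is the permutation module F_2^Omega modulo the constants, Omega being the set of roots.

    As #Omega is odd, the 2-group G_2 fixes a root i0, and all five assertions mean that G_2 acts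
    freely on Omega minus i0.  In that case J[2] is induced over G_2, whence a map rho with
    sum_g g rho g^-1 = id; this persists over Gal(L/K), the index of G_2 being odd, and over all of
    its subgroups, and it contracts the standard complexes.  Conversely, a nontrivial stabilizer
    S in G_2 has a character of order 2, from which Shapiro's lemma makes a nontrivial class in
    H^1(G_2, J[2]). *)

From HB Require Import structures.
Require Import Defs.
From mathcomp Require Import all_boot all_order all_fingroup all_algebra.
From mathcomp Require Import all_solvable all_field qfpoly.
From mathcomp Require classical_sets.
From mathcomp Require Import boolp generic_quotient ring_quotient freeg.
From mathcomp Require Import zify ring.

Set Implicit Arguments.
Unset Strict Implicit.
Unset Printing Implicit Defensive.

Import Order.TTheory GRing.Theory Num.Theory.
Local Open Scope ring_scope.
Local Open Scope quotient_scope.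

(** The points of the curve are abstract valuations, and they are never classified. Two facts
    replace a classification. Over a root of f, and over infinity, f has odd order on the line, so
    the place above is ramified and unique; over any other point a of the line at least one place
    exists, built from a square root of f(a). Moreover, equalities of divisors are checked after
    doubling: twice a sum of P_a - oo is the divisor of a product of factors x - a, whose value is
    given by the same formula at every place.

    The module enters the cohomology only through a presentation: generators e_i of order 2 which
    the group permutes, and the single relation that they add up to 0. The fixed root i0 makes this
    usable: every element has exactly one expression omitting the generator of i0, and G_2 permutes
    these expressions. The map rho is the projection onto the coordinates in a set of
    representatives of the orbits of G_2 off i0. Finally, the action of Gal(L/K) on J[2] is defined
    through lifts to Kbar, so these lifts have to be constructed, by Zorn's lemma. *)

Local Notation "p %:F" := (FracField.tofrac p) : ring_scope.

(** * Valuations of rational function fields *)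

Section Valuation.

Variables (k : Type) (F : fieldType) (c : k -> F).

(** Surjectivity onto the integers is left out, so that the notion restricts to subfields: a
    ramified place takes only even values on k(x). *)
Definition valuation (v : F -> int) : Prop :=
  [/\ v 0 = 0,
      forall a b, a != 0 -> b != 0 -> v (a * b) = v a + v b,
      forall a b, a != 0 -> b != 0 -> a + b != 0 ->
        Num.min (v a) (v b) <= v (a + b)
    & forall x, v (c x) = 0].

Variable v : F -> int.
Hypothesis vP : valuation v.
Implicit Types a b : F.

Lemma valn0 : v 0 = 0. Proof. by case: vP. Qed.

Lemma valnM a b : a != 0 -> b != 0 -> v (a * b) = v a + v b.
Proof. by case: vP => _ + _ _; apply. Qed.

Lemma valnC x : v (c x) = 0. Proof. by case: vP. Qed.

Lemma valn_ge m a b : a != 0 -> b != 0 -> a + b != 0 ->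
  m <= v a -> m <= v b -> m <= v (a + b).
Proof.
case: vP => _ _ H _ a0 b0 ab0 ma mb; apply: le_trans (H _ _ a0 b0 ab0).
by rewrite le_min ma mb.
Qed.

Lemma valn1 : v 1 = 0.
Proof.
have := valnM (oner_neq0 F) (oner_neq0 F); rewrite mulr1 => /eqP.
by rewrite -subr_eq subrr eq_sym => /eqP.
Qed.

Lemma valnV a : v a^-1 = - v a.
Proof.
have [->|a0] := eqVneq a 0; first by rewrite invr0 valn0 oppr0.
by apply/eqP; rewrite -addr_eq0 -valnM ?invr_neq0 // mulVf // valn1.
Qed.

Lemma valnN a : v (- a) = v a.
Proof.
have [->|a0] := eqVneq a 0; first by rewrite oppr0.
rewrite -mulN1r valnM ?oppr_eq0 ?oner_eq0 //.
have : v (- 1) + v (- 1) = 0 by rewrite -valnM ?oppr_eq0 ?oner_eq0 // mulrNN mulr1 valn1.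
by lia.
Qed.

Lemma valnX a n : v (a ^+ n) = v a *+ n.
Proof.
have [->|a0] := eqVneq a 0.
  by rewrite valn0 mul0rn expr0n; case: n => [|n]; rewrite ?valn1 ?valn0.
elim: n => [|n IH]; first by rewrite expr0 valn1.
by rewrite exprS valnM ?expf_neq0 // IH mulrS.
Qed.

Lemma valn_div a b : a != 0 -> b != 0 -> v (a / b) = v a - v b.
Proof. by move=> a0 b0; rewrite valnM ?invr_neq0 // valnV. Qed.

Lemma valn_prod I (r : seq I) (P : pred I) (E : I -> F) :
  (forall i, P i -> E i != 0) ->
  v (\prod_(i <- r | P i) E i) = \sum_(i <- r | P i) v (E i).
Proof.
move=> E0; suff [] : \prod_(i <- r | P i) E i != 0 /\
    v (\prod_(i <- r | P i) E i) = \sum_(i <- r | P i) v (E i) by [].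
elim/big_rec2: _ => [|i x y Pi [y0 <-]]; first by rewrite oner_neq0 valn1.
by rewrite mulf_neq0 ?E0 // valnM ?E0.
Qed.

(** If [a + b] had a value above [v a], then [a], the difference of [a + b] and [b], would have a
    value above [v a] as well. *)
Lemma valn_lt a b : a != 0 -> b != 0 -> v a < v b -> a + b != 0 /\ v (a + b) = v a.
Proof.
move=> a0 b0 ltab.
have ab0 : a + b != 0.
  by apply: contraTneq ltab => /eqP; rewrite addr_eq0 => /eqP ->; rewrite valnN ltxx.
split=> //; apply/eqP; rewrite eq_le (@valn_ge (v a)) // ?(ltW ltab) // andbT.
rewrite leNgt; apply/negP => lt2.
have : v a + 1 <= v (a + b - b).
  by apply: valn_ge; rewrite ?oppr_eq0 ?addrK ?valnN //; lia.
by rewrite addrK; lia.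
Qed.

Lemma valn_add_ne a b : a != 0 -> b != 0 -> v a != v b ->
  a + b != 0 /\ v (a + b) = Num.min (v a) (v b).
Proof.
move=> a0 b0; case: (ltgtP (v a) (v b)) => // lt _.
  by have [? ->] := valn_lt a0 b0 lt; split=> //; lia.
by rewrite addrC; have [? ->] := valn_lt b0 a0 lt; split=> //; lia.
Qed.

End Valuation.

Definition rat_const (k : fieldType) (a : k) : {fraction {poly k}} := (a%:P)%:F.

Section RationalFunctionOrders.

Variable k : fieldType.
Implicit Types (p q : {poly k}) (u : option k) (A B : {fraction {poly k}}).

(* [Some a] stands for the point x = a of the projective line, [None] for the point at infinity. *)
Definition poly_ord u p : int :=
  if u is Some a then (mup a p)%:Z else - (size p).-1%:Z.

(** Computed on a chosen fraction; [ord_frac] shows that any other fraction gives the same value. *)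
Definition ord u A : int :=
  if A == 0 then 0
  else poly_ord u (\n_(repr A)) - poly_ord u (\d_(repr A)).

Lemma poly_ordM u p q : p != 0 -> q != 0 ->
  poly_ord u (p * q) = poly_ord u p + poly_ord u q.
Proof.
case: u => [a|] p0 q0 /=; first by rewrite mupM.
move: p0 q0; rewrite -!size_poly_gt0 => p0 q0.
rewrite size_mul -?size_poly_gt0 //; move: (size p) (size q) p0 q0 => m n; lia.
Qed.

Lemma poly_ordD u p q : p != 0 -> q != 0 -> p + q != 0 ->
  Num.min (poly_ord u p) (poly_ord u q) <= poly_ord u (p + q).
Proof.
case: u => [a|] p0 q0 pq0 /=; last first.
  move: p0 q0 pq0 (size_polyD p q); rewrite -!size_poly_gt0.
  move: (size p) (size q) (size (p + q)) => m n l; lia.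
suff : (minn (mup a p) (mup a q) <= mup a (p + q))%N by lia.
rewrite mup_geq // dvdp_add // -mup_geq //; lia.
Qed.

Lemma poly_ordC u (a : k) : a != 0 -> poly_ord u a%:P = 0.
Proof.
move=> a0; case: u => [b|] /=; last by rewrite size_polyC a0.
by rewrite mupNroot // rootC.
Qed.

Lemma ord_frac u p q : p != 0 -> q != 0 ->
  ord u (p%:F / q%:F) = poly_ord u p - poly_ord u q.
Proof.
move=> p0 q0; set A := _ / _.
have A0 : A != 0 by rewrite mulf_neq0 ?invr_eq0 ?tofrac_eq0.
rewrite /ord (negPf A0); have := frac_numden A.
have := denom_ratioP (repr A); move: (\n_(repr A)) (\d_(repr A)) => n d d0 AE.
have n0 : n != 0 by apply: contra_neq A0; rewrite AE => ->; rewrite rmorph0 mul0r.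
move/eqP: AE; rewrite /A eqr_div ?tofrac_eq0 // -!rmorphM /= tofrac_eq => /eqP.
by move/(congr1 (poly_ord u)); rewrite !poly_ordM //; lia.
Qed.

Lemma ord_poly u p : p != 0 -> ord u p%:F = poly_ord u p.
Proof.
move=> p0; rewrite -[p%:F]divr1 -tofrac1 ord_frac ?oner_eq0 //.
by rewrite -polyC1 poly_ordC ?subr0 ?oner_eq0.
Qed.

Lemma frac_neq0 A : A != 0 -> exists p q, [/\ p != 0, q != 0 & A = p%:F / q%:F].
Proof.
move=> A0; exists \n_(repr A), \d_(repr A); split; last exact: frac_numden.
  by apply: contraNneq A0; rewrite {2}[A]frac_numden => ->; rewrite tofrac0 mul0r.
exact: denom_ratioP.
Qed.

Lemma ord_valuation u : valuation (@rat_const k) (ord u).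
Proof.
split=> [|A B|A B|a]; first by rewrite /ord eqxx.
- move=> /frac_neq0[p [q [p0 q0 ->]]] /frac_neq0[r [s [r0 s0 ->]]].
  rewrite mulf_div -!rmorphM /= !ord_frac ?mulf_neq0 //.
  by rewrite !poly_ordM //; lia.
- move=> /frac_neq0[p [q [p0 q0 ->]]] /frac_neq0[r [s [r0 s0 ->]]].
  rewrite addf_div ?tofrac_eq0 // -!rmorphM -rmorphD /=.
  rewrite mulf_eq0 negb_or tofrac_eq0 => /andP[pr0 _].
  rewrite !ord_frac ?mulf_neq0 // (poly_ordM _ q0 s0).
  have := poly_ordD u (mulf_neq0 p0 s0) (mulf_neq0 r0 q0) pr0.
  rewrite (poly_ordM _ p0 s0) (poly_ordM _ r0 q0).
  move: (poly_ord u _) (poly_ord u p) (poly_ord u q) (poly_ord u r) (poly_ord u s).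
  by move=> x1 x2 x3 x4 x5 {p0 q0 r0 s0 pr0}; lia.
rewrite /rat_const; have [->|a0] := eqVneq a 0; first by rewrite /ord polyC0 tofrac0 eqxx.
by rewrite ord_poly ?polyC_eq0 ?poly_ordC.
Qed.

Lemma ord_XsubC a b : ord (Some a) ('X - b%:P)%:F = (a == b)%:Z.
Proof.
rewrite ord_poly ?polyXsubC_eq0 //=.
by have := mup_XsubCX 1 a b; rewrite expr1 eq_sym => ->; case: eqP.
Qed.

Lemma ord_inf_XsubC b : ord None ('X - b%:P)%:F = -1.
Proof. by rewrite ord_poly ?polyXsubC_eq0 //= size_XsubC. Qed.

End RationalFunctionOrders.

(** * Rational functions over an algebraically closed field *)

Section RationalFunctions.

Variable k : closedFieldType.
Implicit Types (p q : {poly k}) (u : option k) (A B : {fraction {poly k}}).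

(** Over an algebraically closed field a nonzero rational function is a constant times a product of
    powers of linear polynomials, so the values on the latter decide everything. *)
Lemma valuation_ord_unique (v : {fraction {poly k}} -> int) u (e : int) :
  valuation (@rat_const k) v ->
  (forall b, v ('X - b%:P)%:F = e * ord u ('X - b%:P)%:F) ->
  forall A, v A = e * ord u A.
Proof.
move=> vP H; have oP := ord_valuation u.
have poly p : v p%:F = e * ord u p%:F.
  have [->|p0] := eqVneq p 0; first by rewrite tofrac0 (valn0 vP) (valn0 oP) mulr0.
  have [r ->] := closed_field_poly_normal p.
  rewrite -mul_polyC rmorphM rmorph_prod /=.
  have P0 (s : seq k) : \prod_(z <- s) ('X - z%:P)%:F != 0 :> {fraction {poly k}}.
    by rewrite prodf_seq_neq0; apply/allP => z _; rewrite tofrac_eq0 polyXsubC_eq0.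
  have l0 : (lead_coef p)%:P%:F != 0 :> {fraction {poly k}}.
    by rewrite tofrac_eq0 polyC_eq0 lead_coef_eq0.
  have vl : v (lead_coef p)%:P%:F = 0 := valnC vP _.
  have ol : ord u (lead_coef p)%:P%:F = 0 := valnC oP _.
  rewrite (valnM vP l0 (P0 r)) (valnM oP l0 (P0 r)) vl ol !add0r.
  have X0 (z : k) : true -> ('X - z%:P)%:F != 0 :> {fraction {poly k}}.
    by rewrite tofrac_eq0 polyXsubC_eq0.
  rewrite (valn_prod vP _ X0) (valn_prod oP _ X0).
  by rewrite mulr_sumr; apply: eq_bigr => z _.
move=> A; have [->|A0] := eqVneq A 0; first by rewrite (valn0 vP) (valn0 oP) mulr0.
have [p [q [p0 q0 AE]]] := frac_neq0 A0.
by rewrite AE (valn_div vP) ?(valn_div oP) ?tofrac_eq0 // !poly mulrBr.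
Qed.

(** For b different from a, ['X - b%:P] is the sum of a nonzero constant and of ['X - a%:P], whose
    value is positive; hence it has value 0. *)
Lemma valuation_finite_ord (v : {fraction {poly k}} -> int) a :
  valuation (@rat_const k) v -> 0 < v ('X - a%:P)%:F ->
  forall A, v A = v ('X - a%:P)%:F * ord (Some a) A.
Proof.
move=> vP va; apply: valuation_ord_unique => // b; rewrite ord_XsubC.
have [<-|ab] := eqVneq a b; first by rewrite mulr1.
have c0 : rat_const (a - b) != 0 by rewrite tofrac_eq0 polyC_eq0 subr_eq0.
have x0 : ('X - a%:P)%:F != 0 :> {fraction {poly k}} by rewrite tofrac_eq0 polyXsubC_eq0.
have [|_] := valn_lt vP c0 x0; first by rewrite (valnC vP).
rewrite (valnC vP) -rmorphD /= mulr0 => <-; congr (v _%:F).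
by rewrite polyCB; ring.
Qed.

(** All linear polynomials differ by constants, of value 0, so a single one of negative value
    imposes that value on all of them. *)
Lemma valuation_inf_ord (v : {fraction {poly k}} -> int) a :
  valuation (@rat_const k) v -> v ('X - a%:P)%:F < 0 ->
  forall A, v A = - v ('X - a%:P)%:F * ord None A.
Proof.
move=> vP va; apply: valuation_ord_unique => // b; rewrite ord_inf_XsubC mulrN1 opprK.
have [<-//|ab] := eqVneq a b.
have c0 : rat_const (a - b) != 0 by rewrite tofrac_eq0 polyC_eq0 subr_eq0.
have x0 : ('X - a%:P)%:F != 0 :> {fraction {poly k}} by rewrite tofrac_eq0 polyXsubC_eq0.
have [|_ <-] := valn_lt vP x0 c0; first by rewrite (valnC vP).
by rewrite -rmorphD /=; congr (v _%:F); rewrite polyCB; ring.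
Qed.

Lemma closed_sqrt (a : k) : exists b, b ^+ 2 = a.
Proof.
have [|b] := closed_rootP ('X^2 - a%:P) _; first by rewrite size_XnsubC.
by rewrite /root !hornerE subr_eq0 => /eqP; exists b.
Qed.

(** Write A = p / q = p q / q^2. All roots of p q have even multiplicity, and its leading
    coefficient is a square. *)
Lemma even_ord_square A : A != 0 ->
  (forall a, (2 %| ord (Some a) A)%Z) -> exists B, A = B ^+ 2.
Proof.
move=> A0 Aev; have [p [q [p0 q0 AE]]] := frac_neq0 A0.
have pqev a : (2 %| (mup a (p * q))%:Z)%Z.
  by have := Aev a; rewrite AE ord_frac //= mupM //; lia.
have [r rE] := closed_field_poly_normal (p * q).
have [c cE] := closed_sqrt (lead_coef (p * q)).
have cnt z : (2 %| count_mem z r)%N.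
  have := pqev z; rewrite rE -mul_polyC mupMr ?mu_prod_XsubC; first by lia.
  by rewrite rootC lead_coef_eq0 mulf_neq0.
pose B := c%:P * \prod_(z <- undup r) ('X - z%:P) ^+ (count_mem z r %/ 2).
have BB : B ^+ 2 = p * q.
  rewrite rE /B exprMn -rmorphXn /= cE -mul_polyC -prodrXl; congr (_ * _).
  rewrite -[RHS]prodr_undup_exp_count; apply: eq_bigr => z _.
  by rewrite -exprM divnK.
exists (B%:F / q%:F); rewrite AE expr_div_n; apply/eqP.
rewrite eqr_div ?expf_neq0 ?tofrac_eq0 // -!rmorphXn -!rmorphM tofrac_eq /= BB.
by apply/eqP; ring.
Qed.

(** In lowest terms, a root of the denominator would not be a root of the numerator, hence would be
    a pole. *)
Lemma integral_ord_poly A :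
  (forall a, 0 <= ord (Some a) A) -> exists p : {poly k}, A = p%:F.
Proof.
have [->|A0] := eqVneq A 0; first by exists 0; rewrite tofrac0.
have [p [q [p0 q0 AE]]] := frac_neq0 A0; move=> H.
pose g := gcdp p q.
have g0 : g != 0 by rewrite gcdp_eq0 negb_and p0.
pose p1 := p %/ g; pose q1 := q %/ g.
have pE : p = p1 * g by rewrite divpK // dvdp_gcdl.
have qE : q = q1 * g by rewrite divpK // dvdp_gcdr.
have p10 : p1 != 0 by apply: contraNneq p0; rewrite pE => ->; rewrite mul0r.
have q10 : q1 != 0 by apply: contraNneq q0; rewrite qE => ->; rewrite mul0r.
have cop : coprimep p1 q1 by rewrite coprimep_div_gcd // p0.
clearbody p1 q1; have {}AE : A = p1%:F / q1%:F.
  apply/eqP; rewrite AE eqr_div ?tofrac_eq0 // -!rmorphM tofrac_eq /= pE qE.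
  by apply/eqP; ring.
have [/size_poly1P[c c0 q1E]|/closed_rootP[a ra]] := boolP (size q1 == 1%N).
  exists (c^-1 *: p1); rewrite AE q1E -mul_polyC rmorphM /= mulrC; congr (_ * _).
  have c0' : (c%:P)%:F != 0 :> {fraction {poly k}} by rewrite tofrac_eq0 polyC_eq0.
  by apply: (mulfI c0'); rewrite divff // -rmorphM -polyCM divff // tofrac1.
have := H a; rewrite AE ord_frac //= mupNroot; last first.
  by rewrite /root; apply: coprimep_root ra; rewrite coprimep_sym.
by have := XsubC_dvd a q10; rewrite dvdp_XsubCl ra; lia.
Qed.

Lemma ord_inf_poly_le0 p : ord None p%:F <= 0.
Proof.
have [->|p0] := eqVneq p 0; first by rewrite tofrac0 (valn0 (ord_valuation _)).
by rewrite ord_poly //=; lia.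
Qed.

End RationalFunctions.

(** * Quadratic extensions and their places *)

(* [F] = [E](sqrt [gamma]), with coordinates with respect to the basis (1, [qgen]). *)
Record quad_ext (E F : fieldType) (gamma : E) : Type := QuadExt {
  of_base :> {rmorphism E -> F};
  qgen : F;
  re_part : F -> E;
  im_part : F -> E;
  qgen_sqr : qgen ^+ 2 = of_base gamma;
  re_coords : forall a b, re_part (of_base a + of_base b * qgen) = a;
  im_coords : forall a b, im_part (of_base a + of_base b * qgen) = b;
  coordsE : forall h, h = of_base (re_part h) + of_base (im_part h) * qgen }.

Section QuadraticExtension.

Variables (E F : fieldType) (gamma : E) (X : quad_ext F gamma).
Hypothesis gamma0 : gamma != 0.
Implicit Types (a b c d : E) (h : F).
Local Notation y := (qgen X).

Lemma coords_add a b c d : X a + X b * y + (X c + X d * y) = X (a + c) + X (b + d) * y.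
Proof. by rewrite !rmorphD /=; ring. Qed.

Lemma coords_mul a b c d :
  (X a + X b * y) * (X c + X d * y) = X (a * c + gamma * b * d) + X (a * d + b * c) * y.
Proof. by rewrite !(rmorphD, rmorphM) /= -qgen_sqr; ring. Qed.

Lemma re_base a : re_part X (X a) = a.
Proof. by have := re_coords X a 0; rewrite rmorph0 mul0r addr0. Qed.

Lemma im_base a : im_part X (X a) = 0.
Proof. by have := im_coords X a 0; rewrite rmorph0 mul0r addr0. Qed.

Definition conj_fun h : F := X (re_part X h) - X (im_part X h) * y.

Lemma conj_coords a b : conj_fun (X a + X b * y) = X a + X (- b) * y.
Proof. by rewrite /conj_fun re_coords im_coords rmorphN mulNr. Qed.

Lemma conj_base a : conj_fun (X a) = X a.
Proof. by rewrite /conj_fun re_base im_base rmorph0 mul0r subr0. Qed.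

Lemma conjD h1 h2 : conj_fun (h1 + h2) = conj_fun h1 + conj_fun h2.
Proof.
move: (coordsE X h1) (coordsE X h2).
move: (re_part X h1) (im_part X h1) (re_part X h2) (im_part X h2) => a b c d -> ->.
by rewrite coords_add !conj_coords coords_add opprD.
Qed.

Lemma conjM h1 h2 : conj_fun (h1 * h2) = conj_fun h1 * conj_fun h2.
Proof.
move: (coordsE X h1) (coordsE X h2).
move: (re_part X h1) (im_part X h1) (re_part X h2) (im_part X h2) => a b c d -> ->.
rewrite coords_mul !conj_coords coords_mul.
by congr (X _ + X _ * _); ring.
Qed.

Lemma conjK : involutive conj_fun.
Proof.
move=> h; move: (coordsE X h); move: (re_part X h) (im_part X h) => a b ->.
by rewrite !conj_coords opprK.
Qed.

Lemma conj_qgen : conj_fun y = - y.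
Proof. by have := conj_coords 0 1; rewrite !(rmorphN, rmorph1, rmorph0) mulN1r mul1r !add0r. Qed.

Lemma conj_eq0 h : (conj_fun h == 0) = (h == 0).
Proof.
have conj0 : conj_fun 0 = 0 by rewrite -(rmorph0 X) conj_base.
by rewrite -{2}[h]conjK; apply/eqP/eqP => [->|/(congr1 conj_fun)]; rewrite conj0 ?conjK.
Qed.

Definition qnorm h : E := re_part X h ^+ 2 - gamma * im_part X h ^+ 2.

Lemma qnormE h : X (qnorm h) = h * conj_fun h.
Proof.
rewrite [X in X * _](coordsE X h) /conj_fun /qnorm !(rmorphB, rmorphM, rmorphXn) /= -qgen_sqr.
ring.
Qed.

Lemma qnorm_coords a b : qnorm (X a + X b * y) = a ^+ 2 - gamma * b ^+ 2.
Proof. by rewrite /qnorm re_coords im_coords. Qed.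

Lemma qnorm_base a : qnorm (X a) = a ^+ 2.
Proof. by rewrite /qnorm re_base im_base expr0n mulr0 subr0. Qed.

Lemma qnormM h1 h2 : qnorm (h1 * h2) = qnorm h1 * qnorm h2.
Proof. by apply: (fmorph_inj X); rewrite rmorphM !qnormE conjM mulrACA. Qed.

Lemma qnorm_eq0 h : (qnorm h == 0) = (h == 0).
Proof. by rewrite -(fmorph_eq0 X) qnormE mulf_eq0 conj_eq0 orbb. Qed.

Lemma qgen_neq0 : y != 0.
Proof. by rewrite -sqrf_eq0 qgen_sqr fmorph_eq0. Qed.

(* Hilbert's theorem 90 *)
Lemma qnorm1_div_conj u : qnorm u = 1 -> exists2 w, w != 0 & u * conj_fun w = w.
Proof.
move=> u1; have uu : u * conj_fun u = 1 by rewrite -qnormE u1 rmorph1.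
(* As u times its conjugate is 1, u (1 + conj u) = u + 1, which gives the witness 1 + u. It vanishes
   only for u = -1, where y does the job because conjugation negates it. *)
have [u1'|u1'] := eqVneq (1 + u) 0.
  exists y; first exact: qgen_neq0.
  by move/eqP: u1'; rewrite addrC addr_eq0 => /eqP ->; rewrite conj_qgen mulrNN mul1r.
exists (1 + u) => //; rewrite conjD -{1}(rmorph1 X) conj_base rmorph1.
by rewrite mulrDr mulr1 uu addrC.
Qed.

End QuadraticExtension.

Lemma valuation_restrict (T : Type) (E F : fieldType) (c : T -> E)
    (iota : {rmorphism E -> F}) (v : F -> int) :
  valuation (fun x => iota (c x)) v -> valuation c (fun x => v (iota x)).
Proof.
case=> [v0 vM vD vC]; split=> [|a b a0 b0|a b a0 b0 ab0|x].
- by rewrite rmorph0.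
- by rewrite rmorphM vM // fmorph_eq0.
- by rewrite rmorphD vD // -?rmorphD fmorph_eq0.
by rewrite vC.
Qed.

(** * Places over a point where [g] does not vanish *)

Section UnramifiedPlace.

Variables (k : closedFieldType) (g : {poly k}) (F : fieldType).
Variable X : quad_ext F (g%:F).
Variables a b : k.
Hypotheses (bb : b ^+ 2 = g.[a]) (b0 : b != 0) (two0 : 2%:R != 0 :> k).
Implicit Types (p q : {poly k}) (h : F) (A B : {fraction {poly k}}).

Local Notation y := (qgen X).

(** [el] parametrizes the coordinate ring k[x, y], [ev] evaluates at the point (a, b) of the curve,
    and [unit] is the complement of the maximal ideal of that point. As b is nonzero, [pi] = x - a
    is a uniformizer there. *)
Let el p q : F := X p%:F + X q%:F * y.
Let ev p q : k := p.[a] + q.[a] * b.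
Let unit h := exists p q, h = el p q /\ ev p q != 0.
Let pi : F := X ('X - a%:P)%:F.

Let el_inj p q p' q' : el p q = el p' q' -> p = p' /\ q = q'.
Proof.
move=> E; have := congr1 (re_part X) E; have := congr1 (im_part X) E.
rewrite !re_coords !im_coords => /eqP + /eqP.
by rewrite !tofrac_eq => /eqP -> /eqP ->.
Qed.

Let elM p q p' q' : el p q * el p' q' = el (p * p' + g * q * q') (p * q' + q * p').
Proof. by rewrite /el coords_mul !(rmorphD, rmorphM). Qed.

Let elD p q p' q' : el p q + el p' q' = el (p + p') (q + q').
Proof. by rewrite /el coords_add !rmorphD. Qed.

Let evM p q p' q' :
  ev (p * p' + g * q * q') (p * q' + q * p') = ev p q * ev p' q'.
Proof. by rewrite /ev !hornerE -bb; ring. Qed.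

Let el_pi p q n : el p q * pi ^+ n = el (p * ('X - a%:P) ^+ n) (q * ('X - a%:P) ^+ n).
Proof. by rewrite /el /pi !(rmorphM, rmorphXn) /=; ring. Qed.

Let unit_poly p : ~~ root p a -> unit (X p%:F).
Proof.
move=> pa; exists p, 0; split; first by rewrite /el !rmorph0 mul0r addr0.
by rewrite /ev horner0 mul0r addr0.
Qed.

Let unitM h h' : unit h -> unit h' -> unit (h * h').
Proof.
move=> [p [q [-> n0]]] [p' [q' [-> n0']]].
by rewrite elM; do 2 eexists; split; first by []; rewrite evM mulf_neq0.
Qed.

Let unit_neq0 h : unit h -> h != 0.
Proof.
move=> [p [q [-> n0]]]; apply: contraNneq n0.
have <- : el 0 0 = 0 by rewrite /el !rmorph0 mul0r addr0.
by case/el_inj=> -> ->; rewrite /ev !horner0 mul0r addr0.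
Qed.

Let pi_neq0 : pi != 0.
Proof. by rewrite fmorph_eq0 tofrac_eq0 polyXsubC_eq0. Qed.

Let unit_pi p q n : ~ unit (el p q * pi ^+ n.+1).
Proof.
rewrite el_pi => -[p' [q' [/el_inj[<- <-]]]].
by rewrite /ev exprS !hornerM hornerXsubC subrr !(mul0r, mulr0) addr0 eqxx.
Qed.

(** The order at (a, b) as a relation: h is pi^e times a quotient of two functions that do not
    vanish at the point. Denominators are cleared so that all computations take place with elements
    of k[x, y]. *)
Let has_val h (e : int) := exists c d m n,
  [/\ unit c, unit d, c * h * pi ^+ m = d * pi ^+ n & e = n%:Z - m%:Z].

Let unit_pi_eq c d m n : unit c -> unit d -> c * pi ^+ m = d * pi ^+ n -> m = n.
Proof.
wlog le_mn : c d m n / (m <= n)%N => [H uc ud E|].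
  case/orP: (leq_total m n) => [/H/(_ uc ud E)//|/H/(_ ud uc (esym E))//].
move=> uc [p [q [-> _]]] E; apply/eqP; rewrite eqn_leq le_mn /= leqNgt.
apply/negP => lt_mn; apply: (@unit_pi p q (n - m).-1).
suff <- : c = el p q * pi ^+ (n - m).-1.+1 by [].
rewrite prednK ?subn_gt0 //; apply: (mulIf (expf_neq0 m pi_neq0)).
by rewrite E -mulrA -exprD subnK.
Qed.

Let has_val_uniq h e e' : has_val h e -> has_val h e' -> e = e'.
Proof.
move=> [c [d [m [n [uc ud E ->]]]]] [c' [d' [m' [n' [uc' ud' E' ->]]]]].
suff : (n + m' = n' + m)%N by lia.
apply: (@unit_pi_eq (c' * d) (c * d')); rewrite ?unitM // ?exprD; try exact: unitM.
have -> : c' * d * (pi ^+ n * pi ^+ m') = d * pi ^+ n * c' * pi ^+ m' by ring.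
have -> : c * d' * (pi ^+ n' * pi ^+ m) = d' * pi ^+ n' * c * pi ^+ m by ring.
by rewrite -E -E'; ring.
Qed.

Let has_valM h h' e e' : has_val h e -> has_val h' e' -> has_val (h * h') (e + e').
Proof.
move=> [c [d [m [n [uc ud E ->]]]]] [c' [d' [m' [n' [uc' ud' E' ->]]]]].
exists (c * c'), (d * d'), (m + m')%N, (n + n')%N; split; try exact: unitM; last by lia.
rewrite !exprD; have -> : d * d' * (pi ^+ n * pi ^+ n') = d * pi ^+ n * (d' * pi ^+ n') by ring.
by rewrite -E -E'; ring.
Qed.

Let unit1 : unit 1.
Proof. by rewrite -(rmorph1 X) -tofrac1; apply: unit_poly; rewrite root1. Qed.

Let has_val_unit h : unit h -> has_val h 0.
Proof. by move=> uh; exists 1, h, 0, 0; split=> //; rewrite mul1r. Qed.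

Let has_val_pi n : has_val (pi ^+ n) n%:Z.
Proof. by exists 1, 1, 0, n; split=> //; rewrite ?mulr1 // subr0. Qed.

Let has_valV h e : h != 0 -> has_val h e -> has_val h^-1 (- e).
Proof.
move=> h0 [c [d [m [n [uc ud E ->]]]]]; exists d, c, n, m; split=> //; last by lia.
by rewrite mulrAC -E; field.
Qed.

Let has_val_poly p : p != 0 -> exists e, has_val (X p%:F) e.
Proof.
move=> p0; have [n [q + pE]] := multiplicity_XsubC p a.
rewrite p0 /= => qa; exists n%:Z; rewrite pE rmorphM rmorphXn rmorphM rmorphXn /=.
rewrite -[n%:Z]add0r; apply: has_valM (has_val_pi n).
by apply: has_val_unit; apply: unit_poly.
Qed.

(** Induction on the total size: a common factor x - a of p and q is split off as [pi]. Without such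
    a factor, either the element does not vanish at (a, b), or its conjugate does not, and then its
    order is that of its norm, a polynomial in x. *)
Let has_val_el p q : el p q != 0 -> exists e, has_val (el p q) e.
Proof.
have [n] := ubnP (size p + size q); elim: n => // n IH in p q *; rewrite ltnS => le_n el0.
have [/andP[pa qa]|nd] := boolP (root p a && root q a).
  have /factor_theorem[p' pE] := pa; have /factor_theorem[q' qE] := qa.
  have elE : el p q = el p' q' * pi ^+ 1 by rewrite el_pi expr1 -pE -qE.
  have el0' : el p' q' != 0 by apply: contraNneq el0; rewrite elE => ->; rewrite mul0r.
  have [|e ve] := IH p' q' _ el0'; last first.
    by exists (e + 1%:Z); rewrite elE; apply: has_valM (has_val_pi 1).
  have lep (r r' : {poly k}) : r = r' * ('X - a%:P) -> (size r' + (r != 0)%R = size r)%N.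
    move=> ->; have [->|r0] := eqVneq r' 0; first by rewrite mul0r size_poly0 eqxx.
    by rewrite size_Mmonic ?monicXsubC // size_XsubC mulf_neq0 ?polyXsubC_eq0 //= addn2 addn1.
  have := lep _ _ pE; have := lep _ _ qE.
  have : (p != 0) || (q != 0).
    rewrite -negb_and; apply: contra el0 => /andP[/eqP-> /eqP->].
    by rewrite /el tofrac0 rmorph0 mul0r addr0.
  move: le_n; move: (size p) (size q) (size p') (size q') (p != 0) (q != 0).
  by clear=> m1 m2 m3 m4 [] []; lia.
have [ev0|/eqP ev0] := eqVneq (ev p q) 0; last first.
  by exists 0; apply: has_val_unit; exists p, q; split=> //; apply/eqP.
(* If p(a) + q(a) b and p(a) - q(a) b both vanished, so would 2 p(a) and 2 b q(a), against the
   absence of a common root. *)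
have uconj : unit (el p (- q)).
  exists p, (- q); split=> //; rewrite /ev hornerN mulNr.
  apply: contraNneq nd => ev0'; rewrite /root.
  have p2 : 2%:R * p.[a] = 0.
    have -> : 2%:R * p.[a] = ev p q + (p.[a] - q.[a] * b) by rewrite /ev; ring.
    by rewrite ev0 ev0' addr0.
  have q2 : 2%:R * b * q.[a] = 0.
    have -> : 2%:R * b * q.[a] = ev p q - (p.[a] - q.[a] * b) by rewrite /ev; ring.
    by rewrite ev0 ev0' subr0.
  move/eqP: p2; rewrite mulf_eq0 (negPf two0) /= => ->.
  by move/eqP: q2; rewrite !mulf_eq0 (negPf two0) (negPf b0).
have nE : el p (- q) * el p q = X (p ^+ 2 - g * q ^+ 2)%:F.
  rewrite elM /el; have -> : p * q + - q * p = 0 by ring.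
  by rewrite !rmorph0 mul0r addr0; congr (X _%:F); ring.
have n0 : p ^+ 2 - g * q ^+ 2 != 0.
  by rewrite -tofrac_eq0 -(fmorph_eq0 X) -nE mulf_neq0 // (unit_neq0 uconj).
have [e ve] := has_val_poly n0; exists (e - 0).
have -> : el p q = X (p ^+ 2 - g * q ^+ 2)%:F * (el p (- q))^-1.
  by rewrite -nE mulrAC mulfV ?mul1r // (unit_neq0 uconj).
exact: (has_valM ve (has_valV (unit_neq0 uconj) (has_val_unit uconj))).
Qed.

Let has_val_ex h : h != 0 -> exists e, has_val h e.
Proof.
move=> h0.
have [p [q [d [d0 hE]]]] : exists p q d, d != 0 /\ h * X d%:F = el p q.
  have frac A : exists p d, d != 0 /\ A = p%:F / d%:F.
    have [->|/frac_neq0[p [d [_ d0 ->]]]] := eqVneq A 0; last by exists p, d.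
    by exists 0, 1; rewrite oner_neq0 tofrac0 mul0r.
  have [p [d [d0 pE]]] := frac (re_part X h); have [q [d' [d0' qE]]] := frac (im_part X h).
  exists (p * d'), (q * d), (d * d'); split; first by rewrite mulf_neq0.
  have dn (r : {poly k}) : r != 0 -> X r%:F != 0 by move=> r0; rewrite fmorph_eq0 tofrac_eq0.
  rewrite [h in LHS](coordsE X) pE qE /el !fmorph_div !rmorphM /=.
  by field; rewrite !dn.
have dn : X d%:F != 0 by rewrite fmorph_eq0 tofrac_eq0.
have [|e ve] := @has_val_el p q; first by rewrite -hE mulf_neq0.
have [e' ve'] := has_val_poly d0.
exists (e - e'); have -> : h = el p q / X d%:F by rewrite -hE mulfK.
exact: (has_valM ve (has_valV dn ve')).
Qed.

Let has_val_ge0 p q e : has_val (el p q) e -> 0 <= e.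
Proof.
move=> [c [d [m [n [[p' [q' [-> _]]] ud E ->]]]]]; rewrite subr_ge0 lez_nat leqNgt.
apply/negP => lt_nm; move: ud.
have -> : d = el p' q' * el p q * pi ^+ (m - n).-1.+1.
  rewrite prednK ?subn_gt0 //; apply: (mulIf (expf_neq0 n pi_neq0)).
  by rewrite -[RHS]mulrA -exprD subnK ?E // ltnW.
by rewrite elM => /unit_pi.
Qed.

Let v h : int := if pselect (h != 0) is left h0 then projT1 (cid (has_val_ex h0)) else 0.

Let vP h : h != 0 -> has_val h (v h).
Proof. by rewrite /v => h0; case: pselect => // h0'; case: cid. Qed.

Let vE h e : h != 0 -> has_val h e -> v h = e.
Proof. by move=> h0; apply: has_val_uniq; apply: vP. Qed.

(** The valuation is the order of vanishing at (a, b). Since x - a has value 1, its restriction to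
    k(x) is the order at a itself and not a multiple. *)
Lemma unramified_place_exists :
  exists v : F -> int, [/\ valuation (fun c => X (rat_const c)) v
    & forall A, v (X A) = ord (Some a) A].
Proof.
have v0 : v 0 = 0 by rewrite /v; case: pselect => // n0; case/eqP: (n0).
have vV : valuation (fun c => X (rat_const c)) v.
  split=> // [h h' h0 h0'|h h' h0 h0' hh0|c].
  - exact: (vE (mulf_neq0 h0 h0') (has_valM (vP h0) (vP h0'))).
  - have [c [d [m [n [uc ud E ->]]]]] := vP h0.
    have [c' [d' [m' [n' [uc' ud' E' ->]]]]] := vP h0'.
    (* Over the common denominator c c' pi^(m + m'), the power pi^N comes out of both summands, and
       the cofactor lies in k[x, y], hence has nonnegative order. *)
    pose N := minn (n + m') (n' + m).
    have [p [q elE]] : exists p q, el p q =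
        c' * d * pi ^+ (n + m' - N) + c * d' * pi ^+ (n' + m - N).
      have := unitM uc' ud; have := unitM uc ud'.
      move=> [p [q [-> _]]] [p' [q' [-> _]]].
      by rewrite !el_pi elD; do 2 eexists.
    have E2 : c * c' * (h + h') * pi ^+ (m + m') = el p q * pi ^+ N.
      rewrite elE mulrDl -!mulrA -!exprD !subnK ?geq_minl ?geq_minr // !exprD.
      have -> : c' * (d * (pi ^+ n * pi ^+ m')) = d * pi ^+ n * c' * pi ^+ m' by ring.
      have -> : c * (d' * (pi ^+ n' * pi ^+ m)) = d' * pi ^+ n' * c * pi ^+ m by ring.
      by rewrite -E -E'; ring.
    have el0 : el p q != 0.
      have : c * c' * (h + h') * pi ^+ (m + m') != 0.
        by rewrite !mulf_neq0 ?expf_neq0 // unit_neq0.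
      by rewrite E2; apply: contraNneq => ->; rewrite mul0r.
    have [e ve] := has_val_el el0; have e_ge0 := has_val_ge0 ve.
    have := has_valM ve (has_val_pi N); rewrite -E2.
    have := has_valM (has_valM (has_val_unit (unitM uc uc')) (vP hh0)) (has_val_pi (m + m')).
    move=> H /(has_val_uniq H); rewrite /N; move: (v (h + h')) e e_ge0 {ve} => x e.
    by rewrite minEle; case: ifP; lia.
  have [->|c0] := eqVneq c 0; first by rewrite /rat_const polyC0 tofrac0 rmorph0.
  have uc : unit (X (rat_const c)) by apply: unit_poly; rewrite rootC.
  exact: (vE (unit_neq0 uc) (has_val_unit uc)).
exists v; split=> // A.
have v1 : v pi = 1 := vE pi_neq0 (has_val_pi 1).
have rV := valuation_restrict vV.
by rewrite (valuation_finite_ord (a := a) rV) v1 // mul1r.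
Qed.

End UnramifiedPlace.

Lemma mulrn2z (n : int) : n *+ 2 = 2 * n.
Proof. by lia. Qed.

(** * Extension of a valuation for which [gamma] has odd value *)

Section RamifiedValuation.

Variables (T : Type) (E F : fieldType) (c : T -> E) (gamma : E) (X : quad_ext F gamma).
Variables (o : E -> int) (m : int).
Hypotheses (oP : valuation c o) (om : o gamma = 2 * m + 1) (gamma0 : gamma != 0).
Implicit Types (a b : E) (h : F) (v : F -> int).

Local Notation y := (qgen X).
Local Notation valF v := (valuation (fun x => X (c x)) v).

(** An odd value of [gamma] forces ramification: the place above is unique, of ramification index 2
    and residue degree 1, so its normalized value is the value of the norm. *)
Definition norm_val h : int := o (qnorm X h).

Lemma qnorm_qgen : qnorm X y = - gamma.
Proof.
have := qnorm_coords X 0 1; rewrite rmorph0 rmorph1 add0r mul1r => ->.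
by rewrite expr0n expr1n mulr1 sub0r.
Qed.

Lemma norm_val_qgen : norm_val y = 2 * m + 1.
Proof. by rewrite /norm_val qnorm_qgen (valnN oP). Qed.

Lemma norm_val_base a : norm_val (X a) = 2 * o a.
Proof. by rewrite /norm_val qnorm_base (valnX oP) mulrn2z. Qed.

(** In the norm a^2 - gamma b^2 the two terms have values of opposite parity, so no cancellation
    occurs. *)
Lemma norm_val_coords a b : a != 0 -> b != 0 ->
  norm_val (X a + X b * y) = Num.min (2 * o a) (2 * o b + (2 * m + 1)).
Proof.
move=> a0 b0; rewrite /norm_val qnorm_coords.
have b0' : - (gamma * b ^+ 2) != 0 by rewrite oppr_eq0 mulf_neq0 ?expf_neq0.
have ob : o (- (gamma * b ^+ 2)) = 2 * o b + (2 * m + 1).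
  by rewrite (valnN oP) (valnM oP) ?expf_neq0 // (valnX oP) mulrn2z om addrC.
have oa : o (a ^+ 2) = 2 * o a by rewrite (valnX oP) mulrn2z.
have [|_ ->] := valn_add_ne oP (expf_neq0 2 a0) b0'; last by rewrite oa ob.
by rewrite oa ob; apply/eqP; lia.
Qed.

Lemma norm_val_qgenM b : b != 0 -> norm_val (X b * y) = 2 * o b + (2 * m + 1).
Proof.
move=> b0; rewrite /norm_val qnormM qnorm_base qnorm_qgen (valnM oP).
- by rewrite (valnX oP) (valnN oP) om mulrn2z.
- exact: expf_neq0.
by rewrite oppr_eq0.
Qed.

(** A lower bound can thus be tested on each coordinate, which reduces the ultrametric inequality
    for [norm_val] to that for [o]. The vanishing alternatives make up for the convention that 0 has
    value 0. *)
Lemma norm_val_ge h (n : int) : h != 0 ->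
  (n <= norm_val h) =
  ((re_part X h == 0) || (n <= 2 * o (re_part X h))) &&
  ((im_part X h == 0) || (n <= 2 * o (im_part X h) + (2 * m + 1))).
Proof.
move: (coordsE X h); move: (re_part X h) (im_part X h) => a b ->.
have [->|a0] := eqVneq a 0; have [->|b0] := eqVneq b 0 => /=.
- by rewrite rmorph0 mul0r addr0 eqxx.
- by rewrite rmorph0 add0r norm_val_qgenM.
- by rewrite rmorph0 mul0r addr0 norm_val_base andbT.
by move=> _; rewrite norm_val_coords // le_min.
Qed.

Lemma norm_val_valuation : valF norm_val.
Proof.
split.
- by rewrite -(rmorph0 X) norm_val_base (valn0 oP) mulr0.
- by move=> h h' h0 h0'; rewrite /norm_val qnormM (valnM oP) // qnorm_eq0.
- move=> h h' h0 h0' hh0.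
  have re_add : re_part X (h + h') = re_part X h + re_part X h'.
    by rewrite {1}[h](coordsE X) {1}[h'](coordsE X) coords_add re_coords.
  have im_add : im_part X (h + h') = im_part X h + im_part X h'.
    by rewrite {1}[h](coordsE X) {1}[h'](coordsE X) coords_add im_coords.
  set n := Num.min _ _; have nh : n <= norm_val h by rewrite ge_min lexx.
  have nh' : n <= norm_val h' by rewrite ge_min lexx orbT.
  clearbody n; move: nh nh'; rewrite !norm_val_ge // re_add im_add.
  have part (e : int) a a' :
      (a == 0) || (n <= 2 * o a + e) -> (a' == 0) || (n <= 2 * o a' + e) ->
      (a + a' == 0) || (n <= 2 * o (a + a') + e).
    have [->|a0 /= na] := eqVneq a 0; first by rewrite add0r.
    have [->|a0' /= na'] := eqVneq a' 0; first by rewrite addr0 na orbT.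
    have [//|aa0 /=] := eqVneq (a + a') 0.
    have [_ _ /(_ a a' a0 a0' aa0) + _] := oP.
    by move: na na'; move: (o a) (o a') (o (a + a')) n => x1 x2 x3 x4; lia.
  have := part 0; move: (part (2 * m + 1)) => {}part part0.
  move=> /andP[h1 h2] /andP[h1' h2']; apply/andP; split; last exact: part.
  by move: h1 h1' (part0 (re_part X h) (re_part X h')); rewrite !addr0; auto.
by move=> x; rewrite norm_val_base (valnC oP) mulr0.
Qed.

(* The value at [y] being half of an odd multiple of e, the two terms of a + b y never have
   the same value. *)
Lemma ramified_valuation_unique v (e : int) : valF v -> (exists t, v t = 1) -> 0 < e ->
  (forall a, v (X a) = e * o a) -> v =1 norm_val.
Proof.
move=> vP [t vt] e_gt0 vX; have y0 : y != 0 := qgen_neq0 X gamma0.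
have vy : 2 * v y = e * (2 * m + 1) by rewrite -om -vX -qgen_sqr (valnX vP) mulrn2z.
(* From 2 v(y) = e (2 m + 1) the integer e is even, with half v(y) - e m. *)
have [e' eE vyE] : exists2 e', e = 2 * e' & e' = v y - e * m.
  by exists (v y - e * m) => //; lia.
have {vyE} vy : v y = e' * (2 * m + 1) by rewrite eE in vy vyE *; lia.
have vE h : h != 0 -> v h = e' * norm_val h.
  move: (coordsE X h); move: (re_part X h) (im_part X h) => a b ->.
  have vyB : b != 0 -> v (X b * y) = e' * (2 * o b + (2 * m + 1)).
    by move=> b0; rewrite (valnM vP _ y0) ?fmorph_eq0 // vX vy eE; lia.
  have vA : v (X a) = e' * (2 * o a) by rewrite vX eE; lia.
  have [->|a0] := eqVneq a 0; have [->|b0] := eqVneq b 0.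
  - by rewrite rmorph0 mul0r addr0 eqxx.
  - by rewrite rmorph0 add0r norm_val_qgenM // vyB.
  - by rewrite rmorph0 mul0r addr0 vA norm_val_base.
  move=> _; rewrite norm_val_coords //.
  have XA0 : X a != 0 by rewrite fmorph_eq0.
  have XB0 : X b * y != 0 by rewrite mulf_neq0 ?fmorph_eq0.
  have e'_gt0 : 0 < e' by lia.
  have [|_ ->] := valn_add_ne vP XA0 XB0.
    by rewrite vA vyB // (inj_eq (mulfI (lt0r_neq0 e'_gt0))); apply/eqP; lia.
  by rewrite vA vyB // minr_pMr ?ltW.
have t0 : t != 0 by apply: contra_eq_neq vt => ->; rewrite (valn0 vP).
(* The value 1 is attained and is a multiple of the positive integer e'. *)
have e'1 : e' = 1.
  have := vE t t0; rewrite vt; have : 0 < e' by lia.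
  move: e' (norm_val t) {eE vy vE} => x n x_gt0 xn.
  have n_gt0 : 0 < n by rewrite -(pmulr_rgt0 _ x_gt0) -xn.
  have : x * 1 <= x * n by rewrite ler_pM2l.
  by rewrite -xn; lia.
move=> h; have [->|/vE->] := eqVneq h 0; last by rewrite e'1 mul1r.
by rewrite (valn0 vP) -(rmorph0 X) norm_val_base (valn0 oP) mulr0.
Qed.

End RamifiedValuation.

Section RamifiedPlaces.

Variables (k : closedFieldType) (g : {poly k}) (F : fieldType).
Variable X : quad_ext F (g%:F).
Hypotheses (odd_g : odd (size g).-1) (sep_g : separable_poly g).
Implicit Types (p q : {poly k}) (h : F) (A B : {fraction {poly k}}) (v : F -> int).
Implicit Type u : option k.

Local Notation y := (qgen X).
Local Notation norm := (qnorm X).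
Local Notation valF v := (valuation (fun c => X (rat_const c)) v).

Definition is_place v := valF v /\ exists t, v t = 1.

Definition ramified u := if u is Some a then root g a else true.

Definition ram_place u : F -> int := norm_val X (ord u).

Lemma odd_size_neq0 : g != 0.
Proof. by apply: contraTneq odd_g => ->; rewrite size_poly0. Qed.

Let gF0 : g%:F != 0 :> {fraction {poly k}}.
Proof. by rewrite tofrac_eq0 odd_size_neq0. Qed.

Lemma mup_separable (a : k) : root g a -> mup a g = 1%N.
Proof.
move=> ga; have g0 := odd_size_neq0.
have : (0 < mup a g)%N by rewrite -XsubC_dvd // dvdp_XsubCl.
case E : (mup a g) => [|[|m]] // _.
have : (('X - a%:P) ^+ 2 %| g) by rewrite -mup_geq // E.
case/dvdpP=> q gE; move: sep_g; rewrite gE expr2 mulrA separable_root.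
by rewrite rootM root_XsubC eqxx orbT andbF.
Qed.

Lemma ord_ramified u : ramified u ->
  ord u g%:F = if u is Some _ then 1 else - (size g).-1%:Z.
Proof.
have g0 := odd_size_neq0.
by case: u => [a|] /= r; rewrite ord_poly //= mup_separable.
Qed.

Lemma ord_ramified_odd u : ramified u -> exists m : int, ord u g%:F = 2 * m + 1.
Proof.
move=> /ord_ramified ->; case: u => [_|]; first by exists 0; lia.
by exists (- ((size g).-1 %/ 2)%:Z - 1); lia.
Qed.

Lemma ram_place_base u A : ram_place u (X A) = 2 * ord u A.
Proof. exact: (norm_val_base X (ord_valuation u)). Qed.

Lemma ram_place_is_place u : ramified u -> is_place (ram_place u).
Proof.
move=> ru; have [m om] := ord_ramified_odd ru.
have vP := norm_val_valuation X (ord_valuation u) om gF0; split=> //.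
have vy := norm_val_qgen X (ord_valuation u) om.
have gE := ord_ramified ru; case: u => [a|] in ru om gE vP vy *.
  by exists y; rewrite /ram_place vy -om gE.
(* With d the odd degree of g, x has value -2 and y has value -d at infinity, so x^((d-1)/2) / y is
   a uniformizer. *)
exists (X ('X ^+ ((size g).-1 %/ 2))%:F / y).
have x0 : X ('X ^+ ((size g).-1 %/ 2))%:F != 0.
  by rewrite fmorph_eq0 tofrac_eq0 expf_neq0 ?polyX_eq0.
rewrite /ram_place (valn_div vP x0 (qgen_neq0 X gF0)) vy -om gE.
rewrite -/(ram_place None) ram_place_base ord_poly ?expf_neq0 ?polyX_eq0 //= size_polyXn.
by move: (size g).-1 odd_g => n; lia.
Qed.

Lemma place_ramified_unique v u (e : int) : is_place v -> ramified u -> 0 < e ->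
  (forall A, v (X A) = e * ord u A) -> v =1 ram_place u.
Proof.
move=> [vP vt] ru e_gt0 vX; have [m om] := ord_ramified_odd ru.
exact: (ramified_valuation_unique (ord_valuation u) om gF0 vP vt e_gt0).
Qed.

Lemma place_over_root v a : is_place v -> root g a ->
  0 < v (X ('X - a%:P)%:F) -> v =1 ram_place (Some a).
Proof.
move=> vP ra va; apply: (@place_ramified_unique v (Some a) _ vP ra va) => A.
exact: (valuation_finite_ord (valuation_restrict vP.1)).
Qed.

Lemma place_over_inf v a : is_place v -> v (X ('X - a%:P)%:F) < 0 -> v =1 ram_place None.
Proof.
move=> vP va; have va' : 0 < - v (X ('X - a%:P)%:F) by rewrite oppr_gt0.
apply: (@place_ramified_unique v None _ vP isT va') => A.
exact: (valuation_inf_ord (valuation_restrict vP.1)).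
Qed.

End RamifiedPlaces.

Lemma sqr_mulVf (E : fieldType) (b : E) : b != 0 -> b ^+ 2 * b^-1 ^+ 2 = 1.
Proof. by move=> b0; rewrite -exprMn mulfV // expr1n. Qed.

(** * Functions with even divisor, modulo squares *)

Section SquareClasses.

Variables (k : closedFieldType) (g : {poly k}) (F : fieldType).
Variable X : quad_ext F (g%:F).
Hypotheses (odd_g : odd (size g).-1) (sep_g : separable_poly g).
Hypothesis two0 : 2%:R != 0 :> k.
Variable rs : seq k.
Hypotheses (uniq_rs : uniq rs) (mem_rs : forall a, root g a = (a \in rs)).
Hypothesis size_rs : size rs = (size g).-1.
Implicit Types (h w : F) (A B : {fraction {poly k}}) (v : F -> int) (S : seq k).

Local Notation y := (qgen X).
Local Notation norm := (qnorm X).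
Local Notation is_place := (is_place X).
Local Notation ram_place := (ram_place X).

Definition root_prod S : {fraction {poly k}} := (\prod_(z <- S) ('X - z%:P))%:F.

Let gF0 : g%:F != 0 :> {fraction {poly k}}.
Proof. by rewrite tofrac_eq0 odd_size_neq0. Qed.

Lemma root_prod_neq0 S : root_prod S != 0.
Proof. by rewrite tofrac_eq0 monic_neq0 ?monic_prod_XsubC. Qed.

Lemma ord_root_prod a S : uniq S -> ord (Some a) (root_prod S) = (a \in S)%:Z.
Proof.
move=> uS; rewrite ord_poly ?monic_neq0 ?monic_prod_XsubC //=.
by rewrite mu_prod_XsubC count_uniq_mem.
Qed.

Lemma ord_inf_root_prod S : ord None (root_prod S) = - (size S)%:Z.
Proof. by rewrite ord_poly ?monic_neq0 ?monic_prod_XsubC //= size_prod_XsubC. Qed.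

Lemma conj_is_place v : is_place v -> is_place (fun h => v (conj_fun X h)).
Proof.
move=> [[v0 vM vD vC] [t vt]]; split; last by exists (conj_fun X t); rewrite conjK.
split.
- by rewrite -(rmorph0 X) conj_base rmorph0.
- by move=> a b a0 b0; rewrite conjM vM ?conj_eq0.
- by move=> a b a0 b0 ab0; rewrite conjD vD -?conjD ?conj_eq0.
by move=> c; rewrite conj_base.
Qed.

Lemma place_over_nonroot a : ~~ root g a ->
  exists2 v, is_place v & forall A, v (X A) = ord (Some a) A.
Proof.
move=> ga; have [b bb] := closed_sqrt g.[a].
have b0 : b != 0 by apply: contraNneq ga => b0; rewrite /root -bb b0 expr0n.
have [v [vP vX]] := unramified_place_exists X bb b0 two0.
by exists v => //; split=> //; exists (X ('X - a%:P)%:F); rewrite vX ord_XsubC eqxx.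
Qed.

Lemma even_divisor_square_class h : h != 0 ->
  (forall v, is_place v -> (2 %| v h)%Z) ->
  exists S w, [/\ uniq S, {subset S <= rs}, w != 0 & h * X (root_prod S) = w ^+ 2].
Proof.
move=> h0 hev.
have n0 : norm h != 0 by rewrite qnorm_eq0.
have [|B nB] := even_ord_square n0.
  move=> a; have [ga|ga] := boolP (root g a).
    by apply: (hev (ram_place (Some a))); apply: ram_place_is_place.
  have [v vP vX] := place_over_nonroot ga.
  (* The order of the norm at a is v(h) + v(conj h), and the second term is the value of h at the
     conjugate place, again even. *)
  rewrite -vX qnormE (valnM vP.1) ?conj_eq0 //.
  have := hev _ vP; have := hev _ (conj_is_place vP).
  by move: (v h) (v _); clear=> x1 x2; lia.
have B0 : B != 0 by apply: contraNneq n0; rewrite nB => ->; rewrite expr0n.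
have XB0 : X B != 0 by rewrite fmorph_eq0.
have [w w0 hw] : exists2 w, w != 0 & h * conj_fun X w = X B * w.
  have [|w w0 uw] := @qnorm1_div_conj _ _ _ X gF0 (h * X B^-1).
    by rewrite qnormM nB (qnorm_base X B^-1) sqr_mulVf.
  by exists w => //; rewrite -[in RHS]uw fmorphV; field.
have nw0 : norm w != 0 by rewrite qnorm_eq0.
have cw0 : conj_fun X w != 0 by rewrite conj_eq0.
have [A A0 hE] : exists2 A, A != 0 & h = X A * w ^+ 2.
  (* h = B w / conj(w), and w / conj(w) is w^2 divided by the norm of w. *)
  exists (B / norm w); first exact: mulf_neq0 B0 (invr_neq0 nw0).
  rewrite fmorph_div qnormE; apply: (mulIf cw0); rewrite hw.
  by field; rewrite w0 cw0.
have Aev a : ~~ root g a -> (2 %| ord (Some a) A)%Z.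
  move=> /place_over_nonroot[v vP vX]; have := hev v vP.
  have XA0 : X A != 0 by rewrite fmorph_eq0.
  rewrite hE (valnM vP.1 XA0 (expf_neq0 2 w0)) (valnX vP.1) vX.
  by move: (ord (Some a) A) (v w); clear=> x1 x2; lia.
(* At a root the place above doubles orders, so nothing is known about the parity of the order of A
   there. The factors x - z at the roots of odd order correct it, after which A becomes a square in
   k(x). *)
pose S := [seq z <- rs | ~~ (2 %| ord (Some z) A)%Z].
have uS : uniq S by rewrite filter_uniq.
have [|r rE] := even_ord_square (mulf_neq0 A0 (root_prod_neq0 S)).
  move=> a; rewrite (valnM (ord_valuation _) A0 (root_prod_neq0 S)) ord_root_prod //.
  have := @Aev a; rewrite mem_filter mem_rs; move: (ord (Some a) A) (a \in rs); clear=> x [] /=.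
    by case: (boolP (2 %| x)%Z) => /=; lia.
  by rewrite andbF addr0 => /(_ isT).
exists S, (X r * w); split=> //.
- by move=> z; rewrite mem_filter => /andP[].
- rewrite mulf_neq0 // fmorph_eq0; apply: contraNneq (mulf_neq0 A0 (root_prod_neq0 S)).
  by rewrite rE => ->; rewrite expr0n.
by rewrite hE mulrAC -rmorphM rE rmorphXn exprMn.
Qed.

(** Write h = A + B y. If B = 0, then h has even value at the point over any z in S, where its value
    should be 1. Otherwise B is a polynomial, so B y has at infinity a pole of order at least d, the
    degree of g; the pole of h, of order #S, is at least as large. *)
Lemma half_root_divisor_trivial S h : uniq S -> {subset S <= rs} -> h != 0 ->
  (forall v, is_place v -> 2 * v h = v (X (root_prod S))) ->
  S = [::] \/ size S = size rs.
Proof.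
move=> uS sS h0 hS; pose A := re_part X h; pose B := im_part X h.
have hE : h = X A + X B * y := coordsE X h.
have [B0|B0] := eqVneq B 0.
  left; case E : S => [//|z S'].
  have zS : z \in S by rewrite E mem_head.
  have gz : root g z by rewrite mem_rs sS.
  have := hS _ (ram_place_is_place X odd_g sep_g (u := Some z) gz).
  rewrite hE B0 rmorph0 mul0r addr0 !ram_place_base ord_root_prod // zS.
  by move: (ord (Some z) A); clear=> x; lia.
right; have XB0 : X B != 0 by rewrite fmorph_eq0.
have y0 : y != 0 := qgen_neq0 X gF0.
(* h and its conjugate have nonnegative value over a, hence so has their difference 2 B y. As v(y)
   is less than the ramification index e, the order of B exceeds -1. *)
have Bint a : 0 <= ord (Some a) B.
  have [v vP [e [e_gt0 vX ve]]] : exists2 v, is_place v & exists e : int,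
      [/\ 0 < e, forall A, v (X A) = e * ord (Some a) A & v y < e].
    have [ga|nga] := boolP (root g a).
      exists (ram_place (Some a)); first exact: ram_place_is_place.
      exists 2; split=> // [A'|]; first by rewrite ram_place_base.
      have [m om] := ord_ramified_odd odd_g sep_g (u := Some a) ga.
      have -> : ram_place (Some a) y = 2 * m + 1 := norm_val_qgen X (ord_valuation _) om.
      by rewrite -om (ord_ramified odd_g sep_g (u := Some a) ga).
    have [v vP vX] := place_over_nonroot nga.
    exists v => //; exists 1; split=> // [A'|]; first by rewrite vX mul1r.
    have : v (y ^+ 2) = 0.
      by rewrite qgen_sqr vX ord_poly ?odd_size_neq0 //= mupNroot.
    by rewrite (valnX vP.1) mulrn2z; move: (v y); clear=> n; lia.
  have vh v' : is_place v' -> (forall A, v' (X A) = e * ord (Some a) A) -> 0 <= v' h.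
    move=> vP' vX'; have := hS v' vP'; rewrite vX' ord_root_prod //.
    by case: (a \in S); move: (v' h) e_gt0; clear=> x; lia.
  have vh1 := vh v vP vX.
  have vh2 : 0 <= v (- conj_fun X h).
    rewrite (valnN vP.1); apply: (vh (fun h => v (conj_fun X h))) => [|A'].
      exact: conj_is_place.
    by rewrite conj_base.
  have two_neq0 : X (rat_const 2%:R) != 0 by rewrite fmorph_eq0 tofrac_eq0 polyC_eq0.
  have dE : h - conj_fun X h = X (rat_const 2%:R) * (X B * y).
    rewrite {1}hE /conj_fun -/A -/B.
    have -> : rat_const (2%:R : k) = 2%:R by rewrite /rat_const !rmorph_nat.
    by rewrite rmorph_nat; ring.
  have d0 : h - conj_fun X h != 0 by rewrite dE !mulf_neq0.
  have := valn_ge vP.1 h0 _ d0 vh1 vh2; rewrite oppr_eq0 conj_eq0 => /(_ h0).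
  rewrite dE (valnM vP.1) ?mulf_neq0 // (valnC vP.1) add0r (valnM vP.1 XB0 y0) vX.
  by move: (ord (Some a) B) (v y) ve e_gt0; clear=> x1 x2; nia.
have [p BE] := integral_ord_poly Bint.
have := ord_inf_poly_le0 p; rewrite -BE => B_le0.
have infP := ram_place_is_place X odd_g sep_g (u := None) isT.
have := hS _ infP; rewrite ram_place_base ord_inf_root_prod => hinf.
have [m om] := ord_ramified_odd odd_g sep_g (u := None) isT.
have : ram_place None h <= 2 * ord None B + ord None g%:F.
  have := norm_val_ge X (ord_valuation None) om gF0 (ram_place None h) h0.
  by rewrite lexx om -/B (negPf B0) /= => /esym /andP[].
rewrite (ord_ramified odd_g sep_g (u := None) isT) -size_rs.
have := uniq_leq_size uS sS; move: (ord None B) (ram_place None h) B_le0 hinf.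
by move: (size S) (size rs); clear=> n1 n2 x1 x2; lia.
Qed.

End SquareClasses.

(** * Two-torsion of the Jacobian *)

Section CurveFunctionField.

Variables (k : closedFieldType) (g : {poly k}) (odd_g : odd (size g).-1).

Local Notation F := (func_field odd_g).
Local Notation Frac := {fraction {poly k}}.

Definition of_rat (A : Frac) : F := func_of_poly odd_g A%:P.
HB.instance Definition _ := GRing.RMorphism.copy of_rat
  (func_of_poly odd_g \o polyC : Frac -> F).

Lemma size_curve_poly : size (mk_monic (curve_poly g)) = 3.
Proof.
by rewrite mk_monicE ?size_XnsubC //; exact: curve_poly_monic_irreducible.
Qed.

Lemma curve_coords (A B : Frac) : of_rat A + of_rat B * func_of_poly odd_g 'X =
  func_of_poly odd_g (A%:P + B%:P * 'X).
Proof.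
by apply/esym/(etrans (rmorphD _ _ _)); congr (_ + _); exact: rmorphM.
Qed.

Lemma polyn_coords (A B : Frac) :
  polyn (func_of_poly odd_g (A%:P + B%:P * 'X)) = A%:P + B%:P * 'X.
Proof.
apply: in_qpoly_small; rewrite size_curve_poly.
apply: leq_ltn_trans (size_polyD _ _) _; rewrite gtn_max size_polyC mul_polyC.
by rewrite (leq_ltn_trans (size_scale_leq _ _)) ?size_polyX // andbT; case: (A != 0).
Qed.

Lemma curve_gen_sqr : (func_of_poly odd_g 'X : F) ^+ 2 = of_rat g%:F.
Proof.
have hI := curve_poly_monic_irreducible odd_g.
have C0 : func_of_poly odd_g (curve_poly g) = 0.
  apply: val_inj; rewrite /= mk_monicE //; case: hI => _ hM.
  exact: Pdiv.RingMonic.rmodpp.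
apply/eqP; rewrite -subr_eq0; apply/eqP; rewrite -C0; symmetry.
apply: etrans (rmorphB _ _ _) _; congr (_ - _); exact: (rmorphXn (func_of_poly odd_g)).
Qed.

(** Residues modulo Y^2 - g have degree at most 1, and their two coefficients are the coordinates.
    Opacity then keeps the quotient ring from unfolding. *)
Definition curve_ext : quad_ext F (g%:F).
Proof.
apply: (@QuadExt _ _ _ of_rat (func_of_poly odd_g 'X)
  (fun h : F => (polyn h)`_0) (fun h : F => (polyn h)`_1)).
- exact: curve_gen_sqr.
- move=> a b; rewrite curve_coords polyn_coords mul_polyC.
  by rewrite coefD coefZ coefX coefC mulr0 addr0.
- move=> a b; rewrite curve_coords polyn_coords mul_polyC.
  by rewrite coefD coefZ coefX coefC mulr1 add0r.
move=> h; rewrite curve_coords -[LHS]func_of_polyK; congr func_of_poly.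
have := leq_trans (size_mk_monic h) (eq_leq size_curve_poly); rewrite ltnS => sz.
apply/polyP => i; rewrite mul_polyC coefD coefZ coefX coefC.
case: i => [|[|i]]; rewrite ?mulr0 ?mulr1 ?add0r ?addr0 //=.
by rewrite nth_default // (leq_trans sz).
Defined.
#[global] Opaque curve_ext.

Lemma place_valuation (v : place odd_g) : is_place curve_ext v.
Proof. by have [v0 vM vD vC vt] := placeP v. Qed.

Lemma is_place_valuation (v : F -> int) : is_place curve_ext v -> is_valuation v.
Proof. by case=> -[v0 vM vD vC] vt. Qed.

Hypothesis sep_g : separable_poly g.
Hypothesis two0 : 2%:R != 0 :> k.

Local Notation X := curve_ext.
Local Notation divisor := {freeg (place odd_g)}.
Local Notation pi := (\pi_(Quotient.quot (@principal _ _ odd_g))).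

Lemma root_place_exists u : ramified g u ->
  {v : place odd_g | v =1 ram_place X u}.
Proof.
move=> ru; have vP := ram_place_is_place X odd_g sep_g ru.
by exists (Place (is_place_valuation vP)).
Qed.

Definition inf_place : place odd_g := sval (root_place_exists (u := None) isT).

Lemma inf_placeE : inf_place =1 ram_place X None.
Proof. exact: (svalP (root_place_exists (u := None) isT)). Qed.

(** The default [inf_place] makes [root_divisor a] zero when a is not a root. *)
Definition root_place (a : k) : place odd_g :=
  if @idP (root g a) is ReflectT ra then sval (root_place_exists (u := Some a) ra)
  else inf_place.

Lemma root_placeE a : root g a -> root_place a =1 ram_place X (Some a).
Proof.
rewrite /root_place => ga; case: {-}_ / idP => // ra.
exact: (svalP (root_place_exists (u := Some a) ra)).
Qed.

Fact root_divisor_subproof a :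
  << root_place a >> - << inf_place >> \in @degree0_pred _ _ odd_g.
Proof. by rewrite unfold_in degB !degU subrr. Qed.

Definition root_divisor a : divisor0 odd_g := Divisor0 (root_divisor_subproof a).

Definition coeff0 (v : place odd_g) (D : divisor0 odd_g) : int := coeff v D.

Fact coeff0_zmod_morphism v : zmod_morphism (coeff0 v).
Proof. by move=> D E; rewrite /coeff0 /= coeffB. Qed.
HB.instance Definition _ v := GRing.isZmodMorphism.Build
  (divisor0 odd_g) int (coeff0 v) (coeff0_zmod_morphism v).

Lemma coeff0D v D E : coeff0 v (D + E) = coeff0 v D + coeff0 v E.
Proof. exact: raddfD. Qed.

Lemma coeff0_double v D : coeff0 v (D *+ 2) = 2 * coeff0 v D.
Proof. by rewrite raddfMn; apply: mulrn2z. Qed.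

(** By uniqueness, x - a has positive value only at P_a and negative value only at infinity, where
    the values are 2 and -2. *)
Lemma coeff_root_divisor v a : root g a ->
  2 * coeff0 v (root_divisor a) = v (X ('X - a%:P)%:F).
Proof.
move=> ga; rewrite /coeff0 coeffB !coeffU !mul1r.
have [va|va] := eqVneq (root_place a) v.
  rewrite -va root_placeE // ram_place_base ord_XsubC eqxx.
  case: eqVneq => // E.
  have := congr1 (fun w : place odd_g => w (X ('X - a%:P)%:F)) E.
  by rewrite inf_placeE root_placeE // !ram_place_base ord_XsubC ord_inf_XsubC eqxx.
have vP := place_valuation v.
have [vi|vi] := eqVneq inf_place v.
  by rewrite -vi inf_placeE ram_place_base ord_inf_XsubC.
rewrite subrr mulr0; case: (ltgtP 0 (v (X ('X - a%:P)%:F))) => // lt_v.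
  case/eqP: va; apply: place_inj => h.
  by rewrite root_placeE // (place_over_root odd_g sep_g vP ga lt_v).
case/eqP: vi; apply: place_inj => h.
by rewrite inf_placeE (place_over_inf odd_g sep_g vP lt_v).
Qed.

Definition root_class a : jacobian odd_g := pi (root_divisor a).

Lemma coeff_sum_root_divisor v S : {subset S <= root g} ->
  2 * coeff0 v (\sum_(a <- S) root_divisor a) = v (X (root_prod S)).
Proof.
have [vP _] := place_valuation v; move=> sS.
rewrite raddf_sum mulr_sumr /root_prod !rmorph_prod (valn_prod vP); last first.
  by move=> a _; rewrite fmorph_eq0 tofrac_eq0 polyXsubC_eq0.
by apply: eq_big_seq => a /sS; apply: coeff_root_divisor.
Qed.

Lemma pi_eq0 D : (pi D == 0 :> jacobian odd_g) = (D \in @principal _ _ odd_g).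
Proof.
have pi0 : pi 0 = 0 :> jacobian odd_g by apply: raddf0.
by rewrite -pi0 -[D in RHS]subr0 Quotient.idealrBE.
Qed.

Lemma root_class2 a : root g a -> root_class a *+ 2 = 0.
Proof.
move=> ga; apply/eqP.
have -> : root_class a *+ 2 = pi (root_divisor a *+ 2) by rewrite [RHS]raddfMn.
rewrite pi_eq0; apply/asboolP; exists (X ('X - a%:P)%:F).
  by rewrite fmorph_eq0 tofrac_eq0 polyXsubC_eq0.
by move=> v; rewrite -coeff_root_divisor //; exact: coeff0_double.
Qed.

Variable rs : seq k.
Hypotheses (uniq_rs : uniq rs) (mem_rs : forall a, root g a = (a \in rs)).
Hypothesis size_rs : size rs = (size g).-1.

Lemma sum_root_classes : \sum_(a <- rs) root_class a = 0.
Proof.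
have sS : {subset rs <= root g} by move=> a; rewrite -mem_rs.
have gE : g = lead_coef g *: \prod_(z <- rs) ('X - z%:P).
  apply: all_roots_prod_XsubC; last by rewrite uniq_rootsE.
    by rewrite size_rs prednK // size_poly_gt0 odd_size_neq0.
  by apply/allP => a /sS.
have -> : \sum_(a <- rs) root_class a = pi (\sum_(a <- rs) root_divisor a).
  by rewrite raddf_sum.
apply/eqP; rewrite pi_eq0; apply/asboolP.
have gF0 : g%:F != 0 :> Frac by rewrite tofrac_eq0 odd_size_neq0.
have y0 := qgen_neq0 X gF0; exists (qgen X) => // v.
have [vP _] := place_valuation v; rewrite -[LHS]/(coeff0 v _).
have gF : g%:F = rat_const (lead_coef g) * root_prod rs.
  by rewrite {1}gE -mul_polyC rmorphM.
have lc0 : X (rat_const (lead_coef g)) != 0.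
  by rewrite fmorph_eq0 tofrac_eq0 polyC_eq0 lead_coef_eq0 odd_size_neq0.
have rs0 : X (root_prod rs) != 0 by rewrite fmorph_eq0 root_prod_neq0.
have Xg : X g%:F = X (rat_const (lead_coef g)) * X (root_prod rs).
  by rewrite -rmorphM -gF.
have vy : v (qgen X) *+ 2 = 0 + v (X (root_prod rs)).
  rewrite -(valnC vP (lead_coef g)) -(valnX vP).
  exact: etrans (congr1 v (etrans (qgen_sqr X) Xg)) (valnM vP lc0 rs0).
have := etrans vy (etrans (add0r _) (esym (coeff_sum_root_divisor v sS))).
by move: (v (qgen X)) (coeff0 v _); clear=> x1 x2; lia.
Qed.

Lemma torsion2_root_classes (P : jacobian odd_g) : P *+ 2 = 0 ->
  exists S, [/\ uniq S, {subset S <= rs} & P = \sum_(a <- S) root_class a].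
Proof.
rewrite -[P]reprK; move: (repr P) => {P} D D2.
have : pi (D *+ 2) == 0 :> jacobian odd_g by rewrite -D2 [pi _]raddfMn.
rewrite pi_eq0 => /asboolP[h h0 hD'].
have hD (v : place odd_g) : v h = 2 * coeff0 v D by rewrite -coeff0_double -hD'.
have [|S [w [uS sS w0 hw]]] := even_divisor_square_class odd_g sep_g two0 uniq_rs mem_rs h0 (X := X).
  move=> v vP; have /= -> := hD (Place (is_place_valuation vP)).
  by rewrite dvdz_mulr.
exists S; split=> //.
have sS' : {subset S <= root g} by move=> a /sS; rewrite -mem_rs.
(* The classes have order at most 2, so the sign may be changed; then D plus the root divisors is
   the divisor of w, because h times the product over S is w^2. *)
have -> : \sum_(a <- S) root_class a = - \sum_(a <- S) root_class a.
  apply/eqP; rewrite -subr_eq0 opprK -mulr2n -sumrMnl; apply/eqP.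
  by rewrite big_seq big1 // => a /sS' /root_class2.
apply/eqP; rewrite -subr_eq0 opprK.
have -> : pi D + \sum_(a <- S) root_class a = pi (D + \sum_(a <- S) root_divisor a).
  by rewrite [RHS]raddfD raddf_sum.
rewrite pi_eq0; apply/asboolP; exists w => // v.
rewrite -[LHS]/(coeff0 v _) coeff0D.
have [vP _] := place_valuation v.
have := congr1 v hw; rewrite (valnX vP) (valnM vP) //; last first.
  by rewrite fmorph_eq0 root_prod_neq0.
rewrite -coeff_sum_root_divisor // hD mulrn2z.
by move: (coeff0 v D) (coeff0 v (\sum_(a <- S) _)) (v w); clear=> x1 x2 x3; lia.
Qed.

Lemma root_classes_relation S : uniq S -> {subset S <= rs} ->
  \sum_(a <- S) root_class a = 0 -> S = [::] \/ size S = size rs.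
Proof.
move=> uS sS S0.
have sS' : {subset S <= root g} by move=> a /sS; rewrite -mem_rs.
have : pi (\sum_(a <- S) root_divisor a) == 0 :> jacobian odd_g.
  by rewrite -S0 raddf_sum.
rewrite pi_eq0 => /asboolP[h h0 hD].
apply: (half_root_divisor_trivial (X := X) odd_g sep_g two0 mem_rs size_rs uS sS h0).
move=> v vP; have := hD (Place (is_place_valuation vP)) => /= <-.
exact: (coeff_sum_root_divisor (Place (is_place_valuation vP)) sS').
Qed.

End CurveFunctionField.

(** * Automorphisms of the curve and the points P_a *)

Section CurveAutomorphisms.

Variables (k : closedFieldType) (g : {poly k}) (odd_g : odd (size g).-1).
Hypothesis sep_g : separable_poly g.
Variable s : curve_aut g.

Local Notation X := (curve_ext odd_g).

Lemma func_map_XsubC a :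
  func_map (caut_inv s) (X ('X - a%:P)%:F) = X ('X - (caut_inv s a)%:P)%:F.
Proof.
apply: (etrans (func_map_of_poly odd_g (caut_inv_fix s) _)).
rewrite map_polyC /= rat_map_tofrac rmorphB /= map_polyX map_polyC; reflexivity.
Qed.

Lemma root_caut a : root g (caut s a) = root g a.
Proof. by rewrite -{1}(caut_fix s) mapf_root. Qed.

(** Only the sign of the value of x - s(a) at the transported place has to be found, since the place
    over a root is unique. *)
Lemma place_act_root a : root g a ->
  place_act s (root_place odd_g sep_g a) = root_place odd_g sep_g (caut s a).
Proof.
move=> ga; have gsa : root g (caut s a) by rewrite root_caut.
apply: place_inj => h; rewrite [RHS]root_placeE //.
apply: (place_over_root odd_g sep_g (place_valuation _) gsa) => /=.
by rewrite func_map_XsubC cautK root_placeE // ram_place_base ord_XsubC eqxx.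
Qed.

Lemma place_act_inf : place_act s (inf_place odd_g sep_g) = inf_place odd_g sep_g.
Proof.
apply: place_inj => h; rewrite [RHS]inf_placeE.
apply: (place_over_inf odd_g sep_g (place_valuation _) (a := 0)) => /=.
by rewrite func_map_XsubC inf_placeE ram_place_base ord_inf_XsubC.
Qed.

Lemma jacobian_act_root_class a : root g a ->
  jacobian_act s (root_class odd_g sep_g a) = root_class odd_g sep_g (caut s a).
Proof.
move=> ga; rewrite /root_class pi_jacobian_act; congr (\pi_ _ _).
apply: val_inj => /=.
have actB D E : divisor_act s (D - E) = divisor_act s D - divisor_act s E.
  exact: raddfB.
have actU v : divisor_act s << v >> = << place_act s v >>.
  by rewrite /divisor_act liftU scale1r.
by rewrite actB !actU place_act_root // place_act_inf.
Qed.

End CurveAutomorphisms.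

(** * Extension of embeddings *)

Section AutomorphismExtension.

Import classical_sets.
Local Open Scope classical_set_scope.

Variables (K : fieldType) (Kbar : closedFieldType) (iota : {rmorphism K -> Kbar}).
Hypothesis Kbar_alg : algebraic_closure iota.

Implicit Types (R : set (Kbar * Kbar)) (p q u : {poly Kbar}).

(* The graphs of the K-embeddings into [Kbar] of the K-subalgebras of [Kbar]. *)
Record embedding_graph R : Prop := EmbeddingGraph {
  graph_iota : forall a, R (iota a, iota a);
  graphB : forall x y x' y', R (x, y) -> R (x', y') -> R (x - x', y - y');
  graphM : forall x y x' y', R (x, y) -> R (x', y') -> R (x * x', y * y');
  graph_fun : forall y, R (0, y) -> y = 0 }.

Section GraphTheory.

Variable R : set (Kbar * Kbar).
Hypothesis RP : embedding_graph R.

Lemma graph0 : R (0, 0).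
Proof. by rewrite -(rmorph0 iota); apply: graph_iota. Qed.

Lemma graph1 : R (1, 1).
Proof. by rewrite -(rmorph1 iota); apply: graph_iota. Qed.

Lemma graphD x y x' y' : R (x, y) -> R (x', y') -> R (x + x', y + y').
Proof.
move=> H H'; have := graphB RP H (graphB RP graph0 H').
by rewrite !sub0r !opprK.
Qed.

Lemma graph_inj x y y' : R (x, y) -> R (x, y') -> y = y'.
Proof.
move=> H H'; have := graphB RP H H'; rewrite subrr => /(graph_fun RP)/eqP.
by rewrite subr_eq0 => /eqP.
Qed.

Lemma graph_sum (I : finType) (E E' : I -> Kbar) :
  (forall i, R (E i, E' i)) -> R (\sum_i E i, \sum_i E' i).
Proof.
move=> H; apply: (big_rec2 (fun x y => R (x, y))) => [|i x y _]; first exact: graph0.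
exact: graphD.
Qed.

Lemma graph_iota_poly (q : {poly K}) x y : R (x, y) ->
  R ((map_poly iota q).[x], (map_poly iota q).[y]).
Proof.
move=> H; elim/poly_ind: q => [|q c IH]; first by rewrite rmorph0 !horner0; apply: graph0.
rewrite rmorphD rmorphM /= map_polyX map_polyC !hornerE.
by apply: graphD; [apply: graphM|apply: graph_iota].
Qed.

(** A K-algebra of algebraic elements is a field: q1(x) x + c = 0 with c nonzero in K expresses x^-1
    as a polynomial in x over K. The image y satisfies the same equation. Dividing a polynomial that
    kills x by a power of X produces the nonzero constant term c. *)
Lemma graphV x y : R (x, y) -> R (x^-1, y^-1).
Proof.
move=> H; have [x0|x0] := eqVneq x 0.
  by move: H; rewrite x0 => /(graph_fun RP) ->; rewrite !invr0; apply: graph0.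
have [q [q1 [c [c0 qE qx]]]] : exists (q q1 : {poly K}) (c : K),
    [/\ c != 0, q = q1 * 'X + c%:P & root (map_poly iota q) x].
  have [p p0 px] := Kbar_alg x; have [n [q + pE]] := multiplicity_XsubC p 0.
  rewrite p0 subr0 in pE *; move=> /= q0.
  have /factor_theorem[q1 q1E] : root (q - (q.[0])%:P) 0.
    by rewrite /root !hornerE subrr.
  exists q, q1, q.[0]; split=> //; first by rewrite -[LHS](subrK (q.[0])%:P) q1E subr0.
  move: px; rewrite pE rmorphM rmorphXn /= map_polyX rootM.
  have /negPf-> : ~~ root ('X^n : {poly Kbar}) x by rewrite /root hornerXn expf_neq0.
  by rewrite orbF.
have qeval z : (map_poly iota q).[z] = (map_poly iota q1).[z] * z + iota c.
  by rewrite qE rmorphD rmorphM /= map_polyX map_polyC !hornerE.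
have H1 := graph_iota_poly q1 H.
have Hq := graph_iota_poly q H.
have ex : (map_poly iota q1).[x] * x + iota c = 0 by rewrite -qeval; apply/rootP.
have ey : (map_poly iota q1).[y] * y + iota c = 0.
  by rewrite -qeval; apply: (graph_fun RP); rewrite -[X in (X, _)](rootP qx).
have ic : iota c != 0 by rewrite fmorph_eq0.
have inv z : (map_poly iota q1).[z] * z + iota c = 0 ->
    z^-1 = (map_poly iota q1).[z] * iota (- c^-1).
  move/eqP; rewrite addr_eq0 => /eqP ez.
  have z0 : z != 0 by apply: contraNneq ic => z0; rewrite -oppr_eq0 -ez z0 mulr0.
  apply: (mulIf z0); rewrite mulVf // mulrAC ez rmorphN fmorphV mulrNN mulfV //.
by rewrite (inv x ex) (inv y ey); apply: graphM => //; apply: graph_iota.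
Qed.

Definition poly_graph p p' := forall i, R (p`_i, p'`_i).

Lemma poly_graphB p p' q q' : poly_graph p p' -> poly_graph q q' -> poly_graph (p - q) (p' - q').
Proof. by move=> H H' i; rewrite !coefB; apply: graphB. Qed.

Lemma poly_graphM p p' q q' : poly_graph p p' -> poly_graph q q' -> poly_graph (p * q) (p' * q').
Proof.
by move=> H H' i; rewrite !coefM; apply: graph_sum => l; apply: (graphM RP).
Qed.

Lemma poly_graphZ c c' p p' : R (c, c') -> poly_graph p p' -> poly_graph (c *: p) (c' *: p').
Proof. by move=> Hc H i; rewrite !coefZ; apply: (graphM RP). Qed.

Lemma poly_graphC c c' : R (c, c') -> poly_graph c%:P c'%:P.
Proof. by move=> H [|i]; rewrite !coefC //=; apply: graph0. Qed.

Lemma poly_graphXn n : poly_graph 'X^n 'X^n.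
Proof. by move=> i; rewrite !coefXn; case: eqP => _; [apply: graph1|apply: graph0]. Qed.

Lemma poly_graph_iota (q : {poly K}) : poly_graph (map_poly iota q) (map_poly iota q).
Proof. by move=> i; rewrite !coef_map; apply: (graph_iota RP). Qed.

Variable z : Kbar.

(** The least such n is the size of the minimal polynomial p of z over the domain of the embedding;
    p' is its image. *)
Let min_pred n := `[< exists p p', [/\ poly_graph p p', p \is monic, root p z & size p = n] >].

Let min_ex : exists n, min_pred n.
Proof.
have [q q0 qz] := Kbar_alg z.
exists (size q); apply/asboolP.
exists (map_poly iota ((lead_coef q)^-1 *: q)), (map_poly iota ((lead_coef q)^-1 *: q)).
have lq : (lead_coef q)^-1 != 0 by rewrite invr_eq0 lead_coef_eq0.
split; first exact: poly_graph_iota.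
- by rewrite map_monic monicE lead_coefZ mulVf ?lead_coef_eq0.
- by rewrite map_polyZ rootZ ?fmorph_eq0.
by rewrite size_map_poly size_scale.
Qed.

(** The embedding is extended by sending z to a root z' of p', which is not constant since p is
    monic of positive degree. The new graph consists of the pairs (u(z), u'(z')). *)
Lemma graph_extend : exists R', [/\ embedding_graph R', R `<=` R' & exists z', R' (z, z')].
Proof.
case: (ex_minnP min_ex) => m /asboolP[p [p' [pp' p_mon pz szp]]] p_min.
have p'1 : p'`_m.-1 = 1.
  apply: (@graph_inj 1); last exact: graph1.
  by have := pp' m.-1; rewrite -szp -lead_coefE (monicP p_mon).
have m_gt1 : (1 < m)%N.
  rewrite -szp ltn_neqAle size_poly_gt0 monic_neq0 // andbT.
  apply/eqP => /esym sz1; have /size1_polyC pC : (size p <= 1)%N by rewrite sz1.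
  by move: pz p_mon; rewrite pC rootC monicE lead_coefC => /eqP ->; rewrite eq_sym oner_eq0.
have [z' p'z'] : exists z', root p' z'.
  apply/closed_rootP; rewrite neq_ltn; apply/orP; right.
  rewrite ltnNge; apply/negP => /leq_sizeP/(_ m.-1); rewrite p'1.
  move=> p'0; have /eqP : 1 = 0 :> Kbar by apply: p'0; lia.
  by rewrite oner_eq0.
(* Well-definedness, by division by p one leading term at a time, with u' following u. A nonzero u
   smaller than p contradicts minimality once made monic. *)
have vanish u u' : poly_graph u u' -> u.[z] = 0 -> u'.[z'] = 0.
  have [n] := ubnP (size u); elim: n u u' => // n IH u u'; rewrite ltnS => le_n uu' uz.
  have [u0|u0] := eqVneq u 0.
    suff -> : u' = 0 by rewrite horner0.
    by apply/polyP => i; rewrite coef0; apply: (graph_fun RP); have := uu' i; rewrite u0 coef0.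
  pose c := lead_coef u; pose c' := u'`_(size u).-1.
  have cc' : R (c, c') by apply: uu'.
  have c0 : c != 0 by rewrite lead_coef_eq0.
  have [lt_um|le_mu] := ltnP (size u) m.
    have /p_min : min_pred (size u); last by rewrite leqNgt lt_um.
    apply/asboolP; exists (c^-1 *: u), (c'^-1 *: u'); split.
    - by apply: poly_graphZ => //; apply: graphV.
    - by rewrite monicE lead_coefZ mulVf.
    - by rewrite rootZ ?invr_eq0 //; apply/rootP.
    by rewrite size_scale ?invr_eq0.
  pose w := (c *: 'X^(size u - m)) * p; pose w' := (c' *: 'X^(size u - m)) * p'.
  have ww' : poly_graph w w'.
    by apply: poly_graphM => //; apply: poly_graphZ => //; apply: poly_graphXn.
  have sz_uw : (size (u - w)%R < size u)%N.
    have u_gt0 : (0 < size u)%N by rewrite size_poly_gt0.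
    rewrite -(prednK u_gt0) ltnS; apply/leq_sizeP => i le_i.
    rewrite coefB /w -scalerAl coefZ coefXnM.
    have -> : (i < size u - m)%N = false by apply/negbTE; lia.
    have [->|ne_i] := eqVneq i (size u).-1.
      have -> : ((size u).-1 - (size u - m) = (size p).-1)%N by lia.
      by rewrite -!lead_coefE (monicP p_mon) mulr1 subrr.
    have lt_i : (size u <= i)%N by move/eqP: ne_i => ne_i; lia.
    rewrite [u`_i]nth_default // [p`__]nth_default ?mulr0 ?subrr // szp; lia.
  have := IH _ _ (leq_trans sz_uw le_n) (poly_graphB uu' ww').
  rewrite !hornerD !hornerN /w /w' !hornerM uz (rootP pz) (rootP p'z').
  by rewrite !mulr0 !subr0; apply.
exists (fun x => exists u u', poly_graph u u' /\ x = (u.[z], u'.[z'])); split.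
- split.
  + by move=> a; exists (iota a)%:P, (iota a)%:P; rewrite !hornerC; split=> //;
      apply/poly_graphC/(graph_iota RP).
  + move=> x y x' y' [u [u' [uu' [-> ->]]]] [v [v' [vv' [-> ->]]]].
    by exists (u - v), (u' - v'); rewrite !hornerD !hornerN; split=> //; apply: poly_graphB.
  + move=> x y x' y' [u [u' [uu' [-> ->]]]] [v [v' [vv' [-> ->]]]].
    by exists (u * v), (u' * v'); rewrite !hornerM; split=> //; apply: poly_graphM.
  by move=> y [u [u' [uu' [/esym uz ->]]]]; apply: vanish uz.
- move=> [x y] H; exists x%:P, y%:P; rewrite !hornerC; split=> //; exact: poly_graphC.
by exists z', 'X, 'X; rewrite !hornerX; split=> //; rewrite -['X]expr1; apply: poly_graphXn.
Qed.

End GraphTheory.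

(** Zorn's lemma applies to the graphs that contain all pairs (j1 l, j2 l). A maximal one is total
    by [graph_extend], and is the graph of a field endomorphism. *)
Lemma embedding_extend (L : fieldType) (j1 j2 : {rmorphism L -> Kbar}) :
  (forall a : K, exists l : L, j1 l = iota a /\ j2 l = iota a) ->
  exists s : abs_gal iota, forall l, s (j1 l) = j2 l.
Proof.
move=> jK.
pose R0 : set (Kbar * Kbar) := fun x => exists l, x = (j1 l, j2 l).
have R0P : embedding_graph R0.
  split.
  - by move=> a; have [l [e1 e2]] := jK a; exists l; rewrite e1 e2.
  - by move=> x y x' y' [l [-> ->]] [l' [-> ->]]; exists (l - l'); rewrite !rmorphB.
  - by move=> x y x' y' [l [-> ->]] [l' [-> ->]]; exists (l * l'); rewrite !rmorphM.
  by move=> y [l [/esym/eqP + ->]]; rewrite fmorph_eq0 => /eqP ->; rewrite rmorph0.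
pose P : set (set (Kbar * Kbar)) := fun R => R = set0 \/ (R0 `<=` R /\ embedding_graph R).
have [|A [PA Amax]] := @Zorn_bigcup _ P.
  move=> C CP Ctot.
  have [[R1 [CR1 [x1 R1x1]]]|none] := pselect (exists R1, C R1 /\ R1 !=set0); last first.
    left; rewrite -subset0 => x [R CR Rx]; apply: none; exists R; split=> //; by exists x.
  have memP R x : C R -> R x -> R0 `<=` R /\ embedding_graph R.
    by move=> CR Rx; case: (CP R CR) => // R_0; move: Rx; rewrite R_0.
  have [R1sub R1P] := memP R1 x1 CR1 R1x1.
  have common x y : (\bigcup_(R in C) R) x -> (\bigcup_(R in C) R) y ->
      exists R, [/\ C R, R x, R y & embedding_graph R].
    move=> [R CR Rx] [R' CR' R'y].
    have [RR'|R'R] := Ctot _ _ CR CR'.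
      by exists R'; split=> //; [apply: RR'|case: (memP _ _ CR' R'y)].
    by exists R; split=> //; [apply: R'R|case: (memP _ _ CR Rx)].
  right; split; first by move=> x R0x; exists R1 => //; apply: R1sub.
  split.
  - by move=> a; exists R1 => //; apply: (graph_iota R1P).
  - move=> x y x' y' H H'; have [R [CR Rx Ry RP]] := common _ _ H H'.
    by exists R => //; apply: (graphB RP).
  - move=> x y x' y' H H'; have [R [CR Rx Ry RP]] := common _ _ H H'.
    by exists R => //; apply: (graphM RP).
  by move=> y [R CR Ry]; have [_ RP] := memP _ _ CR Ry; apply: (graph_fun RP).
have [R0A AP] : R0 `<=` A /\ embedding_graph A.
  case: PA => // A0; exfalso; apply: (Amax R0); last by right; split.
  rewrite A0; split; first by move=> ? [].
  by move=> /(_ (1, 1)); apply; exists 1; rewrite !rmorph1.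
have Atot z : exists z', A (z, z').
  have [R' [R'P AR' [z' R'z]]] := graph_extend AP z.
  exists z'; apply: contrapT => nA; apply: (Amax R').
    by split=> // /(_ _ R'z).
  by right; split=> //; apply: subset_trans AR'.
pose s z := projT1 (cid (Atot z)).
have sP z : A (z, s z) := projT2 (cid (Atot z)).
have sE z z' : A (z, z') -> s z = z' by move=> H; apply: (graph_inj AP (sP z) H).
have s_zmod : zmod_morphism s by move=> x y; apply/sE/(graphB AP).
have s_monoid : monoid_morphism s.
  by split=> [|x y]; [apply/sE/(graph1 AP)|apply/sE/(graphM AP)].
pose sZ := GRing.isZmodMorphism.Build Kbar Kbar s s_zmod.
pose sM := GRing.isMonoidMorphism.Build Kbar Kbar s s_monoid.
pose sR : {rmorphism Kbar -> Kbar} := HB.pack s sZ sM.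
have s_iota a : s (iota a) = iota a by apply/sE/(graph_iota AP).
(* For q over K vanishing at z, [s] maps the finite set of roots of q injectively into itself, hence
   onto it. *)
have s_surj z : exists x, s x = z.
  have [q q0 qz] := Kbar_alg z.
  have [r rE] := closed_field_poly_normal (map_poly iota q).
  have memr x : (x \in undup r) = root (map_poly iota q) x.
    by rewrite mem_undup rE rootZ ?lead_coef_eq0 ?map_poly_eq0 // root_prod_XsubC.
  have s_root x : root (map_poly iota q) x -> root (map_poly iota q) (s x).
    move=> rx; have -> : map_poly iota q = map_poly sR (map_poly iota q).
      by rewrite -map_poly_comp; apply: eq_map_poly => a /=; rewrite s_iota.
    by rewrite (mapf_root sR).
  have s_inj : injective s := fmorph_inj sR.
  have [|||_ eqr] := @uniq_min_size _ (map s (undup r)) (undup r).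
  - by rewrite (map_inj_uniq s_inj) undup_uniq.
  - by move=> _ /mapP[x xr ->]; rewrite memr s_root // -memr.
  - by rewrite size_map.
  have : z \in undup r by rewrite memr.
  by rewrite -eqr => /mapP[x _ ->]; exists x.
pose t z := projT1 (cid (s_surj z)).
have tK : cancel t s by move=> z; apply: (projT2 (cid (s_surj z))).
have sK : cancel s t by move=> z; apply: (fmorph_inj sR); apply: tK.
pose tZ := GRing.isZmodMorphism.Build Kbar Kbar t (can2_zmod_morphism (f := sR) sK tK).
pose tM := GRing.isMonoidMorphism.Build Kbar Kbar t (can2_monoid_morphism (f := sR) sK tK).
pose tR : {rmorphism Kbar -> Kbar} := HB.pack t tZ tM.
exists (@AbsGal _ _ iota sR tR sK tK s_iota) => l /=.
by apply/sE/R0A; exists l.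
Qed.

End AutomorphismExtension.

(** * Cohomology of permutation modules modulo constants *)

Section ZmodMorphism.

Variables (U V : zmodType) (f : U -> V).
Hypothesis fB : zmod_morphism f.

Let F : {additive U -> V} := HB.pack f (GRing.isZmodMorphism.Build U V f fB).

Lemma zmorph0 : f 0 = 0. Proof. exact: (raddf0 F). Qed.
Lemma zmorphD x y : f (x + y) = f x + f y. Proof. exact: (raddfD F). Qed.
Lemma zmorphMz x n : f (x *~ n) = f x *~ n. Proof. exact: (raddfMz F). Qed.
Lemma zmorph_sum I r (P : pred I) E :
  f (\sum_(i <- r | P i) E i) = \sum_(i <- r | P i) f (E i).
Proof. exact: (raddf_sum F). Qed.

End ZmodMorphism.

Section Faces.

Variable gT : finGroupType.

Local Notation cons h g := (cons_tuple h g).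

Lemma face0_cons n h (g : n.-tuple gT) : face 0 (cons h g) = g.
Proof. by apply: eq_from_tnth => l; rewrite tnth_mktuple (tnth_nth 1%g). Qed.

Lemma face1_cons n h h' (g : n.-tuple gT) :
  face 1 (cons h (cons h' g)) = cons (h * h')%g g.
Proof.
apply: eq_from_tnth => l; rewrite tnth_mktuple (tnth_nth 1%g) /=.
by case: l => -[|l] /=.
Qed.

Lemma faceS_cons n i h (g : n.+1.-tuple gT) :
  face i.+2 (cons h g) = cons h (face i.+1 g).
Proof.
apply: eq_from_tnth => l; rewrite tnth_mktuple (tnth_nth 1%g) /=.
case: l => -[|l] lt_l //=.
rewrite !ltnS eqSS; have lt_l' : (l < n)%N by [].
by have := tnth_mktuple (fun l : 'I_n => if (l.+1 < i.+1)%N then nth 1%g g l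
  else if l.+1 == i.+1 then (nth 1%g g l * nth 1%g g l.+1)%g else nth 1%g g l.+1) (Ordinal lt_l');
   rewrite (tnth_nth 1%g) /= => ->.
Qed.

Lemma face1_1 (g : 1.-tuple gT) : face 1 g = [tuple].
Proof. exact: tuple0. Qed.

Lemma tuple_consE n (g : n.+1.-tuple gT) : g = cons (thead g) (behead_tuple g).
Proof. by apply: val_inj; rewrite {1}(tuple_eta g). Qed.

(** Inner faces preserve this product and the last face loses its last factor. This is the twist
    required in the homotopy on cochains. *)
Definition tprod n (g : n.-tuple gT) : gT := (\prod_(x <- g) x)%g.

Lemma tprod_cons n h (g : n.-tuple gT) : tprod (cons h g) = (h * tprod g)%g.
Proof. by rewrite /tprod big_cons. Qed.

Lemma tprod_face n i (g : n.+1.-tuple gT) : (i < n)%N -> tprod (face i.+1 g) = tprod g.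
Proof.
elim: n i g => // n IH i g; rewrite (tuple_consE g); move: (thead g) (behead_tuple g) => h g'.
case: i => [_|i lt_i]; last by rewrite faceS_cons !tprod_cons IH.
rewrite (tuple_consE g'); move: (thead g') (behead_tuple g') => h' g''.
by rewrite face1_cons !tprod_cons mulgA.
Qed.

Lemma tprod_face_last n (g : n.+1.-tuple gT) :
  (tprod (face n.+1 g) * last 1 g)%g = tprod g.
Proof.
elim: n g => [|n IH] g; rewrite (tuple_consE g); move: (thead g) (behead_tuple g) => h g'.
  by rewrite face1_1 (tuple0 g') tprod_cons /tprod big_nil /= mul1g mulg1.
rewrite faceS_cons !tprod_cons -mulgA -(IH g'); congr (_ * (_ * _))%g.
by rewrite (tuple_consE g').
Qed.

Lemma big_cons_tuple (M : zmodType) n (E : n.+1.-tuple gT -> M) :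
  \sum_g E g = \sum_h \sum_(g : n.-tuple gT) E (cons h g).
Proof.
rewrite pair_big /= (reindex (fun x : gT * n.-tuple gT => cons x.1 x.2)) //=.
exists (fun g => (thead g, behead_tuple g)) => [[h g] _|g _] /=; last by rewrite -tuple_consE.
by congr (_, _); apply: val_inj.
Qed.

End Faces.

(** * The contraction of the standard complexes attached to [rho] *)

Section Contraction.

Variables (gT : finGroupType) (M : zmodType) (act : gT -> M -> M).
Hypothesis actB : forall g, zmod_morphism (act g).
Hypothesis actM : forall g h m, act (g * h)%g m = act h (act g m).
Hypothesis act1 : forall m, act 1%g m = m.

Local Notation chain n := {ffun n.-tuple gT -> M}.
Local Notation cons h g := (cons_tuple h g).

Lemma coboundE n (c : chain n) (g : n.+1.-tuple gT) :
  cobound act c g = c (face 0 g) + \sum_(l < n.+1)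
    (if l.+1 == n.+1 then act (last 1%g g) (c (face l.+1 g))
     else c (face l.+1 g)) *~ (-1) ^+ l.+1.
Proof.
by rewrite ffunE big_ord_recl expr0 mulr1z.
Qed.

Lemma cobound0E (c : chain 0) g :
  cobound act c [tuple g] = c [tuple] - act g (c [tuple]).
Proof. by rewrite coboundE big_ord1 expr1 mulrN1z ![face _ _]tuple0. Qed.

Lemma cobound1E (c : chain 1) g h :
  cobound act c [tuple g; h] = c [tuple h] - c [tuple (g * h)%g] + act h (c [tuple g]).
Proof.
have face0E : face 0 [tuple g; h] = [tuple h] by apply: face0_cons.
have face1E : face 1 [tuple g; h] = [tuple (g * h)%g] by apply: face1_cons.
have face2E : face 2 [tuple g; h] = [tuple g].
  by apply: etrans (faceS_cons 0 g [tuple h]) _; rewrite face1_1.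
have -> : cobound act c [tuple g; h] = c (face 0 [tuple g; h]) +
    (c (face 1 [tuple g; h]) *~ (-1) ^+ 1 + act h (c (face 2 [tuple g; h])) *~ (-1) ^+ 2).
  by have := coboundE c [tuple g; h]; rewrite big_ord_recl big_ord1.
by rewrite face0E face1E face2E expr1 mulrN1z sqrrN expr1n mulr1z addrA.
Qed.

Lemma boundE n (c : chain n.+1) (t : n.-tuple gT) :
  bound act c t = \sum_(g | face 0 g == t) act (thead g) (c g) +
    \sum_(l < n.+1) (\sum_(g | face l.+1 g == t) c g) *~ (-1) ^+ l.+1.
Proof.
rewrite ffunE; under eq_bigr do rewrite big_mkcond.
rewrite exchange_big big_ord_recl.
congr (_ + _).
  by rewrite [RHS]big_mkcond; apply: eq_bigr => g _; rewrite expr0 mulr1z.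
apply: eq_bigr => l _; rewrite mulrz_suml [RHS]big_mkcond.
by apply: eq_bigr => g _.
Qed.

Variable rho : M -> M.
Hypothesis rhoB : zmod_morphism rho.
Hypothesis rho_sum : forall m, \sum_g act g (rho (act g^-1%g m)) = m.

Let R g m := act g (rho (act g^-1%g m)).

Let RB g : zmod_morphism (R g).
Proof. by move=> x y; rewrite /R actB rhoB actB. Qed.

Let R_act g h m : R (g * h)%g (act h m) = act h (R g m).
Proof. by rewrite /R actM invMg [act (h^-1 * _)%g _]actM -[act h^-1%g _]actM mulgV act1. Qed.

(** The cocycle condition at (h, g) writes b(g) as a combination of values of b at tuples beginning
    with h or h g_1. Applying R at h g_1 ... g_n and summing over h gives b(g) back on one side and
    the coboundary of the witness on the other. *)
Lemma exact_cobound n : exact_at (@cobound _ _ act n) (@cobound _ _ act n.+1).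
Proof.
move=> b b0.
exists [ffun g : n.-tuple gT => \sum_h R (h * tprod g)%g (b (cons h g))].
apply/ffunP => g; rewrite coboundE.
have bE h : b g = b (face 1 (cons h g)) + \sum_(l < n.+1)
    (if l.+1 == n.+1 then act (last 1%g g) (b (cons h (face l.+1 g)))
     else b (cons h (face l.+1 g))) *~ (-1) ^+ l.+1.
  have := coboundE b (cons h g); rewrite b0 ffunE big_ord_recl face0_cons => /esym E.
  have {E}: b g + (b (face 1 (cons h g)) *~ (-1) ^+ 1 + \sum_(l < n.+1)
      (if l.+2 == n.+2 then act (last 1%g (cons h g)) (b (face l.+2 (cons h g)))
       else b (face l.+2 (cons h g))) *~ (-1) ^+ l.+2) = 0 := E.
  rewrite expr1 mulrN1z addrA => /eqP; rewrite addr_eq0 subr_eq addrC => /eqP ->.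
  congr (_ + _); rewrite -sumrN; apply: eq_bigr => l _; rewrite faceS_cons eqSS.
  rewrite [in LHS]exprS mulN1r mulrNz opprK.
  by rewrite (tuple_consE g) /=.
have -> : b g = \sum_h R (h * tprod g)%g (b g).
  rewrite (reindex_inj (mulIg (tprod g)^-1%g)) /=.
  by under eq_bigr do rewrite mulgKV; rewrite rho_sum.
under [RHS]eq_bigr => h _ do rewrite {1}(bE h) (zmorphD (RB _)) (zmorph_sum (RB _)).
rewrite big_split exchange_big /=; congr (_ + _).
  rewrite ffunE (tuple_consE g); move: (thead g) (behead_tuple g) => h' g'.
  rewrite face0_cons [RHS](reindex_inj (mulIg h'^-1%g)) /=; apply: eq_bigr => h _.
  by rewrite face1_cons tprod_cons mulgKV mulgA mulgKV.
apply: eq_bigr => l _; rewrite ffunE.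
under [RHS]eq_bigr do rewrite (zmorphMz (RB _)).
rewrite -mulrz_suml; congr (_ *~ _).
case: eqP => [E|/eqP neq]; last first.
  by apply: eq_bigr => h _; rewrite tprod_face //; have := ltn_ord l; lia.
(* For the last face, [R_act] restores in the index of R the factor that the face has removed. *)
rewrite (zmorph_sum (actB _)); apply: eq_bigr => h _.
by rewrite -R_act -mulgA; move: E => [->]; rewrite tprod_face_last.
Qed.

(** A homotopy on chains: the entry h added in front carries rho (h^-1 b), so that the face removing
    h sums these to b. *)
Let contract n (b : chain n) : chain n.+1 :=
  [ffun g => rho (act (thead g)^-1%g (b (behead_tuple g)))].

Let rho_actB g : zmod_morphism (fun m => rho (act g m)).
Proof. by move=> x y; rewrite actB rhoB. Qed.

Lemma sum_face0 n (E : n.+1.-tuple gT -> M) t :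
  \sum_(g | face 0 g == t) E g = \sum_h E (cons h t).
Proof.
rewrite big_mkcond big_cons_tuple; apply: eq_bigr => h _.
by under eq_bigr do rewrite face0_cons; rewrite -big_mkcond big_pred1_eq.
Qed.

Lemma bound_contract0 n (b : chain n) t :
  \sum_(g | face 0 g == t) act (thead g) (contract b g) = b t.
Proof.
rewrite sum_face0 -[RHS]rho_sum; apply: eq_bigr => h _.
by rewrite ffunE theadE; congr (act _ (rho (act _ (b _)))); apply: val_inj.
Qed.

Lemma eq_cons_tuple n h h' (g g' : n.-tuple gT) :
  (cons h g == cons h' g') = (h == h') && (g == g').
Proof. by rewrite -!val_eqE /= eqseq_cons. Qed.

Let contract_cons n (b : chain n) h g : contract b (cons h g) = rho (act h^-1%g (b g)).
Proof. by rewrite ffunE theadE; congr (rho (act _ (b _))); apply: val_inj. Qed.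

Lemma contract_face1 n (b : chain n.+1) h (t : n.-tuple gT) :
  \sum_(g | face 1 g == cons h t) contract b g =
  \sum_(g | face 0 g == t) rho (act h^-1%g (act (thead g) (b g))).
Proof.
rewrite big_mkcond [RHS]big_mkcond big_cons_tuple exchange_big; apply: eq_bigr => g _ /=.
have -> : face 0 g = behead_tuple g by rewrite {1}(tuple_consE g) face0_cons.
have f1 x : face 1 (cons x g) = cons (x * thead g)%g (behead_tuple g).
  by rewrite {1}(tuple_consE g) face1_cons.
under eq_bigr do rewrite f1 eq_cons_tuple contract_cons.
case: eqP => _ /=; last by rewrite big1 // => y _; rewrite andbF.
rewrite (bigD1 (h * (thead g)^-1)%g) //= mulgKV eqxx big1 ?addr0 => [|y ne_y].
  by rewrite invMg invgK actM.
by rewrite andbT; case: eqP => // E; case/eqP: ne_y; rewrite -E mulgK.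
Qed.

Lemma contract_faceS n i (b : chain n.+1) h (t : n.-tuple gT) :
  \sum_(g | face i.+2 g == cons h t) contract b g =
  \sum_(g | face i.+1 g == t) rho (act h^-1%g (b g)).
Proof.
rewrite big_mkcond [RHS]big_mkcond big_cons_tuple exchange_big; apply: eq_bigr => g _ /=.
under eq_bigr do rewrite faceS_cons eq_cons_tuple contract_cons.
rewrite (bigD1 h) //= eqxx big1 ?addr0 => // y /negPf ne_y.
by rewrite ne_y.
Qed.

(** The homotopy identity. Face 0 of the contraction returns b; its face i + 1 cancels face i of b,
    contracted, which appears with the opposite sign. *)
Lemma bound_contract n (b : chain n.+1) :
  bound act (contract b) + contract (bound act b) = b.
Proof.
apply/ffunP => t; rewrite ffunE.
have -> : bound act (contract b) t = b t + ((\sum_(g | face 1 g == t) contract b g) *~ (-1) ^+ 1 +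
    \sum_(l < n.+1) (\sum_(g | face l.+2 g == t) contract b g) *~ (-1) ^+ l.+2).
  by rewrite boundE bound_contract0 big_ord_recl.
rewrite (tuple_consE t); move: (thead t) (behead_tuple t) => h t'.
rewrite contract_cons boundE (zmorphD (rho_actB _)) !(zmorph_sum (rho_actB _)).
rewrite contract_face1 expr1 mulrN1z -addrA -[RHS]addr0; congr (_ + _).
rewrite addrACA addNr add0r -big_split big1 //= => l _.
rewrite contract_faceS (zmorphMz (rho_actB _)) (zmorph_sum (rho_actB _)).
by rewrite exprS mulN1r mulrNz addNr.
Qed.

Lemma exact_bound n : exact_at (@bound _ _ act n.+1) (@bound _ _ act n).
Proof.
move=> b b0; exists (contract b); rewrite -[RHS]bound_contract b0.
suff -> : contract 0 = 0 by rewrite addr0.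
by move=> n'; apply/ffunP => g; rewrite !ffunE (zmorph0 (rho_actB _)).
Qed.

Lemma tate_vanish_relatively_projective i : tate_vanish act i.
Proof.
case: i => -[|n] /=; [|exact: exact_cobound| |exact: exact_bound].
(* Degree 0: an invariant element m is the norm of rho m. *)
- move=> b b0; exists [ffun t => rho (b t)]; apply/ffunP => t; rewrite !ffunE.
  rewrite -[RHS]rho_sum; apply: eq_bigr => g _; congr (act g (rho _)).
  have := congr1 (fun c : chain 1 => c [tuple g^-1%g]) b0.
  by rewrite cobound0E ffunE (tuple0 t) => /eqP; rewrite subr_eq0 => /eqP.
(* Degree -1: the boundary of the contraction is b minus rho of the norm of b, which vanishes. *)
move=> b b0; exists (contract b); apply/ffunP => t.
rewrite boundE bound_contract0 big_ord1 expr1 mulrN1z -[RHS]subr0; congr (_ - _).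
rewrite (eq_bigl xpredT) => [|g]; last by rewrite [face _ _]tuple0 (tuple0 t) eqxx.
have := congr1 (fun c : chain 0 => rho (c t)) b0.
rewrite !ffunE (zmorph_sum rhoB) (zmorph0 rhoB) => {2}<-.
rewrite big_cons_tuple (reindex_inj invg_inj); apply: eq_bigr => h _.
rewrite (bigD1 [tuple]) //= big1 ?addr0 => [|g]; last by rewrite tuple0.
by rewrite contract_cons invgK (tuple0 t).
Qed.

End Contraction.

Section IndexTwo.

Variables (gT : finGroupType) (S N : {group gT}).
Hypotheses (sNS : N \subset S) (iNS : #|S : N|%g = 2%N).

(** Lying outside N is the character of order 2 of S with kernel N: if g is outside N, then S is the
    union of N and g^-1 N. *)
Lemma index2_memM g h : g \in S -> h \in S ->
  ((g * h)%g \notin N) = (g \notin N) (+) (h \notin N).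
Proof.
move=> gS hS; have [gN|gN] := boolP (g \in N); first by rewrite groupMl.
have [hN|hN] := boolP (h \in N); first by rewrite groupMr.
suff : (g * h)%g \in N by move=> ->.
have dis : [disjoint N & (g^-1 *: N)%g].
  rewrite disjoint_subset; apply/subsetP => x xN; rewrite inE mem_lcoset invgK.
  by rewrite groupMr.
have /eqP SE : N :|: (g^-1 *: N)%g == S.
  rewrite eqEcard subUset sNS /= cardsU disjoint_setI0 // cards0 subn0 card_lcoset.
  rewrite -(Lagrange sNS) iNS muln2 addnn leqnn andbT.
  by apply/subsetP => x /lcosetP[y yN ->]; rewrite groupM ?groupV // (subsetP sNS).
by move: hS; rewrite -{1}SE inE (negPf hN) /= mem_lcoset invgK.
Qed.

End IndexTwo.

(** * Permutation modules over F_2 modulo the constants *)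

Section PermutationModule.

Variables (gT : finGroupType) (I : finType) (to : {action gT &-> I}).
Variables (M : zmodType) (act : gT -> M -> M) (e : I -> M).
Hypothesis actB : forall g, zmod_morphism (act g).
Hypothesis act_e : forall g i, act g (e i) = e (to i g).
Hypothesis e2 : forall i, e i *+ 2 = 0.

Implicit Types c : {ffun I -> bool}.

Definition indic_sum c : M := \sum_i e i *+ c i.

Hypothesis e_gen : forall m, exists c, m = indic_sum c.
Hypothesis e_rel : forall c, (indic_sum c == 0) = [forall i, forall l, c i == c l].

Local Notation es := indic_sum.

Lemma indic_sumD c c' : es c + es c' = es [ffun i => c i (+) c' i].
Proof.
rewrite /es -big_split; apply: eq_bigr => i _; rewrite ffunE.
by case: (c i) (c' i) => [] []; rewrite /= ?mulr0n ?mulr1n ?addr0 ?add0r // -mulr2n e2.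
Qed.

Lemma perm_module2 (m : M) : m + m = 0.
Proof.
have [c ->] := e_gen m; rewrite indic_sumD /es big1 // => i _.
by rewrite ffunE addbb.
Qed.

Lemma perm_moduleN (m : M) : - m = m.
Proof. by apply/eqP; rewrite -subr_eq0 -opprD perm_module2 oppr0. Qed.

Lemma act_indic g c : act g (es c) = es [ffun i => c (to i g^-1%g)].
Proof.
rewrite /es (zmorph_sum (actB g)) [RHS](reindex_inj (act_inj to g)) /=.
apply: eq_bigr => i _; rewrite ffunE actK.
by case: (c i); rewrite ?mulr1n ?mulr0n ?act_e // (zmorph0 (actB g)).
Qed.

Lemma act_mul g h m : act (g * h)%g m = act h (act g m).
Proof.
have [c ->] := e_gen m; rewrite !act_indic; congr es; apply/ffunP => i.
by rewrite !ffunE invMg actM.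
Qed.

Lemma act_one m : act 1%g m = m.
Proof.
have [c ->] := e_gen m; rewrite act_indic; congr es; apply/ffunP => i.
by rewrite ffunE invg1 act1.
Qed.

Lemma indic_inj i c c' : c i = c' i -> es c = es c' -> c = c'.
Proof.
move=> ci E; have : es [ffun i => c i (+) c' i] == 0.
  by rewrite -indic_sumD E perm_module2.
rewrite e_rel => /forallP/(_ i)/forallP H; apply/ffunP => l.
by have := H l; rewrite !ffunE ci addbb; case: (c l) (c' l) => [] [].
Qed.

(** A set and its complement define the same element, and one of the two omits i. *)
Lemma indic_normal i (m : M) : exists2 c, m = es c & c i = false.
Proof.
have [c ->] := e_gen m; case ci : (c i); last by exists c.
exists [ffun l => ~~ c l]; last by rewrite ffunE ci.
apply/eqP; rewrite -subr_eq0 perm_moduleN indic_sumD e_rel.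
by apply/forallP => l; apply/forallP => l'; rewrite !ffunE !addbN !addbb.
Qed.

Lemma perm_module_odd (m : M) n : odd n -> m *+ n = m.
Proof.
move=> on; rewrite -(odd_double_half n) on mulrnDr mulr1n -mul2n mulrnA.
by rewrite mulr2n perm_module2 mul0rn addr0.
Qed.

Section FixedPoint.

Variables (G : {group gT}) (i0 : I).
Hypothesis fix0 : forall g, g \in G -> to i0 g = i0.

Definition free_off_fixed := forall i g, i != i0 -> g \in G -> to i g = i -> g = 1%g.

(** The coordinates with respect to the F_2-basis formed by the e_l with l different from i0; G
    permutes this basis because it fixes i0. *)
Let coord m := s2val (cid2 (indic_normal i0 m)).

Let coordP m : m = es (coord m).
Proof. exact: (s2valP (cid2 (indic_normal i0 m))). Qed.

Let coord0 m : coord m i0 = false.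
Proof. exact: (s2valP' (cid2 (indic_normal i0 m))). Qed.

Let coord_uniq c : c i0 = false -> coord (es c) = c.
Proof. by move=> c0; apply: (indic_inj (i := i0)); rewrite ?coord0 -?coordP. Qed.

Let coordD (m m' : M) i : coord (m - m') i = coord m i (+) coord m' i.
Proof.
rewrite perm_moduleN {1}(coordP m) {1}(coordP m') indic_sumD coord_uniq ffunE //.
by rewrite !coord0.
Qed.

Let coord_act g m i : g \in G -> coord (act g m) i = coord m (to i g^-1%g).
Proof.
move=> gG; rewrite {1}(coordP m) act_indic coord_uniq ffunE //.
by rewrite fix0 ?groupV.
Qed.

Let orep i := odflt i0 [pick l in orbit to G i].

Let orepP i : orep i \in orbit to G i.
Proof. by rewrite /orep; case: pickP => // /(_ i); rewrite orbit_refl. Qed.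

Let proj (T : {set I}) m := es [ffun i => (i \in T) && coord m i].

Let projB T : zmod_morphism (proj T).
Proof.
move=> m m'; rewrite /proj [- es _]perm_moduleN indic_sumD; congr es; apply/ffunP => i.
by rewrite !ffunE coordD; case: (i \in T).
Qed.

(** T contains one point of each orbit off i0. By freeness each i other than i0 lies in exactly one
    translate of T, so the conjugates of the projection onto T add up to the identity. *)
Lemma free_projector : free_off_fixed ->
  exists rho : M -> M, zmod_morphism rho /\
    forall m, \sum_(g in G) act g (rho (act g^-1%g m)) = m.
Proof.
move=> free; pose T := [set i | (i != i0) && (orep i == i)].
exists (proj T); split=> [|m]; first exact: projB.
pose f g := [ffun i => (to i g^-1%g \in T) && coord m i].
have fE g : g \in G -> act g (proj T (act g^-1%g m)) = es (f g).
  move=> gG; rewrite /proj act_indic; congr es; apply/ffunP => i.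
  by rewrite !ffunE coord_act ?groupV // invgK actKV.
rewrite (eq_bigr (fun g => es (f g)) fE) /es exchange_big [RHS]coordP.
apply: eq_bigr => i _; have [i_0|i_0] := eqVneq i i0.
  by rewrite i_0 coord0 big1 // => g _; rewrite ffunE coord0 andbF.
have /orbitP[g0 g0G g0i] := orepP i.
have orep_eq g : g \in G -> orep (to i g) = orep i.
  by move=> gG; rewrite /orep (orbit_eqP (mem_orbit to i gG)).
have toT g : g \in G -> (to i g^-1%g \in T) = (g == g0^-1%g).
  move=> gG; rewrite inE orep_eq ?groupV // -g0i.
  have -> : to i g^-1%g != i0.
    by apply: contraNneq i_0 => E; rewrite -(actKV to g i) E fix0.
  apply/eqP/eqP => [E|->]; last by rewrite invgK.
  apply: (mulgI g0); rewrite mulgV; apply: (free i) => //; first by rewrite groupM.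
  by rewrite actM E actKV.
rewrite (bigD1 g0^-1%g) ?groupV //= ffunE toT ?groupV // eqxx /= big1 ?addr0 // => g /andP[gG ne].
by rewrite ffunE toT // (negPf ne).
Qed.

(** Stated for any commutative monoid law, since it serves both to count roots and to regroup a
    product of linear factors. *)
Lemma free_orbits_big : free_off_fixed -> exists T : {set I},
  [/\ forall i, i \in T -> i != i0, #|I|.-1 = (#|T| * #|G|)%N &
  forall (R : Type) (idx : R) (op : Monoid.com_law idx) (F : I -> R),
    \big[op/idx]_(i | i != i0) F i =
    \big[op/idx]_(i in T) \big[op/idx]_(g in G) F (to i g)].
Proof.
move=> free; pose T := [set i | (i != i0) && (orep i == i)]; exists T.
suff big_T (R : Type) (idx : R) (op : Monoid.com_law idx) (F : I -> R) :
    \big[op/idx]_(i | i != i0) F i = \big[op/idx]_(i in T) \big[op/idx]_(g in G) F (to i g).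
  split=> // [i|]; first by rewrite inE => /andP[].
  rewrite -(cardC1 i0) -[LHS]sum1_card.
  transitivity (\sum_(i : I | i != i0) 1)%N; first exact: eq_bigl.
  by rewrite big_T -sum_nat_const; apply: eq_bigr => i _; apply: sum1_card.
have orep_orbit i x : x \in orbit to G i -> orep x = orep i.
  by move=> xi; rewrite /orep (orbit_eqP xi).
have off_fixed i x : x \in orbit to G i -> (x == i0) = (i == i0).
  move=> /orbitP[g gG <-]; rewrite -{1}(fix0 gG).
  by apply/eqP/eqP => [/act_inj|->].
rewrite (partition_big orep (mem T)) /=; last first.
  by move=> i i_0; rewrite inE (off_fixed i) ?orepP // i_0 (orep_orbit i) ?eqxx // orepP.
apply: eq_bigr => x; rewrite inE => /andP[x_0 /eqP xT].
rewrite -(big_imset _ (h := to x)) /= => [|g h gG hG E].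
  apply: eq_bigl => i; apply/andP/idP => [[i_0 /eqP ix]|ix].
    by rewrite -/(orbit to G x) orbit_sym -ix orepP.
  by rewrite (off_fixed x) // x_0 (orep_orbit x) // xT.
apply/(mulIg h^-1%g); rewrite mulgV; apply: (free x) => //; first by rewrite groupM ?groupV.
by rewrite actM E actK.
Qed.

(* The 1-cocycle produced by Shapiro's lemma from the character chi : 'C_G[i] -> Z/2 with
   kernel N: for x = i.(tr x) in the orbit of i, its coordinate at x is
   g |-> chi (tr (x.g^-1) * g * (tr x)^-1). *)
Lemma H1_vanish_free : (2.-group G)%g -> H1_vanish (res_act act G) -> free_off_fixed.
Proof.
move=> pG H1 i g i_0 gG ig; apply/set1gP/negPn/negP => g1.
pose S := 'C_G[i | to]%G; have sSG : S \subset G by apply: subsetIl.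
have mem_S h : (h \in S) = (h \in G) && (to i h == i).
  by rewrite !inE /= sub1set inE; case: (h \in G).
have ntS : S :!=: 1%g.
  by apply: contraNneq g1 => S1; rewrite -S1 mem_S gG ig eqxx.
have pS : (2.-group S)%g := pgroupS sSG pG.
have [S1|[N maxN _]] := maximal_exists (sub1G S); first by rewrite S1 eqxx in ntS.
have iN := p_maximal_index pS maxN.
have /properP[sNS [h0 h0S h0N]] : N \proper S := maxgroupp maxN.
pose tr x := odflt 1%g [pick h in G | to i h == x].
have trP x : x \in orbit to G i -> tr x \in G /\ to i (tr x) = x.
  rewrite /tr; case: pickP => [h /andP[hG /eqP]//|no /orbitP[h hG hx]].
  by have := no h; rewrite hG hx eqxx.
have orbG h x : h \in G -> (to x h \in orbit to G i) = (x \in orbit to G i).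
  by move=> hG; rewrite -!orbit_eq_mem orbit_act.
pose s h x := (tr (to x h^-1%g) * h * (tr x)^-1)%g.
have sS h x : h \in G -> x \in orbit to G i -> s h x \in S.
  move=> hG xO; have [tG tx] := trP x xO.
  have [tG' tx'] : tr (to x h^-1%g) \in G /\ to i (tr (to x h^-1%g)) = to x h^-1%g.
    by apply: trP; rewrite orbG ?groupV.
  by rewrite mem_S !groupM ?groupV // !actM tx' actKV -{1}tx actK eqxx.
pose f h := [ffun x => (x \in orbit to G i) && (s h x \notin N)].
have fM h h' : h \in G -> h' \in G -> es (f (h * h')%g) = es (f h') + act h' (es (f h)).
  move=> hG h'G; rewrite act_indic indic_sumD; congr es; apply/ffunP => x.
  rewrite !ffunE orbG ?groupV //; case: (boolP (x \in _)) => //= xO.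
  have -> : s (h * h')%g x = (s h (to x h'^-1) * s h' x)%g.
    by rewrite /s invMg actM !mulgA mulgKV.
  by rewrite (index2_memM sNS iN) ?sS ?orbG ?groupV // addbC.
pose b : {ffun 1.-tuple (subg_of G) -> M} := [ffun t => es (f (sgval (thead t)))].
have b0 : cobound (res_act act G) b = 0.
  apply/ffunP => t; rewrite [RHS]ffunE.
  case/tupleP: t => u t; case/tupleP: t => v t; rewrite (tuple0 t).
  have -> := cobound1E (res_act act G) b u v.
  have bE w : b [tuple w] = es (f (sgval w)) by rewrite ffunE.
  have fuv : es (f (sgval (u * v)%g)) = es (f (sgval v)) + act (sgval v) (es (f (sgval u))).
    exact: (fM _ _ (subgP u) (subgP v)).
  rewrite !bE /res_act fuv perm_moduleN addrA perm_module2 add0r perm_module2 //.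
have [a ab] := H1 b b0.
have aE h : h \in G -> a [tuple] - act h (a [tuple]) = es (f h).
  move=> hG; have := congr1 (fun c : {ffun 1.-tuple (subg_of G) -> M} => c [tuple subg G h]) ab.
  by rewrite cobound0E !ffunE theadE /res_act subgK.
have iO : i \in orbit to G i := orbit_refl to G i.
have [tG ti] := trP i iO.
(* h is chosen so that [s h i] is h0, outside N; hence the cocycle at h has coordinate 1 at i. But h
   fixes i, so every a - h a has coordinate 0 there. *)
pose h := (h0 ^ tr i)%g.
have /andP[h0G /eqP h0i] : (h0 \in G) && (to i h0 == i) by rewrite -mem_S.
have hG : h \in G by rewrite groupJ.
have hi : to i h^-1%g = i.
  have tVi : to i (tr i)^-1%g = i by rewrite -{1}ti actK.
  have h0Vi : to i h0^-1%g = i by rewrite -{1}h0i actK.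
  by rewrite /h -conjVg conjgE !actM tVi h0Vi ti.
have fi : f h i = true.
  by rewrite ffunE iO /s hi /h conjgE !mulgA mulgV mul1g mulgK.
(* i0 is not in the orbit of i, so [f h] is already the normalized set of coordinates. *)
have f0 : f h i0 = false.
  rewrite ffunE; case: (boolP (i0 \in _)) => // /orbitP[x xG xi].
  by case/eqP: i_0; apply: (act_inj to x); rewrite xi fix0.
have := congr1 (fun m => coord m i) (aE h hG).
by rewrite coordD coord_act // hi addbb coord_uniq // fi.
Qed.

End FixedPoint.

(** Each right coset of H contributes m, by conjugating the identity for H; the number of cosets is
    odd and 2 kills M. *)
Lemma projector_odd_index (H G : {group gT}) rho : H \subset G -> odd #|G : H|%g ->
  (forall m, \sum_(g in H) act g (rho (act g^-1%g m)) = m) ->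
  forall m, \sum_(g in G) act g (rho (act g^-1%g m)) = m.
Proof.
move=> sHG oddHG rhoH m.
rewrite (partition_big (rcoset H) (mem (rcosets H G))) /=; last first.
  by move=> g gG; rewrite rcosetE mem_rcosets (subsetP (mulG_subr _ _)).
rewrite (eq_bigr (fun _ => m)) => [|_ /rcosetsP[x xG ->]].
  by rewrite sumr_const perm_module_odd.
rewrite (eq_bigl (mem (H :* x)%g)) => [|g] /=; last first.
  rewrite rcosetE; apply/andP/idP => [[_ /eqP/rcoset_eqP]//|gx].
  split; last exact/eqP/rcoset_eqP.
  by move: gx; rewrite mem_rcoset => /(subsetP sHG); rewrite groupMr ?groupV.
rewrite (reindex_inj (mulIg x)) /=.
transitivity (act x (\sum_(h in H) act h (rho (act h^-1%g (act x^-1%g m))))).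
  rewrite (zmorph_sum (actB x)); apply: eq_big => [h|h _].
    by rewrite mem_rcoset mulgK.
  by rewrite act_mul invMg act_mul.
by rewrite rhoH -act_mul mulVg act_one.
Qed.

(** rho' adds up the conjugates of rho by representatives of the left cosets of H, so that summing
    its conjugates over H runs through G once. *)
Lemma projector_subgroup (H G : {group gT}) rho : H \subset G -> zmod_morphism rho ->
  (forall m, \sum_(g in G) act g (rho (act g^-1%g m)) = m) ->
  exists rho' : M -> M, zmod_morphism rho' /\
    forall m, \sum_(g in H) act g (rho' (act g^-1%g m)) = m.
Proof.
move=> sHG rhoB rhoG.
pose rho' m := \sum_(C in lcosets H G) act (fingroup.repr C) (rho (act (fingroup.repr C)^-1%g m)).
exists rho'; split=> [x y|m].
  by rewrite /rho' -sumrB; apply: eq_bigr => C _; rewrite actB rhoB actB.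
rewrite -[RHS]rhoG [RHS](partition_big (lcoset H) (mem (lcosets H G))) /=; last first.
  by move=> g gG; apply: imset_f.
transitivity (\sum_(h in H) \sum_(C in lcosets H G)
    act (fingroup.repr C * h)%g (rho (act (fingroup.repr C * h)^-1%g m))).
  apply: eq_bigr => h hH; rewrite /rho' (zmorph_sum (actB h)).
  by apply: eq_bigr => C _; rewrite act_mul invMg act_mul.
rewrite exchange_big; apply: eq_bigr => C /lcosetsP[x xG ->].
set y := fingroup.repr _; have yx : y \in (x *: H)%g by apply: (mem_repr x); apply: lcoset_refl.
rewrite [RHS](eq_bigl (mem (y *: H)%g)) => [|g] /=; last first.
  rewrite lcosetE (lcoset_eqP yx); apply/andP/idP => [[_ /eqP/lcoset_eqP]//|gx].
  split; last exact/eqP/lcoset_eqP.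
  by move: gx; rewrite mem_lcoset => /(subsetP sHG); rewrite groupMl ?groupV.
rewrite [RHS](reindex_inj (mulgI y)) /=; apply: eq_bigl => h.
by rewrite mem_lcoset mulKg.
Qed.

Lemma projector_tate_vanish (H : {group gT}) rho : zmod_morphism rho ->
  (forall m, \sum_(g in H) act g (rho (act g^-1%g m)) = m) ->
  forall n, tate_vanish (res_act act H) n.
Proof.
move=> rhoB rhoH; apply: (@tate_vanish_relatively_projective _ _ _ _ _ _ rho) => //.
- by move=> g; apply: actB.
- by move=> g h m; rewrite /res_act act_mul.
- by move=> m; apply: act_one.
move=> m; rewrite -[RHS]rhoH.
rewrite [RHS](reindex (@sgval _ H)) /=; last first.
  by exists (subg H) => [u _|g gH]; [apply: sgvalK|apply: subgK].
by apply: eq_big => [u|u _]; rewrite ?subgP // /res_act.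
Qed.

Lemma two_group_fixed_point (P : {group gT}) : (2.-group P)%g -> odd #|I| ->
  exists i0, forall g, g \in P -> to i0 g = i0.
Proof.
move=> pP oddI; have aP : [acts P, on [set: I] | to].
  by apply/subsetP => g _; rewrite !inE; apply/subsetP => i _; rewrite !inE.
have := pgroup_fix_mod pP aP; rewrite cardsT !modn2 oddI.
case: (set_0Vmem 'Fix_([set: I] | to)(P)%g) => [->|[i0]]; first by rewrite cards0.
by rewrite inE => /andP[_ /afixP fix_i0] _; exists i0.
Qed.

Lemma sylow_coh_trivial (G P : {group gT}) (i0 : I) : (2.-Sylow(G) P)%g ->
  (forall g, g \in P -> to i0 g = i0) ->
  [<-> H1_vanish (res_act act P); coh_trivial act P; coh_trivial act G;
       free_off_fixed P i0].
Proof.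
move=> sylP fix0; have sPG := pHall_sub sylP.
have free_coh : free_off_fixed P i0 -> coh_trivial act G.
  move=> free H sHG n; have [rho [rhoB rhoP]] := free_projector fix0 free.
  have rhoG := projector_odd_index sPG _ rhoP.
  have [|rho' [rhoB' rhoH]] := projector_subgroup sHG rhoB (rhoG _).
    by rewrite odd_2'nat; case/and3P: sylP.
  exact: projector_tate_vanish rhoB' rhoH n.
have coh_sub : coh_trivial act G -> coh_trivial act P.
  by move=> cohG H sHP; apply: cohG; apply: subset_trans sPG.
tfae; last by move/free_coh/coh_sub => /(_ P (subxx _) 1).
- by move/(H1_vanish_free fix0 (pHall_pgroup sylP))/free_coh/coh_sub.
- by move=> /(_ P (subxx _) 1)/(H1_vanish_free fix0 (pHall_pgroup sylP))/free_coh.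
by move/coh_sub => /(_ P (subxx _) 1)/(H1_vanish_free fix0 (pHall_pgroup sylP)).
Qed.

End PermutationModule.

(** * J[2] as a Galois module *)

Section TwoTorsionModule.

Variables (K : fieldType) (Kbar : closedFieldType) (iota : {rmorphism K -> Kbar}).
Hypothesis charK0 : [pchar K] =i pred0.
Variable f : {poly K}.
Hypotheses (sep_f : separable_poly f) (odd_f : odd (size f).-1).

Local Notation g := (map_poly iota f).
Local Notation odd_g := (odd_map_iota iota odd_f).
Local Notation J := (jacobian odd_g).
Local Notation J2 := (J2 iota odd_f).

Fact sep_g : separable_poly g.
Proof. by rewrite separable_map. Qed.

Fact two_neq0 : 2%:R != 0 :> Kbar.
Proof. by have /pcharf0P H := charK0; rewrite -(rmorph_nat iota) fmorph_eq0 H. Qed.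

Lemma closure_roots : exists rs : seq Kbar,
  [/\ uniq rs, forall a, root g a = (a \in rs) & size rs = (size g).-1].
Proof.
have [rs gE] := closed_field_poly_normal g.
have lg : lead_coef g != 0 by rewrite lead_coef_eq0 (odd_size_neq0 odd_g).
exists rs; split.
- have := sep_g; rewrite gE -mul_polyC separable_mul => /and3P[_ + _].
  by rewrite separable_prod_XsubC.
- by move=> a; rewrite gE rootZ // root_prod_XsubC.
by rewrite gE size_scale // size_prod_XsubC.
Qed.

Definition root_torsion (a : Kbar) : J2 := insubd (0 : J2) (root_class odd_g sep_g a).

Lemma root_torsion_val a : root g a ->
  torsion_val (root_torsion a) = root_class odd_g sep_g a.
Proof.
move=> ga; rewrite /root_torsion /insubd insubT //.
by rewrite unfold_in; apply/eqP; apply: root_class2.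
Qed.

Lemma J2_actB s : zmod_morphism (@J2_act K Kbar iota f odd_f s).
Proof.
move=> P Q; apply: val_inj => /=.
exact: (raddfB (jacobian_act (abs_gal_curve_aut f s))).
Qed.

Lemma J2_act_root s a : root g a ->
  J2_act s (root_torsion a) = root_torsion (s a).
Proof.
move=> ga; have gsa : root g (s a).
  by rewrite -(root_caut (abs_gal_curve_aut f s)) in ga.
apply: val_inj.
change (jacobian_act (abs_gal_curve_aut f s) (torsion_val (root_torsion a)) =
  torsion_val (root_torsion (s a))).
apply: (etrans (congr1 (jacobian_act _) (root_torsion_val ga))).
apply: (etrans _ (esym (root_torsion_val gsa))).
exact: (jacobian_act_root_class _ _ (abs_gal_curve_aut f s)).
Qed.

Lemma root_torsion2 a : root g a -> root_torsion a *+ 2 = 0.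
Proof.
move=> ga; apply: val_inj; apply: (etrans (raddfMn (val : torsion J 2 -> J) _ _)).
exact: (etrans (congr1 (fun x => x *+ 2) (root_torsion_val ga)) (root_class2 _ _ ga)).
Qed.

Lemma torsion_val_sum S : {subset S <= root g} ->
  torsion_val (\sum_(a <- S) root_torsion a) = \sum_(a <- S) root_class odd_g sep_g a.
Proof.
move=> sS; apply: etrans (raddf_sum (val : torsion J 2 -> J) _ _ _) _.
by apply: eq_big_seq => a /sS; apply: root_torsion_val.
Qed.

Section Relations.

Variable rs : seq Kbar.
Hypotheses (uniq_rs : uniq rs) (mem_rs : forall a, root g a = (a \in rs)).
Hypothesis size_rs : size rs = (size g).-1.

Lemma J2_root_torsions (P : J2) : exists S,
  [/\ uniq S, {subset S <= rs} & P = \sum_(a <- S) root_torsion a].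
Proof.
have P2 : torsion_val P *+ 2 = 0 by case: P => P /=; rewrite unfold_in => /eqP.
have [S [uS sS PE]] := torsion2_root_classes sep_g two_neq0 uniq_rs mem_rs P2.
have sS' : {subset S <= root g} by move=> a /sS; rewrite -mem_rs.
exists S; split=> //; apply: val_inj.
exact: (etrans PE (esym (torsion_val_sum sS'))).
Qed.

Lemma root_torsion_relation S : uniq S -> {subset S <= rs} ->
  (\sum_(a <- S) root_torsion a == 0) = (S == [::]) || (size S == size rs).
Proof.
move=> uS sS; have sS' : {subset S <= root g} by move=> a /sS; rewrite -mem_rs.
apply/eqP/orP => [S0|[/eqP->|/eqP szS]]; last 2 first.
- by rewrite big_nil.
- suff S0 : \sum_(a <- S) root_class odd_g sep_g a = 0.
    by apply: val_inj; apply: (etrans (torsion_val_sum sS') S0).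
  rewrite -[RHS](sum_root_classes odd_g sep_g uniq_rs mem_rs size_rs).
  apply: perm_big; apply: uniq_perm => //.
  by have [] := uniq_min_size uS sS (eq_leq (esym szS)).
have := etrans (esym (torsion_val_sum sS')) (congr1 (@torsion_val J 2) S0).
move/(root_classes_relation two_neq0 mem_rs size_rs uS sS).
by case=> [->|->]; [left|right].
Qed.

End Relations.

End TwoTorsionModule.

Section GaloisModule.

Variables (K : fieldType) (Kbar : closedFieldType) (iota : {rmorphism K -> Kbar}).
Hypothesis charK0 : [pchar K] =i pred0.
Hypothesis Kbar_alg : algebraic_closure iota.
Variable f : {poly K}.
Hypotheses (sep_f : separable_poly f) (odd_f : odd (size f).-1).
Variables (L : splittingFieldType K) (j : {rmorphism L -> Kbar}).
Hypothesis L_KJ2 : is_K_of_J2 iota odd_f j.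

Local Notation g := (map_poly iota f).
Local Notation odd_g := (odd_map_iota iota odd_f).
Local Notation J2 := (J2 iota odd_f).
Local Notation fL := (map_poly (in_alg L) f).
Local Notation act := (@gal_J2_act K Kbar iota f odd_f L j).
Local Notation root_torsion := (root_torsion iota sep_f odd_f).

Lemma j_alg a : j a%:A = iota a. Proof. by case: L_KJ2. Qed.

Lemma map_j_fL : map_poly j fL = g.
Proof. by rewrite -map_poly_comp; apply: eq_map_poly => a /=; rewrite j_alg. Qed.

Lemma root_j x : root g (j x) = root fL x.
Proof. by rewrite -map_j_fL fmorph_root. Qed.

(** If s moved the root a, triviality on J[2] would give a relation between the two roots a and
    s(a), while relations have length 0 or d, which is odd. *)
Lemma J2_act_trivial s :
  (forall P : J2, J2_act s P = P) <-> (forall a, root g a -> s a = a).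
Proof.
have [rs [uniq_rs mem_rs size_rs]] := closure_roots iota sep_f odd_f.
split=> [triv a ga | triv P].
  have gsa : root g (s a) by rewrite -(root_caut (abs_gal_curve_aut f s)) in ga.
  apply/eqP; apply: contraT => ne_sa.
  have uS : uniq [:: s a; a] by rewrite /= inE ne_sa.
  have sS : {subset [:: s a; a] <= rs}.
    by move=> x; rewrite !inE -mem_rs => /orP[] /eqP->.
  have := root_torsion_relation charK0 sep_f odd_f uniq_rs mem_rs size_rs uS sS.
  rewrite big_cons big_seq1 -J2_act_root // triv -mulr2n root_torsion2 // eqxx.
  rewrite size_rs size_map_poly /= => /esym/eqP sz2.
  by move: odd_f; rewrite -sz2.
have [S [uS sS ->]] := J2_root_torsions charK0 sep_f uniq_rs mem_rs P.
rewrite (zmorph_sum (@J2_actB _ _ _ _ _ s)); apply: eq_big_seq => a /sS.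
rewrite -mem_rs => ga; apply: (etrans (J2_act_root sep_f odd_f s ga)).
by rewrite (triv a ga).
Qed.

Lemma gal_rmorph_alg (t : gal_of {:L}) a : t a%:A = a%:A.
Proof. by rewrite linearZ rmorph1. Qed.

Lemma root_gal (t : gal_of {:L}) x : root fL x -> root fL (t x).
Proof.
move=> fx; have -> : fL = map_poly t fL; last by rewrite fmorph_root.
by rewrite -map_poly_comp; apply: eq_map_poly => a /=; rewrite gal_rmorph_alg.
Qed.

Lemma gal_lift (t : gal_of {:L}) :
  exists s : abs_gal iota, forall a, s (j a) = j (t a).
Proof.
apply: (embedding_extend Kbar_alg (j1 := j) (j2 := j \o t)) => a.
by exists a%:A; rewrite /= gal_rmorph_alg j_alg.
Qed.

Lemma gal_J2_act_lift (t : gal_of {:L}) : exists2 s : abs_gal iota,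
  forall a, s (j a) = j (t a) & act t =1 J2_act s.
Proof.
rewrite /gal_J2_act; case: pselect => [lift|[]]; last exact: gal_lift.
by exists (projT1 (cid lift)) => //; apply: projT2 (cid lift).
Qed.

(** An automorphism acting trivially on J[2] fixes each root of f, so the roots lie in the field
    fixed by all of these, the image of L. *)
Lemma splitting_roots : exists rL : seq L,
  [/\ uniq rL, forall x, root fL x = (x \in rL), size rL = (size f).-1
    & forall a, root g a -> exists2 x, x \in rL & j x = a].
Proof.
have [rs [uniq_rs mem_rs size_rs]] := closure_roots iota sep_f odd_f.
have pre_ex a : exists x, a \in rs -> j x = a.
  have [ars|nars] := boolP (a \in rs); last by exists 0.
  have [x xa] : exists x, j x = a.
    by apply/(proj2 L_KJ2) => s' /J2_act_trivial; apply; rewrite mem_rs.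
  by exists x.
pose pre a := projT1 (cid (pre_ex a)).
have preK a : a \in rs -> j (pre a) = a := projT2 (cid (pre_ex a)).
have mem_pre x : root fL x = (x \in map pre rs).
  rewrite -root_j mem_rs; apply/idP/mapP => [xrs|[a ars ->]]; last by rewrite preK.
  by exists (j x) => //; apply: (fmorph_inj j); rewrite preK.
exists (map pre rs); split=> //.
- rewrite map_inj_in_uniq // => a b ars brs E.
  by rewrite -(preK a ars) -(preK b brs) E.
- by rewrite size_map size_rs size_map_poly.
move=> a; rewrite mem_rs => ars; exists (pre a); last exact: preK.
exact: map_f.
Qed.

Section RootAction.

Variable rL : seq L.
Hypotheses (uniq_rL : uniq rL) (mem_rL : forall x, root fL x = (x \in rL)).
Hypothesis size_rL : size rL = (size f).-1.
Hypothesis root_rL : forall a, root g a -> exists2 x, x \in rL & j x = a.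

Local Notation I := (seq_sub rL).

Definition gal_root (i : I) (t : gal_of {:L}) : I := insubd i (t (ssval i)).

Lemma gal_rootE i t : ssval (gal_root i t) = t (ssval i).
Proof. by rewrite /gal_root insubdK // -topredE /= -mem_rL root_gal // mem_rL ssvalP. Qed.

Fact gal_root1 : gal_root^~ 1%g =1 id.
Proof. by move=> i; apply: val_inj; rewrite /= gal_rootE gal_id. Qed.

Fact gal_rootM i : act_morph gal_root i.
Proof. by move=> s t; apply: val_inj; rewrite /= !gal_rootE galM ?memvf. Qed.

Definition root_action : {action gal_of {:L} &-> I} := TotalAction gal_root1 gal_rootM.

Lemma root_actionE i t : ssval (root_action i t) = t (ssval i).
Proof. exact: gal_rootE. Qed.

Definition root_class_at (i : I) : J2 := root_torsion (j (ssval i)).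

Let root_ssval (i : I) : root g (j (ssval i)).
Proof. by rewrite root_j mem_rL ssvalP. Qed.

Lemma gal_actB t : zmod_morphism (act t).
Proof.
by have [s _ actE] := gal_J2_act_lift t; move=> x y; rewrite !actE; apply: J2_actB.
Qed.

Lemma gal_act_root t i : act t (root_class_at i) = root_class_at (root_action i t).
Proof.
have [s st actE] := gal_J2_act_lift t; rewrite actE.
apply: (etrans (J2_act_root sep_f odd_f s (root_ssval i))).
by rewrite /root_class_at root_actionE st.
Qed.

Lemma root_class_at2 i : root_class_at i *+ 2 = 0.
Proof. exact: root_torsion2. Qed.

Let roots_of (c : {ffun I -> bool}) := [seq j (ssval i) | i <- enum {: I} & c i].

Let indicE c : indic_sum root_class_at c = \sum_(a <- roots_of c) root_torsion a.
Proof.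
rewrite big_map big_filter big_enum_cond /= [RHS]big_mkcond.
by apply: eq_bigr => i _; case: (c i).
Qed.

Let j_ssval_inj : injective (fun i : I => j (ssval i)).
Proof. by move=> i i' /fmorph_inj/val_inj. Qed.

Let uniq_roots_of c : uniq (roots_of c).
Proof. by rewrite (map_inj_uniq j_ssval_inj) filter_uniq ?enum_uniq. Qed.

Let rs := map j rL.

Let uniq_rs : uniq rs.
Proof. by rewrite (map_inj_uniq (fmorph_inj j)). Qed.

Let mem_rs a : root g a = (a \in rs).
Proof.
apply/idP/mapP => [/root_rL[x xrL <-]|[x xrL ->]]; first by exists x.
by rewrite root_j mem_rL.
Qed.

Let size_rs : size rs = (size g).-1.
Proof. by rewrite size_map size_map_poly. Qed.

Let sub_roots_of c : {subset roots_of c <= rs}.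
Proof. by move=> _ /mapP[i _ ->]; rewrite -mem_rs. Qed.

Lemma root_class_gen P : exists c, P = indic_sum root_class_at c.
Proof.
have [S [uS sS ->]] := J2_root_torsions charK0 sep_f uniq_rs mem_rs P.
exists [ffun i => j (ssval i) \in S]; rewrite indicE; apply: perm_big.
apply: uniq_perm => // a; apply/idP/mapP => [aS|[i + ->]]; last first.
  by rewrite mem_filter ffunE => /andP[].
have /mapP[x xrL ax] := sS a aS; exists (SeqSub xrL) => //.
by rewrite mem_filter ffunE /= -ax aS mem_enum.
Qed.

Lemma root_class_rel c : (indic_sum root_class_at c == 0) = [forall i, forall l, c i == c l].
Proof.
rewrite indicE.
have -> := root_torsion_relation charK0 sep_f odd_f uniq_rs mem_rs size_rs
  (uniq_roots_of c) (@sub_roots_of c).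
have -> : size rs = size (enum {: I}) by rewrite -cardT size_map card_seq_sub.
rewrite -size_eq0 size_map size_filter -all_count -leqn0 leqNgt -has_count.
apply/orP/forallP => [c_const i|c_const].
  apply/forallP => l; case: c_const => [/hasPn|/allP] c_const.
    by rewrite (negPf (c_const i _)) ?mem_enum // (negPf (c_const l _)) ?mem_enum.
  by rewrite !c_const ?mem_enum.
have [/hasP[i _ ci]|] := boolP (has c (enum {: I})); last by left.
by right; apply/allP => l _; move/forallP: (c_const i) => /(_ l)/eqP <-.
Qed.

End RootAction.

End GaloisModule.

(** * Freeness and the degree of L over the field of two roots *)

Section GaloisFreeness.

Variables (K : fieldType) (charK0 : [pchar K] =i pred0).
Variables (L : splittingFieldType K) (f : {poly K}).

Local Notation fL := (map_poly (in_alg L) f).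
Local Notation Gal := ('Gal({:L} / 1)%G).

Lemma galois_pchar0 (E : {subfield L}) : galois E {:L}.
Proof.
apply/and3P; split; [exact: subvf| |exact: normalFieldf].
apply/separableP => y _; apply: pcharf0_separable => p.
by rewrite pchar_lalg charK0.
Qed.

Lemma mem_Gal (E : {subfield L}) (t : gal_of {:L}) :
  (E <= fixedField <[t]>%g)%VS -> t \in 'Gal({:L} / E)%g.
Proof.
move=> sE; apply: (subsetP (galS {:L} sE)).
by rewrite gal_fixedField cycle_id.
Qed.

Lemma mem_fixedField_cycle (t : gal_of {:L}) x : (x \in fixedField <[t]>%g) = (t x == x).
Proof.
apply/fixedFieldP/eqP => [|fix_x|tx]; first exact: memvf.
  by apply: fix_x; rewrite cycle_id.
move=> _ /cycleP[n ->]; elim: n => [|n IH]; first by rewrite expg0 gal_id.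
by rewrite expgS galM ?memvf // tx.
Qed.

Lemma mem_Gal1 (t : gal_of {:L}) : t \in Gal.
Proof. by apply: mem_Gal; apply: sub1v. Qed.

Lemma mem_Gal_adjoin2 (t : gal_of {:L}) x y :
  (t \in 'Gal({:L} / <<1 & [:: x; y]>>)%g) = (t x == x) && (t y == y).
Proof.
apply/idP/andP => [tE|[tx ty]].
  have fixE z : z \in <<1 & [:: x; y]>>%VS -> t z == z.
    by move=> zE; rewrite (fixed_gal (subvf _) tE).
  by split; apply/fixE/seqv_sub_adjoin; rewrite !inE eqxx ?orbT.
apply: mem_Gal; apply/Fadjoin_seqP; split; first exact: sub1v.
by move=> z; rewrite !inE => /orP[] /eqP ->; rewrite mem_fixedField_cycle.
Qed.

Variable rL : seq L.
Hypothesis mem_rL : forall x, root fL x = (x \in rL).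

Local Notation I := (seq_sub rL).
Local Notation to := (root_action mem_rL).

Lemma root_action_fixE (i : I) t : (to i t == i) = (t (ssval i) == ssval i).
Proof. by rewrite -val_eqE; exact: (congr1 (eq_op^~ (ssval i)) (root_actionE mem_rL i t)). Qed.

Variables (G2 : {group gal_of {:L}}) (i0 : I).
Hypothesis sylG2 : (2.-Sylow(Gal) G2)%g.
Hypothesis fix0 : forall t, t \in G2 -> to i0 t = i0.

(** An even degree gives by Cauchy an involution fixing i and l. A conjugate of it lies in G_2 and
    fixes two distinct roots, one of which is not i0. *)
Lemma free_odd_dim (i l : I) : free_off_fixed to G2 i0 -> i != l ->
  odd (\dim_(<<1 & [:: ssval i; ssval l]>>%VS) {:L}).
Proof.
move=> free ne_il; rewrite galois_dim ?galois_pchar0 //.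
set H := 'Gal(_ / _)%g; apply: contraT; rewrite -dvdn2 => even_H.
have [u uH ou] := Cauchy (isT : prime 2) even_H.
have pu : (2.-group <[u]>)%g by rewrite /pgroup -orderE ou.
have [|x _ sx] := Sylow_Jsub sylG2 _ pu; first by rewrite cycle_subG mem_Gal1.
have uxG2 : (u ^ x)%g \in G2 by apply: (subsetP sx); rewrite memJ_conjg cycle_id.
have fixJ m : (to m u == m) -> to (to m x) (u ^ x)%g = to m x.
  by move=> /eqP um; rewrite conjgE !actM actK um.
move: uH; rewrite mem_Gal_adjoin2 -!root_action_fixE => /andP[ui ul].
have ux1 : (u ^ x)%g = 1%g.
  have [ix0|] := eqVneq (to i x) i0; last by move=> nix; apply: free (fixJ i ui).
  apply: free (fixJ l ul) => //; rewrite -ix0.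
  by apply: contra_neq ne_il => /act_inj.
by move: ou; rewrite -(orderJ u x) ux1 order1.
Qed.

(** An element of G_2 that fixes i fixes i0 too, so its order, a power of 2, divides the odd degree
    of L over the field of these two roots. *)
Lemma odd_dim_free :
  (forall i l : I, i != l -> odd (\dim_(<<1 & [:: ssval i; ssval l]>>%VS) {:L})) ->
  free_off_fixed to G2 i0.
Proof.
move=> odd_dim i t ne_i tG2 ti; apply/eqP; rewrite -order_eq1.
have p_t : (2.-nat #[t]%g)%N.
  exact: (mem_p_elt (pHall_pgroup sylG2) tG2).
have odd_t : odd #[t]%g.
  have := odd_dim _ _ ne_i; rewrite galois_dim ?galois_pchar0 //.
  apply: dvdn_odd; apply: order_dvdG.
  by rewrite mem_Gal_adjoin2 -!root_action_fixE ti fix0 // !eqxx.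
by apply/eqP; apply: (pnat_1 p_t); rewrite -odd_2'nat.
Qed.

End GaloisFreeness.

(** * Freeness and the factorization over the fixed field of G_2 *)

Section FixedFieldFactorization.

Variables (K : fieldType) (L : splittingFieldType K) (G2 : {group gal_of {:L}}).

Local Notation W := ([aspace of fixedField G2] : {subfield L}).

Lemma minPoly_free x : (forall t, t \in G2 -> t x = x -> t = 1%g) ->
  minPoly W x = \prod_(t in G2) ('X - (t x)%:P).
Proof.
move=> free.
have /galois_factors := fixedField_galois G2 => /(_ (subvf _) x (memvf x))[r [sr ur mE]].
have root_m t : t \in G2 -> root (minPoly W x) (t x).
  by move=> tG; rewrite root_minPoly_gal ?subvf ?memvf // gal_fixedField.
rewrite gal_fixedField in sr; rewrite mE in root_m *.
have inj : {in G2 &, injective (fun t : gal_of {:L} => t x)}.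
  move=> s t sG tG E; apply/eqP; rewrite eq_mulgV1; apply/eqP/free.
    by rewrite groupM ?groupV.
  by rewrite galM ?memvf // E -galM ?memvf // mulgV gal_id.
rewrite -[RHS]big_enum -(big_map (fun t : gal_of {:L} => t x) xpredT (fun b => 'X - b%:P)).
apply: perm_big; apply: uniq_perm => //.
  by rewrite map_inj_in_uniq ?enum_uniq // => s t; rewrite !mem_enum; apply: inj.
move=> b; apply/mapP/mapP => [[t tr ->]|[t tG ->]].
  by exists t => //; rewrite mem_enum (subsetP sr).
by rewrite mem_enum in tG; apply/mapP; rewrite -root_prod_XsubC root_m.
Qed.

(** The roots of the minimal polynomial are #G_2 distinct elements, all of the form t(x), so t is
    determined by t(x). *)
Lemma size_minPoly_free x : size (minPoly W x) = #|G2|.+1 ->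
  forall t, t \in G2 -> t x = x -> t = 1%g.
Proof.
have /galois_factors := fixedField_galois G2 => /(_ (subvf _) x (memvf x))[r [sr ur ->]].
rewrite gal_fixedField in sr; rewrite size_prod_XsubC => -[size_r] t tG2 tx.
have inj : {in G2 &, injective (fun t : gal_of {:L} => t x)}.
  apply/dinjectiveP; rewrite /dinjectiveb -[uniq _]negbK -ltn_size_undup -leqNgt.
  rewrite size_map -cardE -size_r; apply: uniq_leq_size => // _ /mapP[s sr' ->].
  by rewrite mem_undup; apply/mapP; exists s; rewrite ?mem_enum ?(subsetP sr).
by apply: inj; rewrite ?group1 // gal_id.
Qed.

(** Transfers the minimal polynomial, whose coefficients are elements of L lying in W, to the field
    type [subvs_of W] over which the factorization is stated. *)
Lemma subvs_minPoly x : exists q : {poly subvs_of W},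
  [/\ map_poly vsval q = minPoly W x, irreducible_poly q &
    forall p : {poly subvs_of W}, root (map_poly vsval p) x -> q %| p].
Proof.
have /polyOver_subvs[q qE] := minPolyOver W x; exists q; split=> //.
  split=> [|p ne1]; last rewrite -(dvdp_map vsval).
  - by rewrite -(size_map_poly vsval) -qE size_minPoly.
  rewrite -qE => /minPoly_irr-/(_ _)/orP[|p_min|p1].
  - by apply/polyOver_subvs; exists p.
  - by rewrite -(eqp_map vsval) -qE.
  by move: ne1; rewrite -(size_map_poly vsval) (eqp_size p1) size_poly1 eqxx.
move=> p px; rewrite -(dvdp_map vsval) -qE; apply: minPoly_dvdp => //.
by apply/polyOver_subvs; exists p.
Qed.

Section Factorization.

Variable f : {poly K}.

Local Notation fL := (map_poly (in_alg L) f).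

Variable rL : seq L.
Hypotheses (uniq_rL : uniq rL) (mem_rL : forall x, root fL x = (x \in rL)).
Hypothesis size_rL : size rL = (size f).-1.
Hypothesis f0 : f != 0.

Local Notation I := (seq_sub rL).
Local Notation to := (root_action mem_rL).

Variable i0 : I.
Hypothesis fix0 : forall t, t \in G2 -> to i0 t = i0.

Definition fixed_field_factorization :=
  exists (l : {poly subvs_of W}) (s : seq {poly subvs_of W}),
    [/\ size l = 2%N,
        size s = (((size f).-1 - 1) %/ #|G2|)%N,
        forall p, p \in s -> irreducible_poly p /\ (size p).-1 = #|G2|
      & map_poly (in_alg (subvs_of W)) f = l * \prod_(p <- s) p].

Let val_fW : map_poly vsval (map_poly (in_alg (subvs_of W)) f) = fL.
Proof.
rewrite -map_poly_comp; apply: eq_map_poly => a.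
exact: (rmorph_alg (vsval : subvs_of W -> L)).
Qed.

Let to_fix i t : to i t = i -> t (ssval i) = ssval i.
Proof. by move/eqP; rewrite root_action_fixE => /eqP. Qed.

Let fix_to i (t : gal_of {:L}) : t (ssval i) = ssval i -> to i t = i.
Proof. by move/eqP; rewrite -(root_action_fixE mem_rL) => /eqP. Qed.

Let fL_prod : fL = (lead_coef f)%:A *: \prod_(i : I) ('X - (ssval i)%:P).
Proof.
rewrite -(big_enum _ _ _ (fun i : I => 'X - (ssval i)%:P)) /=.
rewrite -(big_map (fun i : I => ssval i) xpredT (fun x => 'X - x%:P)) /=.
have -> : (lead_coef f)%:A = lead_coef fL by rewrite lead_coef_map.
rewrite (perm_big rL) /=; last first.
  apply: uniq_perm => //.
    by rewrite map_inj_uniq ?enum_uniq //; apply: val_inj.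
  move=> x; apply/mapP/idP => [[i _ ->]|xrL]; first exact: ssvalP.
  by exists (SeqSub xrL); rewrite ?mem_enum.
apply: all_roots_prod_XsubC; last by rewrite uniq_rootsE.
  by rewrite size_map_poly size_rL prednK // size_poly_gt0.
by apply/allP => x; rewrite -mem_rL.
Qed.

Let i0W : ssval i0 \in W.
Proof. by apply/fixedFieldP => [|t tG]; [exact: memvf|exact/to_fix/fix0]. Qed.

Lemma free_factorization : free_off_fixed to G2 i0 -> fixed_field_factorization.
Proof.
move=> free; have [T [T0 card_T big_T]] := free_orbits_big fix0 free.
pose q (i : I) := projT1 (cid (subvs_minPoly (ssval i))).
have qP (i : I) : [/\ map_poly vsval (q i) = minPoly W (ssval i), irreducible_poly (q i) &
    forall p : {poly subvs_of W}, root (map_poly vsval p) (ssval i) -> q i %| p].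
  exact: projT2 (cid (subvs_minPoly (ssval i))).
have minE i : i \in T -> minPoly W (ssval i) = \prod_(t in G2) ('X - (ssval (to i t))%:P).
  move=> iT; rewrite minPoly_free => [|t tG ti]; last exact: (free i t (T0 i iT) tG (fix_to ti)).
  by apply: eq_bigr => t _; rewrite root_actionE.
(* The leading coefficient of f goes into the linear factor, whose root i0 is in W; the other
   factors are the minimal polynomials of one root per orbit. *)
exists ((lead_coef f)%:A *: ('X - (Subvs i0W)%:P)), [seq q i | i <- enum T]; split.
- by rewrite size_scale ?size_XsubC // scaler_eq0 oner_eq0 lead_coef_eq0 orbF.
- rewrite size_map -cardE -size_rL -(card_seq_sub uniq_rL).
  rewrite subn1 [X in (X %/ _)%N]card_T mulnK ?cardG_gt0 //.
- move=> _ /mapP[i + ->]; rewrite mem_enum => iT; have [qE irr _] := qP i.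
  split=> //; rewrite -(size_map_poly vsval) qE minE //.
  by rewrite -big_enum size_prod_XsubC -cardE.
apply: (map_inj_poly (f := vsval)) => //; first exact: val_inj.
rewrite val_fW fL_prod rmorphM /= map_polyZ rmorphB /= map_polyX map_polyC /=.
rewrite rmorph_prod /= big_map big_enum /= (bigD1 i0) //= -scalerAl.
congr (_ *: (_ * _)); first by apply/esym; exact: (rmorph_alg (vsval : subvs_of W -> L)).
rewrite (big_T _ _ _ (fun i => 'X - (ssval i)%:P)).
by apply: eq_bigr => i iT; have [-> _ _] := qP i; rewrite minE.
Qed.

(** A root of a factor of degree #G_2 has trivial stabilizer. If i is instead the root of the linear
    factor, then i0 is a root of one of the others; being fixed by G_2, it makes G_2 trivial. *)
Lemma factorization_free : fixed_field_factorization -> free_off_fixed to G2 i0.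
Proof.
move=> [l [s [size_l _ sP fE]]] i t ne_i tG ti.
have free_root x p : p \in s -> root (map_poly vsval p) x ->
    forall t, t \in G2 -> t x = x -> t = 1%g.
  move=> /sP[[_ irr] size_p] px; apply: size_minPoly_free.
  have [q [qE [size_q _] q_dvd]] := subvs_minPoly x.
  rewrite -qE size_map_poly (eqp_size (irr _ _ (q_dvd p px))).
    by have := cardG_gt0 G2; rewrite -size_p; case: (size p).
  by rewrite neq_ltn size_q orbT.
have root_cases (m : I) : root (map_poly vsval l) (ssval m) \/
    exists2 p, p \in s & root (map_poly vsval p) (ssval m).
  have : root fL (ssval m) by rewrite mem_rL; exact: ssvalP m.
  rewrite -val_fW fE rmorphM /= rootM => /orP[|]; first by left.
  rewrite rmorph_prod /= => /rootP; rewrite horner_prod => /eqP.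
  by rewrite prodf_seq_eq0 => /hasP[p ps /= rp]; right; exists p.
have [li|[p ps pi]] := root_cases i; last exact: free_root ps pi t tG (to_fix ti).
have [l0|[p ps p0]] := root_cases i0.
  have l_neq0 : map_poly vsval l != 0 by rewrite -size_poly_eq0 size_map_poly size_l.
  have : (size [:: ssval i; ssval i0] < size (map_poly (vsval : subvs_of W -> L) l))%N.
    apply: max_poly_roots => //=; first by rewrite li l0.
    by rewrite inE (inj_eq val_inj) ne_i.
  by rewrite size_map_poly size_l.
exact: free_root ps p0 t tG (to_fix (fix0 tG)).
Qed.

End Factorization.

End FixedFieldFactorization.

Theorem lemma5p1 (K : fieldType) (charK0 : [pchar K] =i pred0)
  (Kbar : closedFieldType) (iota : {rmorphism K -> Kbar})
  (Kbar_alg : algebraic_closure iota)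
  (f : {poly K}) (sep_f : separable_poly f)
  (odd_f : odd (size f).-1) (ge3_f : (3 <= (size f).-1)%N)
  (L : splittingFieldType K) (j : {rmorphism L -> Kbar})
  (L_KJ2 : is_K_of_J2 iota odd_f j)
  (G2 : {group gal_of {:L}}) (sylG2 : (2.-Sylow('Gal({:L} / 1)) G2)%g) :
  let d := (size f).-1 in
  let act := @gal_J2_act K Kbar iota f odd_f L j in
  let W := [aspace of fixedField G2] : {subfield L} in
  [<-> H1_vanish (res_act act G2);
       coh_trivial act G2;
       coh_trivial act 'Gal({:L} / 1);
       exists (l : {poly subvs_of W}) (s : seq {poly subvs_of W}),
         [/\ size l = 2%N,
             size s = ((d - 1) %/ #|G2|)%N,
             forall p, p \in s -> irreducible_poly p /\ (size p).-1 = #|G2|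
           & map_poly (in_alg (subvs_of W)) f = l * \prod_(p <- s) p];
       forall alpha beta : Kbar,
         root (map_poly iota f) alpha -> root (map_poly iota f) beta ->
         alpha != beta ->
         exists a b : L, [/\ j a = alpha, j b = beta
           & odd (\dim_(<<1 & [:: a; b]>>%VS) {:L})] ].
Proof.
move=> d act W.
have [rL [uniq_rL mem_rL size_rL root_rL]] := splitting_roots charK0 sep_f L_KJ2.
have f0 : f != 0 by apply: contraTneq (odd_f) => ->; rewrite size_poly0.
have [i0 fix0] : exists i0, forall t, t \in G2 -> root_action mem_rL i0 t = i0.
  apply: two_group_fixed_point (pHall_pgroup sylG2) _.
  by rewrite card_seq_sub // size_rL.
have H := sylow_coh_trivial (gal_actB Kbar_alg L_KJ2)
  (gal_act_root Kbar_alg sep_f L_KJ2 mem_rL) (root_class_at2 sep_f L_KJ2 mem_rL)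
  (root_class_gen charK0 sep_f L_KJ2 uniq_rL mem_rL root_rL)
  (root_class_rel charK0 sep_f L_KJ2 uniq_rL mem_rL size_rL root_rL) sylG2 fix0.
have H4 : fixed_field_factorization G2 f -> free_off_fixed (root_action mem_rL) G2 i0.
  exact: factorization_free.
tfae.
- by move/(H 0 1).
- by move/(H 1 2).
- by move/(H 2 3)/(free_factorization uniq_rL size_rL f0 fix0).
- move/H4 => free alpha beta /root_rL[a arL <-] /root_rL[b brL <-] ne_ab.
  exists a, b; split=> //.
  have ne_I : SeqSub arL != SeqSub brL by apply: contra_neq ne_ab => - [->].
  exact: (free_odd_dim charK0 sylG2 free ne_I).
move=> odd_dim; apply/(H 3 0)/(odd_dim_free charK0 sylG2 fix0) => i l ne_il.
have root_i (m : seq_sub rL) : root (map_poly iota f) (j (ssval m)).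
  by rewrite (root_j L_KJ2) mem_rL ssvalP.
have [|a [b [/fmorph_inj-> /fmorph_inj-> //]]] := odd_dim _ _ (root_i i) (root_i l).
by rewrite (inj_eq (fmorph_inj j)) (inj_eq val_inj).
Qed.
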